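(* Let $p=p(n)$ satisfy $\frac{\log^4 n}{n^{1/3}}\leq p\leq 1-\frac{\log^{5/2} n}{n^{1/5}}$. Then, asymptotically almost surely (that is, with probability tending to $1$ as $n\to\infty$), the random digraph $D_{n,p}$ is consistent.
   Context: A digraph $D=(V(D),E(D))$ is loopless and, for each pair of distinct vertices, has at most one edge in each direction. $D_{n,p}$ is the random digraph on vertex set $\{1,\dots,n\}$ in which each of the $n(n-1)$ possible directed edges is included independently with probability $p$. For a vertex $v$, $d_D^+(v)$ and $d_D^-(v)$ denote the out- and indegree of $v$ in $D$; the excess at $v$ is $\mathrm{ex}_D(v)=d_D^+(v)-d_D^-(v)$, and the excess of $D$ is $\mathrm{ex}(D)=\frac12\sum_{v\in V(D)}|\mathrm{ex}_D(v)|$. A path decomposition of $D$ is a collection of (directed) paths of $D$ (with no repeated vertices) whose edge sets partition $E(D)$. The path number $\mathrm{pn}(D)$ is the minimum number of paths in a path decomposition of $D$; one always has $\mathrm{pn}(D)\geq\mathrm{ex}(D)$. $D$ is called consistent if $\mathrm{pn}(D)=\mathrm{ex}(D)$. Logarithms are natural. *)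

(* Defs.v *)
From HB Require Import structures.
From mathcomp Require Import all_boot all_order all_algebra.
From mathcomp Require Import all_classical all_reals all_analysis.

Set Implicit Arguments.
Unset Strict Implicit.
Unset Printing Implicit Defensive.

Import Order.TTheory GRing.Theory Num.Theory.
Import numFieldNormedType.Exports.

Local Open Scope ring_scope.

(* A loopless digraph on T; the edge (u, v) is directed from u to v. Since the
   edges form a subset of T * T, there is at most one in each direction. *)
Record digraph (T : finType) := Digraph {
  edges : {set T * T};
  edges_loopless : [forall v, (v, v) \notin edges] }.

HB.instance Definition _ (T : finType) := [isSub for @edges T].
HB.instance Definition _ (T : finType) := [Finite of digraph T by <:].

Section Digraph.
Context (T : finType) (D : digraph T).

Definition edge : rel T := fun u v => (u, v) \in edges D.

Definition outdeg (v : T) : nat := #|[set w | edge v w]|.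
Definition indeg (v : T) : nat := #|[set u | edge u v]|.

Definition vertex_excess (v : T) : int := (outdeg v)%:Z - (indeg v)%:Z.

Definition excess : rat := (\sum_(v : T) `|vertex_excess v|)%:~R / 2.

(* A directed path is given by the sequence of its vertices. *)
Definition dipath (s : seq T) : bool := uniq s && sorted edge s.

Definition path_edges (s : seq T) : {set T * T} :=
  [set e in zip s (behead s)].

(* The parts of a partition are nonempty, so each path has at least one edge. *)
Definition path_decomposition (P : seq (seq T)) : bool :=
  [&& all dipath P, uniq [seq path_edges s | s <- P]
    & finset.partition [set A in [seq path_edges s | s <- P]] (edges D)].

Lemma path_decomposition_exists :
  exists k, `[< exists2 P, path_decomposition P & size P = k >].
Proof.
pose P := [seq [:: e.1; e.2] | e <- enum (edges D)].
have PE : [seq path_edges s | s <- P] = [seq [set e] | e <- enum (edges D)].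
  rewrite -map_comp; apply: eq_map => -[u v] /=.
  by apply/setP => e; rewrite !inE.
exists (size P); apply/asboolP; exists P => //; rewrite /path_decomposition PE.
apply/and3P; split.
- apply/allP => s /mapP[[u v]]; rewrite mem_enum => uvD ->.
  rewrite /dipath /= /edge uvD inE !andbT; apply/eqP => uv.
  by move/forallP: (edges_loopless D) => /(_ u); rewrite {2}uv uvD.
- by rewrite (map_inj_uniq (@set1_inj _)) enum_uniq.
- rewrite /finset.partition; apply/and3P; split.
  + apply/eqP/setP => e; apply/finset.bigcupP/idP => [[A]|eD].
      by rewrite inE => /mapP[f]; rewrite mem_enum => fD -> /set1P->.
    by exists [set e]; rewrite ?set11// inE map_f// mem_enum.
  + apply/finset.trivIsetP => A B; rewrite !inE => /mapP[e _ ->] /mapP[f _ ->] ef.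
    by rewrite disjoints1 inE; apply: contra ef => /eqP->.
  + rewrite inE; apply/mapP => -[e _ /esym/eqP].
    by rewrite -cards_eq0 cards1.
Qed.

Definition path_number : nat := ex_minn path_decomposition_exists.

Definition consistent : bool := path_number%:R == excess.

End Digraph.

Section RandomDigraph.
Context (R : realType) (n : nat) (p : R).

(* The law of D_{n,p}: the n(n-1) ordered pairs of distinct vertices are
   independent edges of probability p (a probability when 0 <= p <= 1). *)
Definition Dnp_mass (D : digraph 'I_n) : R :=
  \prod_(e : 'I_n * 'I_n | e.1 != e.2) (if e \in edges D then p else 1 - p).

Definition Dnp_prob (A : pred (digraph 'I_n)) : R :=
  \sum_(D | A D) Dnp_mass D.

End RandomDigraph.

(* Main.v *)
(* Idea. Only n p q ^ 3 >= C log ^ 18 n is needed, where q = 1 - p. Split the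
   vertices into k blocks, the residue classes modulo an even k of order
   sqrt (n p / q), and decompose the complete digraph on the blocks into the k
   rotations of a zigzag Hamiltonian path. With high probability the bipartite
   graph between two consecutive blocks of a zigzag satisfies the cut condition
   for an r-factor with r close to its average degree; splitting the factor into
   perfect matchings and concatenating these along the zigzag gives paths that
   meet every block at most once. The sparse remainder is decomposed into short
   paths by letting walkers follow the permutations of a Birkhoff decomposition
   in a greedy order that rarely makes a walker revisit a vertex.

   At this point slightly too many paths start and end at each vertex v. By the
   Paley-Zygmund inequality a positive proportion of every block has excess of
   order sqrt (n p q), and likewise for deficiency. Arcs into v from vertices of
   large excess, and out of v to vertices of large deficiency, whose block
   differences the zigzags avoid, are reserved in advance: each superfluous path
   starting at v is prolonged backwards along a reserved arc, each superfluous
   path ending at v forwards, and the unused reserved arcs at v are paired into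
   paths of length two through v. In the end exactly max (ex v, 0) paths start
   at each v. *)

(* With b the block size, up to about b p paths of the block system start at a vertex v, whatever
   its excess, so of order b p arcs must be reserved at v for repairs. A repair moves a path end to
   a reserved neighbour x, which is harmless only while x has excess of the right sign to spare. The
   reserved arcs use h block differences, h being constant, so about h n p / k of them meet x, and
   this must stay below S = sqrt (n p q), the order of the excess. Hence k is of order n p / S =
   sqrt (n p / q).

   An r-factor whose degree has relative error e q then needs e ^ 2 p q b to exceed a multiple of
   log n, and p q b is of order sqrt (n p q ^ 3). With e = log ^ -4 n this is where the exponent 18
   comes from.

   That a path of the system meets each block at most once also helps the repairs: it contains at
   most h reserved neighbours of its end, so a free one remains. Finally, reserved arcs join nearby
   blocks, whereas large excess is detected on arcs to far blocks only, so the two are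
   independent. *)
Require Import Defs.
From mathcomp Require Import all_boot perm zify.

Set Implicit Arguments.
Unset Strict Implicit.
Unset Printing Implicit Defensive.

(** * Factors of bipartite graphs *)

Definition outn (T : finType) (F : {set T * T}) (u : T) := #|[set v | (u, v) \in F]|.
Definition inn (T : finType) (F : {set T * T}) (v : T) := #|[set u | (u, v) \in F]|.

Section Factor.
Context (T : finType) (G : {set T * T}) (r : nat).
Implicit Types (F : {set T * T}) (u v w : T).

Definition subfactor F :=
  [&& F \subset G, [forall u, outn F u <= r] & [forall v, inn F v <= r]].

Lemma outn_sum F u : outn F u = \sum_v ((u, v) \in F).
Proof. by rewrite /outn -sum1_card big_mkcond; apply: eq_bigr => v _; rewrite inE; case: ifP. Qed.

Lemma inn_sum F v : inn F v = \sum_u ((u, v) \in F).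
Proof. by rewrite /inn -sum1_card big_mkcond; apply: eq_bigr => u _; rewrite inE; case: ifP. Qed.

Lemma card_outn F : #|F| = \sum_u outn F u.
Proof.
under eq_bigr do rewrite outn_sum.
rewrite pair_big -sum1_card big_mkcond /=; apply: eq_bigr => -[u v] _ /=.
by case: ifP.
Qed.

Lemma card_inn F : #|F| = \sum_v inn F v.
Proof.
rewrite card_outn; under eq_bigr do rewrite outn_sum.
by rewrite exchange_big; apply: eq_bigr => v _; rewrite inn_sum.
Qed.

Lemma outn_setU1 F u w x : (u, w) \notin F ->
  outn ((u, w) |: F) x = (x == u) + outn F x.
Proof.
move=> uwF; rewrite !outn_sum (bigD1 w) //= [in RHS](bigD1 w) //= addnA; congr (_ + _).
  rewrite !inE xpair_eqE eqxx andbT; case: eqP => [->|]; last by [].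
  by rewrite (negbTE uwF).
by apply: eq_bigr => v vw; rewrite !inE xpair_eqE (negbTE vw) andbF.
Qed.

Lemma inn_setU1 F u w x : (u, w) \notin F ->
  inn ((u, w) |: F) x = (x == w) + inn F x.
Proof.
move=> uwF; rewrite !inn_sum (bigD1 u) //= [in RHS](bigD1 u) //= addnA; congr (_ + _).
  rewrite !inE xpair_eqE eqxx; case: eqP => [->|]; last by [].
  by rewrite (negbTE uwF).
by apply: eq_bigr => v vw; rewrite !inE xpair_eqE (negbTE vw).
Qed.

(** Exchanging [(u', w)] for [(u, w)] in [F] raises the out-degree of [u], lowers that of [u'] and
    changes no in-degree: one step of an alternating path. *)
Definition alt F u u' :=
  [exists w, [&& (u, w) \in G, (u, w) \notin F & (u', w) \in F]].

Lemma subfactorP F : reflect [/\ F \subset G, forall u, outn F u <= r & forall v, inn F v <= r]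
  (subfactor F).
Proof.
apply: (iffP and3P) => -[? ? ?]; split=> //; first by move=> u; apply/forallP: u.
- by move=> u; apply/forallP: u.
- exact/forallP.
- exact/forallP.
Qed.

(** Exchanging the arcs of the first step passes the deficiency from [u] to [u1] at constant size,
    and induction handles the rest. As the path is simple, [u] does not recur and [u1] occurs only
    as the start of the next step, so the later steps stay alternating. *)
Lemma augment p F u : subfactor F -> outn F u < r -> uniq (u :: p) -> path (alt F) u p ->
  (exists w, [/\ (last u p, w) \in G, (last u p, w) \notin F & inn F w < r]) ->
  exists2 F', subfactor F' & #|F'| = #|F|.+1.
Proof.
elim: p F u => [|u1 p IH] F u sF du.
  move=> _ _ /= [w [uwG uwF dw]]; exists ((u, w) |: F); last by rewrite cardsU1 uwF.
  have [sub out_r in_r] := subfactorP _ sF.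
  apply/subfactorP; split.
  - by rewrite subUset sub1set uwG.
  - by move=> x; rewrite outn_setU1 //; case: eqP => [->|_]; rewrite ?add0n.
  - by move=> x; rewrite inn_setU1 //; case: eqP => [->|_]; rewrite ?add0n.
move=> /= /and3P[]; rewrite inE negb_or => /andP[uu1 up] u1p pu /andP[/existsP[w0]].
move=> /and3P[uwG uwF u1wF] altp [w [lG lF dw]].
have [sub out_r in_r] := subfactorP _ sF.
have F0 : (u1, w0) |: (F :\ (u1, w0)) = F by rewrite setD1K.
set F1 := (u, w0) |: (F :\ (u1, w0)).
have uw1 : (u, w0) \notin F :\ (u1, w0) by rewrite !inE negb_and uwF orbT.
have u1w1 : (u1, w0) \notin F :\ (u1, w0) by rewrite !inE eqxx.
have outF x : outn F x = (x == u1) + outn (F :\ (u1, w0)) x.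
  by rewrite -{1}F0 outn_setU1.
have innF x : inn F x = (x == w0) + inn (F :\ (u1, w0)) x.
  by rewrite -{1}F0 inn_setU1.
have inF1 x : inn F1 x = inn F x by rewrite innF inn_setU1.
have outF1 x : outn F1 x + (x == u1) = (x == u) + outn F x.
  by rewrite outF outn_setU1 // -addnA; congr (_ + _); rewrite addnC.
have cF1 : #|F1| = #|F| by rewrite !card_inn; apply: eq_bigr.
have sF1 : subfactor F1.
  apply/subfactorP; split.
  - by rewrite subUset sub1set uwG (subset_trans (subsetDl _ _)).
  - move=> x; have := outF1 x; have := out_r x; move: du.
    by case: (x =P u) => [->|_]; case: eqP => _ /=; clear; lia.
  - by move=> x; rewrite inF1.
have d1 : outn F1 u1 < r.
  have := outF1 u1; rewrite eqxx eq_sym (negbTE uu1) /=; move: (out_r u1); clear; lia.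
have altF1 : {in u1 :: p, forall x, x != u}.
  move=> x; rewrite inE => /orP[/eqP->|xp]; first by rewrite eq_sym.
  by apply: contraNneq up => <-.
have keep x y : x != u -> (x, y) \notin F -> (x, y) \notin F1.
  by move=> xu xyF; rewrite !inE xpair_eqE (negbTE xu) (negbTE xyF) andbF.
have keep1 x y : x != u1 -> (x, y) \in F -> (x, y) \in F1.
  by move=> xu xyF; rewrite !inE !xpair_eqE xyF (negbTE xu) orbT.
rewrite -cF1; apply: (IH F1 u1) => //; first by rewrite /= u1p pu.
- have pu1 : {in p, forall x, x != u1} by move=> x xp; apply: contraNneq u1p => <-.
  suff claim z : z != u -> {in p, forall x, x != u} -> path (alt F) z p -> path (alt F1) z p.
    by apply: claim => // [|x xp]; apply: altF1; rewrite inE ?eqxx ?xp ?orbT.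
  elim: p pu1 z {IH up u1p pu lG lF altp altF1} => //= y p IHp yu1 z zu yu.
  move=> /andP[/existsP[w' /and3P[g1 g2 g3]] ap].
  rewrite IHp //; first last.
  + by move=> x xp; apply: yu; rewrite inE xp orbT.
  + by apply: yu; rewrite mem_head.
  + by move=> x xp; apply: yu1; rewrite inE xp orbT.
  rewrite andbT; apply/existsP; exists w'; rewrite g1 keep ?keep1 //.
  by apply: yu1; rewrite mem_head.
- by exists w; rewrite lG inF1; split=> //; apply: keep => //; apply: altF1; rewrite mem_last.
Qed.

(* A largest subgraph with all degrees at most r is r-regular: otherwise the
   vertices reachable from a deficient one by alternating paths violate the
   cut condition. *)
Lemma factorP :
    (forall X Y : {set T}, r * (#|X| + #|Y|) <= #|G :&: setX X Y| + r * #|T|) ->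
  exists F, [/\ F \subset G, forall u, outn F u = r & forall v, inn F v = r].
Proof.
move=> cut.
have s0 : subfactor set0.
  by apply/subfactorP; split=> [|u|v]; rewrite ?sub0set ?outn_sum ?inn_sum // big1 // => x _;
     rewrite inE.
pose F := [arg max_(F > set0 | subfactor F) #|F|].
have [sF maxF] : subfactor F /\ forall F', subfactor F' -> #|F'| <= #|F|.
  by rewrite /F; case: arg_maxnP.
have [sub out_r in_r] := subfactorP _ sF.
have [/forallP full|] := boolP [forall u, outn F u == r].
  exists F; split=> // [u|v]; first exact/eqP.
  have : \sum_v inn F v = \sum_(v : T) r.
    by rewrite -card_inn card_outn; apply: eq_bigr => u _; apply/eqP.
  move=> e; apply/eqP; rewrite eqn_leq in_r /= leqNgt; apply/negP => lt.
  suff : \sum_v inn F v < \sum_(v : T) r by rewrite e ltnn.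
  rewrite (bigD1 v) //= [in X in _ < X](bigD1 v) //= -addSn leq_add //.
  exact: leq_sum.
rewrite negb_forall => /existsP[u0 du0]; have {}du0 : outn F u0 < r.
  by rewrite ltn_neqAle du0 out_r.
pose S := [set u | connect (alt F) u0 u].
pose W := [set w | [exists u, [&& u \in S, (u, w) \in G & (u, w) \notin F]]].
have u0S : u0 \in S by rewrite inE connect0.
(* A vertex of [W] with spare in-degree would end an augmenting path. *)
have fullW w : w \in W -> inn F w = r.
  rewrite inE => /existsP[u /and3P[]]; rewrite inE => /connectP[p0 p0P ->].
  case/shortenP: p0P => p pP pU _ uwG uwF.
  apply/eqP; rewrite eqn_leq in_r leqNgt /=; apply/negP => dw.
  have [|F' sF'] := augment sF du0 pU pP; first by exists w.
  by move=> cF'; have := maxF _ sF'; rewrite cF' ltnn.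
have FW u w : w \in W -> (u, w) \in F -> u \in S.
  rewrite inE => /existsP[u' /and3P[u'S uwG uwF]] uF.
  move: u'S; rewrite !inE => c; apply: (connect_trans c); apply: connect1.
  by apply/existsP; exists w; apply/and3P.
have eGF : G :&: setX S (~: W) = F :&: setX S (~: W).
  apply/setP => -[u w]; rewrite !inE /=.
  have [uF|uF] := boolP ((u, w) \in F); first by rewrite (subsetP sub _ uF).
  apply/negbTE; apply/negP => /and3P[uG uS] /negP; apply; apply/existsP.
  by exists u; rewrite inE uS uG.
have cS : #|F :&: setX S (~: W)| + #|F :&: setX S W| = \sum_(u in S) outn F u.
  under eq_bigr do rewrite outn_sum.
  rewrite pair_big_dep /= -!sum1_card; rewrite [X in X + _]big_mkcond [X in _ + X]big_mkcond [RHS]big_mkcond /= -big_split /=.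
  apply: eq_bigr => -[u w] _ /=; rewrite !in_setI !in_setX in_setC /=.
  by case: ((u, w) \in F); case: (u \in S); case: (w \in W).
have cW : #|F :&: setX S W| = \sum_(w in W) inn F w.
  under eq_bigr do rewrite inn_sum.
  rewrite exchange_big pair_big_dep /= -sum1_card big_mkcond [RHS]big_mkcond /=.
  apply: eq_bigr => -[u w] _; rewrite in_setI in_setX /=.
  case: (boolP ((u, w) \in F)) => uF //=; last by case: ifP.
  by case: (boolP (w \in W)) => wW; rewrite ?andbT ?andbF // (FW _ _ wW uF).
have cW' : \sum_(w in W) inn F w = #|W| * r.
  by rewrite (eq_bigr (fun=> r)) ?sum_nat_const // => w /fullW.
have cS' : \sum_(u in S) outn F u < #|S| * r.
  rewrite -sum_nat_const (bigD1 u0) //= [in X in _ < X](bigD1 u0) //= -addSn leq_add //.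
  exact: leq_sum.
(* The arcs of [G] from [S] to [~: W] all lie in [F]. Their number is the out-degree sum of [S],
   below [r * #|S|] because of [u0], minus [r * #|W|]: too few for the cut condition. *)
have := cut S (~: W); rewrite eGF; have := cardsC W.
rewrite mulnDr [r * _]mulnC [r * #|~: _|]mulnC => <-; rewrite mulnDr ![r * #|_ |]mulnC.
move: cS'; rewrite -cS cW cW'; clear; lia.
Qed.
End Factor.

Section Permutations.
Context (T : finType).
Implicit Types (E G : {set T * T}) (u v : T).

(** Hall's theorem: for r = 1 the cut condition is Hall's condition, and a 1-factor is the graph of
    a permutation. *)
Lemma perm_of_factor G :
    (forall X Y : {set T}, #|X| + #|Y| <= #|G :&: setX X Y| + #|T|) ->
  exists s : {perm T}, forall u, (u, s u) \in G.
Proof.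
move=> cut; have [X Y|F [FG out1 in1]] := @factorP T G 1; first by rewrite !mul1n.
have f_ex u : exists v, (u, v) \in F.
  have /card_gt0P[v] : 0 < outn F u by rewrite out1.
  by rewrite inE; exists v.
pose f u := xchoose (f_ex u); have fF u : (u, f u) \in F := xchooseP (f_ex u).
have f_inj : injective f.
  move=> u u' e; have /eqP/cards1P[w wE] := in1 (f u).
  have : u \in [set w] by rewrite -wE inE.
  have : u' \in [set w] by rewrite -wE inE e.
  by rewrite !inE => /eqP-> /eqP->.
by exists (perm f_inj) => u; rewrite permE (subsetP FG).
Qed.

(** [E] holds the real arcs, [L] the multiplicities of fake arcs that make the multigraph d-regular.
    Each permutation comes with the set of its arcs that count as real; where both kinds are
    available the real one is used up first, so each real arc is real in exactly one permutation. *)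
Lemma birkhoff E (L : T -> T -> nat) d :
    (forall u, outn E u + \sum_v L u v = d) ->
    (forall v, inn E v + \sum_u L u v = d) ->
  exists S : seq ({perm T} * {set T * T}), [/\ size S = d,
    forall s, s \in S -> forall u v, (u, v) \in s.2 -> s.1 u = v,
    forall e, \sum_(s <- S) (e \in s.2) = (e \in E)
    & forall u v, \sum_(s <- S) ((s.1 u == v) && ((u, v) \notin s.2)) = L u v].
Proof.
elim: d E L => [|d IH] E L row col.
  exists [::]; split=> //.
    move=> [u v]; rewrite big_nil; have := row u; rewrite outn_sum (bigD1 v) //=.
    by case: (_ \in E).
  by move=> u v; rewrite big_nil; have := row u; rewrite (bigD1 v) //=; lia.
pose W u v := ((u, v) \in E) + L u v.
have rowW u : \sum_v W u v = d.+1 by rewrite big_split /= -outn_sum row.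
have colW v : \sum_u W u v = d.+1 by rewrite big_split /= -inn_sum col.
pose G := [set e : T * T | 0 < W e.1 e.2].
have [s sG] : exists s : {perm T}, forall u, (u, s u) \in G.
  (* Of the weight (d + 1) #|X| leaving [X], at most (d + 1) #|~: Y| enters [~: Y], and each pair in
     [G] carries at most d + 1. *)
  apply: perm_of_factor => X Y; rewrite -(leq_pmul2l (ltn0Sn d)).
  have le1 : \sum_(u in X) \sum_(v in Y) W u v <= d.+1 * #|G :&: setX X Y|.
    rewrite pair_big_dep /= mulnC -sum_nat_const big_mkcond [X in _ <= X]big_mkcond /=.
    apply: leq_sum => -[u v] _; rewrite in_setI in_setX !inE /=.
    case: ifP => // _; rewrite andbT; case: ifP; last by case: (W u v).
    by move=> _; rewrite -(rowW u) (bigD1 v) //= leq_addr.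
  have le2 : \sum_(u in X) \sum_(v in ~: Y) W u v <= #|~: Y| * d.+1.
    rewrite exchange_big -sum_nat_const; apply: leq_sum => v _; rewrite -(colW v).
    by rewrite [X in _ <= X](bigID (mem X)) leq_addr.
  have e3 : \sum_(u in X) \sum_(v in Y) W u v + \sum_(u in X) \sum_(v in ~: Y) W u v
     = #|X| * d.+1.
    rewrite -big_split -sum_nat_const; apply: eq_bigr => u _ /=; rewrite -(rowW u).
    rewrite [RHS](bigID (mem Y)) /=; congr (_ + _).
    by apply: eq_bigl => v; rewrite inE.
  move: e3; rewrite -(cardsC Y) !mulnDr ![_ * d.+1]mulnC => <-.
  by rewrite [X in _ <= X]addnCA [X in X <= _]addnC leq_add2l leq_add // mulnC.
pose E1 := [set e in E | s e.1 == e.2].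
pose b u v := (s u == v) && ((u, v) \notin E1).
have bL u v : b u v <= L u v.
  rewrite /b; case: eqP => // <-; rewrite !inE eqxx andbT; have := sG u.
  by rewrite inE /W /=; case: (_ \in E).
have E1E e : (e \in E1) + (e \in E :\: E1) = (e \in E).
  by rewrite !inE; case: (e \in E); case: (_ == _).
have one u : \sum_v (s u == v) = 1.
  by rewrite (bigD1 (s u)) //= eqxx big1 // => v; rewrite eq_sym => /negbTE->.
have one' v : \sum_u (s u == v) = 1.
  rewrite (bigD1 (s^-1 v)%g) //= permKV eqxx big1 // => u.
  by rewrite -(inj_eq (@perm_inj _ s)) permKV => /negbTE->.
have be u v : ((u, v) \in E1) + b u v = (s u == v).
  by rewrite /b !inE /=; case: (_ \in E); case: (s u == v).
have [||S [sS graph part fakes]] := IH (E :\: E1) (fun u v => L u v - b u v).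
- move=> u; apply/eqP; rewrite -(eqn_add2l 1) -[X in X + _](one u) add1n -(row u).
  rewrite !outn_sum -!big_split /=; apply/eqP/eq_bigr => v _.
  by rewrite -E1E -be addnACA subnKC.
- move=> v; apply/eqP; rewrite -(eqn_add2l 1) -[X in X + _](one' v) add1n -(col v).
  rewrite !inn_sum -!big_split /=; apply/eqP/eq_bigr => u _.
  by rewrite -E1E -be addnACA subnKC.
exists ((s, E1) :: S); split=> /= [|t|e|u v].
- by rewrite sS.
- by rewrite inE => /orP[/eqP->|/graph//] u v; rewrite inE => /andP[_ /eqP].
- by rewrite big_cons part E1E.
- by rewrite big_cons fakes; move: (bL u v); clear; rewrite /b /=; lia.
Qed.
End Permutations.

(** * Decomposing a digraph into walks *)

Section Walks.
Context (T : finType).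
Implicit Types (E : {set T * T}) (u v x : T) (q : T * seq T) (e : T * T).

Definition arcs q := pairmap pair q.1 q.2.

Definition simple_path q := uniq (q.1 :: q.2).

(** Trivial paths [(v, [::])] are allowed: they carry no arc but do count in [starts], [ends] and
    the size. [path_decomposition_of] discards them. *)
Definition decomposes E (P : seq (T * seq T)) :=
  all simple_path P /\ forall e, \sum_(q <- P) count_mem e (arcs q) = (e \in E).

Definition starts (P : seq (T * seq T)) v := \sum_(q <- P) (q.1 == v).

Definition ends (P : seq (T * seq T)) v := \sum_(q <- P) (last q.1 q.2 == v).

Lemma arcs_rcons x0 p x : arcs (x0, rcons p x) = rcons (arcs (x0, p)) (last x0 p, x).
Proof. by rewrite /arcs /= -cats1 pairmap_cat cats1. Qed.

Lemma le_average (I : eqType) (S : seq I) (f : I -> nat) : 0 < size S ->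
  exists2 s, s \in S & size S * f s <= \sum_(t <- S) f t.
Proof.
case: S => // s0 S _; elim: S s0 => [|s1 S IH] s0.
  by exists s0; rewrite ?mem_head // big_seq1 mul1n.
have [s sS le] := IH s1; rewrite big_cons.
case: (leqP (f s) (f s0)) => c.
  exists s; first by rewrite inE sS orbT.
  by rewrite /= mulSn leq_add.
exists s0; first by rewrite mem_head.
by rewrite /= mulSn leq_add2l (leq_trans _ le) //= leq_mul // ltnW.
Qed.

Lemma sum_enum (f : T -> nat) (a : pred T) :
  \sum_(u <- enum T | a u) f u = \sum_(u | a u) f u.
Proof. by rewrite big_enum_cond. Qed.

(* The walks occupy all vertices, one each: [hist u] is the current piece of the
   walk at u. A piece is cut when it would revisit a vertex, when it meets an
   arc of the permutation outside the set of real arcs, and every k steps. The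
   exponential potential [\sum_v c v * 2 ^ rep v] tracks the number of cuts of
   the first kind; since [u] has at most k bad continuations, an averaging
   choice of the next permutation multiplies it by at most (M + k) / M. *)
Lemma greedy_walks k (M j : nat) (S : seq ({perm T} * {set T * T}))
    (hist : T -> T * seq T) (c : T -> nat) :
    0 < k -> size S = M -> j <= k ->
    (forall s, s \in S -> forall u v, (u, v) \in s.2 -> s.1 u = v) ->
    (forall s, s \in S -> forall u, (u, u) \notin s.2) ->
    (forall e, \sum_(s <- S) (e \in s.2) <= 1) ->
    (forall u, [/\ last (hist u).1 (hist u).2 = u, simple_path (hist u)
                 & size (hist u).2 + j <= k]) ->
  exists (P : seq (T * seq T)) (rep : T -> nat), [/\ all simple_path P,
    all (fun q => size q.2 <= k) P,
    forall e, \sum_(q <- P) count_mem e (arcs q) =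
       \sum_(s <- S) (e \in s.2) + \sum_u count_mem e (arcs (hist u)),
    forall v, starts P v <= \sum_u ((hist u).1 == v) + (M + k.-1 - j) %/ k
       + \sum_(s <- S) \sum_(u | u != v) ((s.1 u == v) && ((u, v) \notin s.2)) + rep v
    & \sum_v c v * 2 ^ rep v <= (\sum_v c v) * 'C(M + k, M)].
Proof.
move=> k_gt0; elim: M j S hist c => [|M IH] j S hist c sS jk graph noloop disj hP.
  exists [seq hist u | u <- enum T], (fun=> 0).
  rewrite (size0nil sS); split.
  - by apply/allP => q /mapP[u _ ->]; case: (hP u).
  - by apply/allP => q /mapP[u _ ->]; case: (hP u) => _ _; apply: leq_trans; rewrite leq_addr.
  - by move=> e; rewrite big_nil big_map sum_enum.
  - by move=> v; rewrite /starts big_map sum_enum -!addnA leq_addr.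
  - by rewrite add0n bin0 muln1; under eq_bigr do rewrite muln1.
(* Here [j] is the number of steps before the next periodic cut, and [(M + k.-1 - j) %/ k] the
   number of such cuts to come, the ceiling of (M - j) / k. At j = 0 all walks restart as trivial
   paths, one at each vertex, and this quotient drops by one. *)
wlog j_gt0 : j hist jk hP / 0 < j.
  case: j jk hP => [_ hP H|j jk hP H]; last exact: H.
  have [||//|P [rep [Ps Pk Pe Pst Pc]]] := H k (fun u => (u, [::])); first exact: leqnn.
    by move=> u; split.
  exists ([seq hist u | u <- enum T] ++ P), rep; split=> //.
  - by rewrite all_cat Ps andbT; apply/allP => q /mapP[u _ ->]; case: (hP u).
  - rewrite all_cat Pk andbT; apply/allP => q /mapP[u _ ->].
    by case: (hP u) => _ _; apply: leq_trans; rewrite leq_addr.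
  - move=> e; rewrite big_cat big_map sum_enum Pe /= addnC; congr (_ + _).
    by rewrite [X in _ + X]big1 ?addn0.
  - move=> v; rewrite /starts big_cat big_map sum_enum /= -!addnA leq_add2l.
    apply: leq_trans (Pst v) _; rewrite -!addnA addnA leq_add2r.
    rewrite (bigD1 v) //= eqxx big1 ?addn0 => [|u /negbTE->//].
    have -> : M.+1 + k.-1 - k = M by move: k_gt0; clear; lia.
    have -> : M.+1 + k.-1 - 0 = M + k by move: k_gt0; clear; lia.
    by rewrite divnDr ?dvdnn // divnn k_gt0 addnC.
pose visited u := (hist u).1 :: (hist u).2.
pose bad (s : {perm T} * {set T * T}) u := ((u, s.1 u) \in s.2) && (s.1 u \in visited u).
have bad_le u : \sum_(s <- S) bad s u <= k.
  apply: leq_trans (_ : \sum_(x <- visited u) \sum_(s <- S) ((u, x) \in s.2) <= _).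
    rewrite exchange_big !big_seq /=; apply: leq_sum => s sS'.
    case: (boolP (bad s u)) => // /andP[r vis].
    by rewrite (big_rem _ vis) /= r.
  apply: leq_trans (_ : \sum_(x <- visited u) 1 <= _); first exact: leq_sum.
  rewrite sum1_size /=; case: (hP u) => _ _; apply: leq_trans.
  by rewrite -addn1 leq_add2l.
have S_gt0 : 0 < size S by rewrite sS.
have [s sS' s_le] := le_average (fun s => \sum_v c v * 2 ^ bad s v) S_gt0.
have {}s_le : M.+1 * \sum_v c v * 2 ^ bad s v <= (M.+1 + k) * \sum_v c v.
  rewrite -{1}sS; apply: leq_trans s_le _.
  rewrite exchange_big big_distrr /=; apply: leq_sum => v _.
  rewrite -big_distrr /= mulnC leq_mul2r; apply/orP; right.
  apply: leq_trans (_ : \sum_(s <- S) (1 + bad s v) <= _).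
    by apply: leq_sum => t _; case: (bad t v).
  by rewrite big_split /= sum1_size sS leq_add2l.
have pS := perm_to_rem sS'; set S' := rem s S in pS.
have sz' : size S' = M by rewrite size_rem // sS.
have sub' t : t \in S' -> t \in S by apply: mem_rem.
have sumS (f : {perm T} * {set T * T} -> nat) : \sum_(t <- S) f t = f s + \sum_(t <- S') f t.
  by rewrite (perm_big _ pS) big_cons.
pose real u := (u, s.1 u) \in s.2.
pose cut u := if real u then s.1 u \in visited u else s.1 u != u.
(* A real arc extends the walk, or opens a new piece with that arc if its head was visited before. A
   fake loop lets the walk wait uncut; any other fake arc makes it restart at the new vertex. *)
pose hist' x := let u := (s.1^-1)%g x in
  if real u then if x \in visited u then (u, [:: x]) else ((hist u).1, rcons (hist u).2 x)
  else if x == u then hist u else (x, [::]).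
have hist'E u : hist' (s.1 u) =
  if real u then if s.1 u \in visited u then (u, [:: s.1 u])
    else ((hist u).1, rcons (hist u).2 (s.1 u))
  else if s.1 u == u then hist u else (s.1 u, [::]) by rewrite /hist' permK.
have reidx (f : T -> nat) : \sum_x f x = \sum_u f (s.1 u).
  by rewrite (reindex_inj (@perm_inj _ s.1)).
have graph' t : t \in S' -> forall u v, (u, v) \in t.2 -> t.1 u = v by move/sub'; apply: graph.
have noloop' t : t \in S' -> forall u, (u, u) \notin t.2 by move/sub'; apply: noloop.
have disj' e : \sum_(t <- S') (e \in t.2) <= 1.
  by apply: leq_trans (disj e); rewrite sumS leq_addl.
have hP' x : [/\ last (hist' x).1 (hist' x).2 = x, simple_path (hist' x)
                 & size (hist' x).2 + j.-1 <= k].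
  rewrite -(permKV s.1 x); move: (s.1^-1 x)%g => u; rewrite hist'E.
  have [lu su ju] := hP u.
  case: ifP => [r|_]; [case: ifP => vis|case: ifP => [/eqP eu|_]].
  - split=> //=; last by rewrite add1n prednK.
    rewrite /simple_path /= inE andbT; apply/eqP => eu.
    by have := noloop _ sS' u; rewrite {2}eu; move: r; rewrite /real => ->.
  - split=> /=; first by rewrite last_rcons.
      by change (uniq (rcons (visited u) (s.1 u))); rewrite rcons_uniq vis; exact: su.
    by rewrite size_rcons addSnnS prednK.
  - by split=> //; rewrite ?eu // (leq_trans _ ju) // leq_add2l leq_pred.
  - by split=> //=; rewrite add0n (leq_trans _ jk) // leq_pred.
have j'k : j.-1 <= k by rewrite (leq_trans (leq_pred _)).
have [P [rep [Ps Pk Pe Pst Pc]]] :=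
  IH j.-1 S' hist' (fun v => c v * 2 ^ bad s v) sz' j'k graph' noloop' disj' hP'.
exists ([seq hist u | u <- enum T & cut u] ++ P), (fun v => bad s v + rep v); split.
- by rewrite all_cat Ps andbT; apply/allP => q /mapP[u _ ->]; case: (hP u).
- rewrite all_cat Pk andbT; apply/allP => q /mapP[u _ ->].
  by case: (hP u) => _ _; apply: leq_trans; rewrite leq_addr.
- move=> e; rewrite big_cat big_map big_filter sum_enum Pe /= sumS reidx.
  rewrite addnCA -[in RHS]addnA [in RHS]addnCA; congr (_ + _).
  have -> : nat_of_bool (e \in s.2) = \sum_u (((u, s.1 u) == e) && real u).
    case: e => a b; rewrite (bigD1 a) //= big1 => [|u]; last by rewrite xpair_eqE => /negbTE->.
    rewrite addn0 xpair_eqE eqxx /= /real; case: eqP => [->//|] ne.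
    by case: (boolP (_ \in _)) => // /(graph _ sS').
  rewrite big_mkcond -!big_split /=; apply: eq_bigr => u _.
  rewrite hist'E /cut; case: (real u) => //=; last first.
    by rewrite andbF add0n; case: eqP => //= _; rewrite addn0.
  rewrite andbT; case: ifP => vis.
    by rewrite /= addn0 addnC.
  rewrite arcs_rcons -cats1 count_cat /= addn0 add0n addnC.
  by have [-> _ _] := hP u; rewrite -surjective_pairing.
- move=> v; rewrite /starts big_cat big_map big_filter sum_enum /= sumS.
  have le := Pst v.
  have -> : (M.+1 + k.-1 - j) %/ k = (M + k.-1 - j.-1) %/ k.
    by congr (_ %/ _); move: j_gt0; clear; lia.
  apply: leq_trans (leq_add (leqnn _) le) _.
  (* A cut caused by a revisit starts the new piece at [u] itself and is charged to [bad s u]; a cut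
     caused by a fake arc starts it at the head of that arc and is charged to the arc. *)
  have main : \sum_(u | cut u) ((hist u).1 == v) + \sum_u ((hist' u).1 == v) <=
     \sum_u ((hist u).1 == v) + \sum_(u | u != v) ((s.1 u == v) && ((u, v) \notin s.2)) + bad s v.
    have -> : nat_of_bool (bad s v) = \sum_u ((u == v) && bad s u).
      by rewrite (bigD1 v) //= eqxx big1 ?addn0 // => u /negbTE->.
    rewrite reidx [X in X + _ <= _]big_mkcond [X in _ <= _ + X + _]big_mkcond -!big_split /=.
    apply: leq_sum => u _.
    rewrite hist'E /cut /bad; have := graph _ sS' u v; rewrite /real.
    case: (boolP ((u, s.1 u) \in s.2)) => r gr /=.
      by case: ifP => vis /=; rewrite ?andbT ?addn0 ?add0n //=; case: (_ == v); case: (_ == v).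
    rewrite andbF addn0; case: eqP => [eu|/eqP ne] /=; first by rewrite leq_addr.
    rewrite leq_add2l; case: eqP => // ev; rewrite -ev eq_sym ne /=.
    by case: (boolP (_ \in _)) => // H; rewrite H in r.
  have reorder (a b b' d f f' r r' : nat) : a + b' <= b + f + r ->
      a + (b' + d + f' + r') <= b + d + (f + f') + (r + r') by clear; lia.
  exact: reorder main.
- under eq_bigr do rewrite expnD mulnA.
  rewrite -(leq_pmul2l (ltn0Sn M)); apply: leq_trans (leq_mul (leqnn _) Pc) _.
  rewrite mulnA; apply: leq_trans (leq_mul s_le (leqnn _)) _.
  rewrite [(_ + _) * _]mulnC -mulnA [X in _ <= X]mulnCA leq_mul2l; apply/orP; right.
  (* The factors (M + 1 + k) / (M + 1) of the successive steps multiply up to the binomial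
     coefficient. *)
  by rewrite -[M + k]/((M.+1 + k).-1) mul_bin_diag.
Qed.

Lemma sum_starts_ends E P v : decomposes E P ->
  starts P v + inn E v = ends P v + outn E v.
Proof.
move=> [_ dec]; rewrite outn_sum inn_sum.
under [in LHS]eq_bigr do rewrite -dec; under [in RHS]eq_bigr do rewrite -dec.
rewrite exchange_big [in RHS]exchange_big /= -!big_split /=.
apply: eq_bigr => -[x p] _ /=; elim: p x => [|y p IH] x /=; first by rewrite !big1.
rewrite !big_split /=; have := IH y.
have -> : \sum_i ((x, y) == (i, v)) = (y == v).
  rewrite (bigD1 x) //= xpair_eqE eqxx /= big1 ?addn0 // => i; rewrite xpair_eqE eq_sym.
  by move=> /negbTE->.
have -> : \sum_i ((x, y) == (v, i)) = (x == v).
  rewrite (bigD1 y) //= xpair_eqE eqxx /= andbT big1 ?addn0 // => i.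
  by rewrite xpair_eqE eq_sym [y == i]eq_sym => /negbTE->; rewrite andbF.
by rewrite /arcs /= => ->; rewrite addnCA.
Qed.

Lemma sum_count_pair (s : seq (T * T)) u :
  \sum_v count_mem (u, v) s = count_mem u (unzip1 s).
Proof.
elim: s => [|[a b] s IH] /=; first by rewrite big1.
rewrite big_split /= IH (bigD1 b) //= xpair_eqE eqxx andbT big1 ?addn0 // => v.
by rewrite xpair_eqE eq_sym [b == v]eq_sym => /negbTE->; rewrite andbF.
Qed.

Lemma sum_count_pair2 (s : seq (T * T)) v :
  \sum_u count_mem (u, v) s = count_mem v (unzip2 s).
Proof.
elim: s => [|[a b] s IH] /=; first by rewrite big1.
rewrite big_split /= IH (bigD1 a) //= xpair_eqE eqxx big1 ?addn0 // => u.
by rewrite xpair_eqE eq_sym => /negbTE->.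
Qed.

Lemma seq_of_counts (f : T -> nat) :
  exists s : seq T, size s = \sum_u f u /\ forall u, count_mem u s = f u.
Proof.
exists (flatten [seq nseq (f u) u | u <- enum T]); split.
  by rewrite size_flatten /shape -map_comp sumnE big_map sum_enum; apply: eq_bigr => u _;
     rewrite /= size_nseq.
move=> u; rewrite count_flatten -map_comp sumnE big_map sum_enum (bigD1 u) //=.
rewrite count_nseq /= eqxx mul1n big1 ?addn0 // => v vu.
by rewrite count_nseq /= (negbTE vu).
Qed.

(** Fake loops fill the degrees up to d and cost nothing. Fake arcs between distinct vertices lead
    from in-surplus to out-surplus, so they start at most as many pieces at v as its out-surplus.
    The potential with all weights 1 stays below 2 ^ (w + 1), so at most w revisits are charged to a
    vertex. *)
Lemma walk_decomposition E d k w :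
    0 < k -> (forall u, (u, u) \notin E) ->
    (forall u, outn E u <= d) -> (forall u, inn E u <= d) ->
    #|T| * 'C(d + k, d) < 2 ^ w.+1 ->
  exists P, [/\ decomposes E P, all (fun q => size q.2 <= k) P
    & forall v, starts P v <= (outn E v - inn E v) + (d %/ k).+1 + w].
Proof.
move=> k_gt0 noloop out_d in_d big_w.
have [A [szA cA]] := seq_of_counts (fun u => inn E u - outn E u).
have [B [szB cB]] := seq_of_counts (fun u => outn E u - inn E u).
have szAB : size A = size B.
  rewrite szA szB; apply/eqP; rewrite -(eqn_add2r (\sum_u outn E u)).
  rewrite -{2}card_outn card_inn -!big_split /=; apply/eqP/eq_bigr => u _; clear; lia.
pose L u v := (u == v) * (d - maxn (outn E u) (inn E u)) + count_mem (u, v) (zip A B).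
have sumL u : \sum_v (u == v) * (d - maxn (outn E u) (inn E u)) = d - maxn (outn E u) (inn E u).
  by rewrite (bigD1 u) //= eqxx mul1n big1 ?addn0 // => v; rewrite eq_sym => /negbTE->.
have sumL' v : \sum_u (u == v) * (d - maxn (outn E u) (inn E u)) = d - maxn (outn E v) (inn E v).
  by rewrite (bigD1 v) //= eqxx mul1n big1 ?addn0 // => u /negbTE->.
have [||S [sS graph part fakes]] := @birkhoff _ E L d.
- move=> u; rewrite big_split /= sumL sum_count_pair unzip1_zip ?szAB // cA.
  by move: (out_d u) (in_d u); clear; lia.
- move=> v; rewrite big_split /= sumL' sum_count_pair2 unzip2_zip ?szAB // cB.
  by move: (out_d v) (in_d v); clear; lia.
have noloopS s : s \in S -> forall u, (u, u) \notin s.2.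
  move=> sS' u; apply/negP => us; have := part (u, u).
  by rewrite (negbTE (noloop u)) (big_rem _ sS') /= us.
have disj e : \sum_(s <- S) (e \in s.2) <= 1 by rewrite part; case: (_ \in _).
have [|P [rep [Ps Pk Pe Pst Pc]]] :=
  @greedy_walks k d k S (fun u => (u, [::])) (fun=> 1) k_gt0 sS (leqnn k) graph noloopS disj.
- by [].
exists P; split=> //.
  by split=> // e; rewrite Pe part [X in _ + X]big1 ?addn0.
move=> v; apply: leq_trans (Pst v) _.
have -> : \sum_u ((u, [::] : seq T).1 == v) = 1.
  by rewrite (bigD1 v) //= eqxx big1 // => u /negbTE->.
have le_rep : rep v <= w.
  rewrite -ltnS -(@ltn_exp2l 2) // (leq_ltn_trans _ big_w) //.
  have := Pc; rewrite sum1_card; apply: leq_trans.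
  by rewrite (bigD1 v) //= mul1n leq_addr.
have le_fake : \sum_(s <- S) \sum_(u | u != v) ((s.1 u == v) && ((u, v) \notin s.2)) <=
    outn E v - inn E v.
  have -> : outn E v - inn E v = \sum_u count_mem (u, v) (zip A B).
    by rewrite sum_count_pair2 unzip2_zip ?szAB.
  rewrite exchange_big /=.
  rewrite [X in _ <= X](bigID (fun u => u != v)) /= (leq_trans _ (leq_addr _ _)) //.
  by apply: leq_sum => u uv; rewrite fakes /L (negbTE uv).
have le_div : (d + k.-1 - k) %/ k <= d %/ k.
  by apply: leq_div2r; move: k_gt0; clear; lia.
by move: le_rep le_fake le_div; clear; lia.
Qed.
End Walks.

(** * Path systems along the blocks *)

(** An r-factor needs no fake arcs, so [birkhoff] splits it into r perfect matchings. *)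
Lemma disjoint_perms (b r : nat) (G : {set 'I_b * 'I_b}) :
    (forall X Y : {set 'I_b}, r * (#|X| + #|Y|) <= #|G :&: setX X Y| + r * b) ->
  exists s : 'I_r -> {perm 'I_b},
    forall x y, \sum_m (s m x == y) <= ((x, y) \in G).
Proof.
move=> cut; have [X Y|F [FG outF inF]] := @factorP _ G r; first by rewrite card_ord.
have [u|v|S [sS graph part fakes]] := @birkhoff _ F (fun _ _ => 0) r.
- by rewrite outF sum_nat_const muln0 addn0.
- by rewrite inF sum_nat_const muln0 addn0.
pose d0 : {perm 'I_b} * {set 'I_b * 'I_b} := (1%g, set0).
exists (fun m : 'I_r => (nth d0 S m).1) => x y.
rewrite -(big_mkord xpredT (fun m => ((nth d0 S m).1 x == y) : nat)) -sS.
rewrite -(big_nth d0 xpredT (fun s => (s.1 x == y) : nat)).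
apply: leq_trans (_ : \sum_(s <- S) ((x, y) \in s.2) <= _).
  rewrite !big_seq; apply: leq_sum => s sS'; case: (boolP (_ == _)) => // e.
  have := fakes x y; rewrite (big_rem _ sS') /= e /=.
  by case: (_ \in s.2).
by rewrite part; case: (boolP (_ \in F)) => // /(subsetP FG)->.
Qed.

Lemma pairmap_iota (T U : Type) (f : T -> T -> U) (g : nat -> T) i n :
  pairmap f (g i) [seq g t | t <- iota i.+1 n] = [seq f (g t) (g t.+1) | t <- iota i n].
Proof. by elim: n i => //= n IH i; rewrite IH. Qed.

Section PathSystem.
Context (T : finType) (D : {set T * T}) (b r K L : nat).
Context (phi : 'I_K -> nat -> 'I_b -> T) (blk : T -> nat) (bl : 'I_K -> nat -> nat).
Hypothesis phi_inj : forall c t, t <= L -> injective (phi c t).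
Hypothesis blk_phi : forall c t x, t <= L -> blk (phi c t x) = bl c t.
Hypothesis bl_inj : forall c t t', t <= L -> t' <= L -> bl c t = bl c t' -> t = t'.
Hypothesis bl_pair : forall c c' t t', t < L -> t' < L ->
  bl c t = bl c' t' -> bl c t.+1 = bl c' t'.+1 -> c = c' /\ t = t'.
Hypothesis cut : forall c t (X Y : {set 'I_b}), t < L ->
  r * (#|X| + #|Y|) <= #|[set e : 'I_b * 'I_b | (phi c t e.1, phi c t.+1 e.2) \in D] :&: setX X Y|
                       + r * b.

(** The path for the chain c, the index m and the start x follows the m-th matching between any two
    consecutive blocks of c. The two blocks of an arc determine c and the step by [bl_pair], and the
    matchings of one step are disjoint, so no arc is used twice. *)
Lemma path_system : exists (E1 : {set T * T}) P, [/\ E1 \subset D, decomposes E1 P,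
  forall q, q \in P -> uniq [seq blk x | x <- q.1 :: q.2],
  forall v, starts P v = r * \sum_c (v \in codom (phi c 0)) &
  [/\ forall v, ends P v = r * \sum_c (v \in codom (phi c L)), forall v, outn E1 v = r * \sum_c \sum_(t < L) (v \in codom (phi c t)),
  forall v, inn E1 v = r * \sum_c \sum_(t < L) (v \in codom (phi c t.+1)) &
  forall e, e \in E1 -> exists c t, [/\ t < L, blk e.1 = bl c t & blk e.2 = bl c t.+1]]].
Proof.
have ex_s c : exists s : 'I_L -> 'I_r -> {perm 'I_b}, forall t x y,
    \sum_m (s t m x == y) <= ((phi c t x, phi c t.+1 y) \in D).
  have : forall t : 'I_L, exists s : 'I_r -> {perm 'I_b}, forall x y,
      \sum_m (s m x == y) <= ((phi c t x, phi c t.+1 y) \in D).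
    move=> t; have [s sP] := disjoint_perms (fun X Y => cut c X Y (ltn_ord t)).
    by exists s => x y; apply: leq_trans (sP x y) _; rewrite inE.
  by move=> /fin_all_exists.
have [s0 s0P] := fin_all_exists ex_s.
pose s c t m : {perm 'I_b} := if insub t is Some t' then s0 c t' m else 1%g.
have sP c t x y : t < L -> \sum_m (s c t m x == y) <= ((phi c t x, phi c t.+1 y) \in D).
  by move=> tL; rewrite /s insubT //; apply: (s0P c (Sub t tL)).
pose pos c m x t := (\prod_(i < t) s c i m)%g x.
have posS c m x t : pos c m x t.+1 = s c t m (pos c m x t).
  by rewrite /pos big_ord_recr /= permM.
have pos0 c m x : pos c m x 0 = x by rewrite /pos big_ord0 perm1.
pose vert c m x t := phi c t (pos c m x t).
pose pth (j : 'I_K * 'I_r * 'I_b) :=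
  (vert j.1.1 j.1.2 j.2 0, [seq vert j.1.1 j.1.2 j.2 t | t <- iota 1 L]).
pose N e := \sum_c \sum_(t < L) \sum_m \sum_x ((phi c t x, phi c t.+1 (s c t m x)) == e).
have NE e : \sum_(j : 'I_K * 'I_r * 'I_b) count_mem e (arcs (pth j)) = N e.
  rewrite -(pair_bigA _ (fun cm x => count_mem e (arcs (pth (cm, x))))) /=.
  rewrite -(pair_bigA _ (fun c m => \sum_x count_mem e (arcs (pth (c, m, x))))) /=.
  apply: eq_bigr => c _; rewrite [RHS]exchange_big; apply: eq_bigr => m _ /=.
  transitivity (\sum_x \sum_(t < L) ((vert c m x t, vert c m x t.+1) == e)).
    apply: eq_bigr => x _; rewrite /arcs /pth /= pairmap_iota count_map -sum1_count.
    rewrite big_mkcond -(big_mkord xpredT (fun t => ((vert c m x t, vert c m x t.+1) == e) : nat)).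
    by rewrite /index_iota subn0; apply: eq_bigr => t _ /=; case: eqP.
  rewrite exchange_big; apply: eq_bigr => t _; symmetry.
  rewrite (reindex_inj (@perm_inj _ (\prod_(i < t) s c i m)%g)); apply: eq_bigr => x _.
  by rewrite /vert posS.
pose hit e (c : 'I_K) (t : 'I_L) := [exists m, exists x, (phi c t x, phi c t.+1 (s c t m x)) == e].
have hit0 e c t : ~~ hit e c t -> \sum_m \sum_x ((phi c t x, phi c t.+1 (s c t m x)) == e) = 0.
  move=> nh; rewrite big1 // => m _; rewrite big1 // => x _; apply/eqP; rewrite eqb0.
  by apply: contra nh => h; apply/existsP; exists m; apply/existsP; exists x.
have hitP e c t : hit e c t -> exists x y, e = (phi c t x, phi c t.+1 y).
  by move=> /existsP[m /existsP[x /eqP <-]]; exists x, (s c t m x).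
have N_hit e c0 t0 : hit e c0 t0 ->
    N e = \sum_m \sum_x ((phi c0 t0 x, phi c0 t0.+1 (s c0 t0 m x)) == e).
  move=> /hitP[x0 [y0 e0]]; rewrite /N (bigD1 c0) //= (bigD1 t0) //=.
  have other c t : hit e c t -> c = c0 /\ t = t0.
    move=> /hitP[x [y]]; rewrite e0 => -[ex ey].
    have [cc tt] := bl_pair (ltn_ord t0) (ltn_ord t)
      (etrans (esym (blk_phi c0 x0 (ltnW (ltn_ord t0))))
         (etrans (congr1 blk ex) (blk_phi c x (ltnW (ltn_ord t)))))
      (etrans (esym (blk_phi c0 y0 (ltn_ord t0)))
         (etrans (congr1 blk ey) (blk_phi c y (ltn_ord t)))).
    by split=> //; apply: val_inj.
  rewrite -addnA [X in _ + X]addnC -[RHS]addn0; congr (_ + _).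
  rewrite !big1 // => [t tt|c cc]; last rewrite big1 // => t _.
    by apply: hit0; apply: contra tt => /other[_ ->].
  by apply: hit0; apply: contra cc => /other[->].
have N_le e : N e <= (e \in D).
  have [h|nh] := boolP [exists c, exists t, hit e c t]; last first.
    rewrite /N big1 // => c _; rewrite big1 // => t _; apply: hit0.
    by apply: contra nh => h; apply/existsP; exists c; apply/existsP; exists t.
  case/existsP: h => c /existsP[t h]; rewrite (N_hit _ _ _ h).
  have [x0 [y0 e0]] := hitP _ _ _ h.
  apply: leq_trans (_ : \sum_m (s c t m x0 == y0) <= _); last first.
    by apply: leq_trans (sP c t x0 y0 (ltn_ord t)) _; rewrite e0.
  apply: leq_sum => m _; rewrite (bigD1 x0) //= big1 ?addn0 => [|x xx0].
    rewrite e0 xpair_eqE (inj_eq (phi_inj _)) ?(ltnW (ltn_ord t)) // eqxx.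
    by rewrite (inj_eq (phi_inj (ltn_ord t))).
  by rewrite e0 xpair_eqE (inj_eq (phi_inj _)) ?(ltnW (ltn_ord t)) // (negbTE xx0).
pose E1 := [set e | 0 < N e].
have NE1 e : N e = (e \in E1).
  by rewrite inE; have := N_le e; case: (N e) => [|[|n]] //; case: (e \in D).
have codomE c t v : t <= L -> \sum_x (phi c t x == v) = (v \in codom (phi c t)).
  move=> tL; case: (boolP (v \in codom _)) => [/codomP[x ->]|nv].
    rewrite (bigD1 x) //= eqxx big1 // => y yx.
    by rewrite (inj_eq (phi_inj tL)) (negbTE yx).
  by rewrite big1 // => x _; apply/eqP; rewrite eqb0; apply: contra nv => /eqP<-; apply: codom_f.
have blk_pth j : uniq [seq blk x | x <- (pth j).1 :: (pth j).2].
  case: j => [[c m] x].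
  have -> : [seq blk x | x <- (pth (c, m, x)).1 :: (pth (c, m, x)).2]
     = [seq bl c t | t <- iota 0 L.+1].
    rewrite /pth /= blk_phi // -map_comp; congr (_ :: _).
    by apply/eq_in_map => t; rewrite mem_iota => /andP[_ tL]; apply: blk_phi; rewrite -ltnS.
  rewrite map_inj_in_uniq ?iota_uniq // => t t'; rewrite !mem_iota !add0n !ltnS /=.
  exact: bl_inj.
have sum3 (f : 'I_K -> 'I_r -> 'I_b -> nat) :
    \sum_(j : 'I_K * 'I_r * 'I_b) f j.1.1 j.1.2 j.2 = \sum_c \sum_m \sum_x f c m x.
  rewrite -(pair_bigA _ (fun cm x => f cm.1 cm.2 x)) /=.
  by rewrite -(pair_bigA _ (fun c m => \sum_x f c m x)).
exists E1, [seq pth j | j <- enum {: 'I_K * 'I_r * 'I_b}]; split; last split.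
- by apply/subsetP => e; rewrite inE; have := N_le e; case: (e \in D) => //; case: (N e).
- split; last by move=> e; rewrite big_map big_enum /= NE NE1.
  by apply/allP => q /mapP[j _ ->]; have := blk_pth j; apply: map_uniq.
- by move=> q /mapP[j _ ->].
- move=> v; rewrite /starts big_map big_enum /=.
  rewrite (sum3 (fun c m x => (vert c m x 0 == v) : nat)) big_distrr; apply: eq_bigr => c _ /=.
  under eq_bigr => m _.
    under eq_bigr do rewrite /vert pos0.
    rewrite codomE //; over.
  by rewrite sum_nat_const card_ord.
- move=> v; rewrite /ends big_map big_enum /=.
  have last_pth j : last (pth j).1 (pth j).2 = vert j.1.1 j.1.2 j.2 L.
    rewrite /pth /= last_map (last_nth 0) size_iota.
    by rewrite -[0 :: _]/(iota 0 L.+1) nth_iota.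
  under eq_bigr do rewrite last_pth.
  rewrite (sum3 (fun c m x => (vert c m x L == v) : nat)) big_distrr; apply: eq_bigr => c _ /=.
  rewrite -[r in RHS]card_ord -sum_nat_const; apply: eq_bigr => m _ /=.
  by rewrite -codomE // [RHS](reindex_inj (@perm_inj _ (\prod_(i < L) s c i m)%g)).
- move=> v; rewrite outn_sum; under eq_bigr do rewrite -NE1 /N.
  rewrite exchange_big big_distrr; apply: eq_bigr => c _ /=.
  rewrite exchange_big big_distrr; apply: eq_bigr => t _ /=.
  rewrite exchange_big -[r in RHS]card_ord -sum_nat_const; apply: eq_bigr => m _ /=.
  rewrite exchange_big -codomE ?(ltnW (ltn_ord t)) //; apply: eq_bigr => x _ /=.
  rewrite (bigD1 (phi c t.+1 (s c t m x))) //= xpair_eqE eqxx andbT big1 ?addn0 // => w.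
  by rewrite xpair_eqE eq_sym => /negbTE->; rewrite andbF.
- move=> v; rewrite inn_sum; under eq_bigr do rewrite -NE1 /N.
  rewrite exchange_big big_distrr; apply: eq_bigr => c _ /=.
  rewrite exchange_big big_distrr; apply: eq_bigr => t _ /=.
  rewrite exchange_big -[r in RHS]card_ord -sum_nat_const; apply: eq_bigr => m _ /=.
  rewrite exchange_big -codomE ?(ltn_ord t) // [RHS](reindex_inj (@perm_inj _ (s c t m))).
  apply: eq_bigr => x _ /=.
  rewrite (bigD1 (phi c t x)) //= xpair_eqE eqxx big1 ?addn0 // => w.
  by rewrite xpair_eqE eq_sym => /negbTE->.
- move=> e; rewrite inE => Ne.
  have [h|nh] := boolP [exists c, exists t, hit e c t].
    case/existsP: h => c /existsP[t /hitP[x [y ->]]]; exists c, t; rewrite ltn_ord.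
    by rewrite !blk_phi // ltnW.
  move: Ne; rewrite /N big1 // => c _; rewrite big1 // => t _; apply: hit0.
  by apply: contra nh => h; apply/existsP; exists c; apply/existsP; exists t.
Qed.
End PathSystem.

Lemma sum_bool_le1 (I : finType) (a : pred I) :
  (forall x y, a x -> a y -> x = y) -> \sum_x (a x : nat) <= 1.
Proof.
move=> inj; case: (pickP a) => [x ax|none]; last by rewrite big1 // => x _; rewrite none.
rewrite (bigD1 x) //= ax big1 // => y yx; apply/eqP; rewrite eqb0.
by apply: contra yx => ay; apply/eqP/inj.
Qed.

(** * Residue classes as blocks, and their zigzags *)

Section Blocks.
Context (n k b : nat).
Let N := n.+1.
Hypothesis k_gt0 : 0 < k.
Hypothesis k_even : ~~ odd k.
Hypothesis bE : b = N %/ k.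

(* The zigzag 0, 1, -1, 2, -2, ... modulo the even number k: its consecutive
   differences 1, -2, 3, -4, ... are distinct, so the k translates of this
   Hamiltonian path of blocks use each ordered pair of blocks exactly once. *)
Definition zigzag t := if odd t then t./2.+1 else k - t./2.

Definition block_at (c t : nat) := (c + zigzag t) %% k.

Definition block (v : 'I_N) : nat := v %% k.

(* A block has b or b + 1 vertices; in the latter case the c-th path system
   leaves out one of them. *)
Definition omitted (i c : nat) := if i + k * b < N then c %% b.+1 else b.

Definition vertex_at (c : 'I_k) (t : nat) (x : 'I_b) : 'I_N :=
  inord (block_at c t + k * bump (omitted (block_at c t) c) x).

Lemma eq_modP x y : x = y %[mod k] -> exists m, x = y + m * k \/ y = x + m * k.
Proof.
move=> e; case: (leqP y x) => le.
  exists ((x - y) %/ k); left; rewrite divnK ?subnKC //.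
  by rewrite -eqn_mod_dvd // e.
exists ((y - x) %/ k); right; rewrite divnK ?subnKC //; first exact: ltnW.
by rewrite -eqn_mod_dvd ?e // ltnW.
Qed.

(** Doubled to be free of halves: linear arithmetic then settles the congruences below, once the
    multiple of k involved is known to be 0 or 1. *)
Lemma zigzag_odd t : odd t -> (zigzag t).*2 = t.+1.
Proof. by rewrite /zigzag => ot; rewrite ot; move: ot; clear; lia. Qed.

Lemma zigzag_even t : ~~ odd t -> t <= k -> (zigzag t).*2 + t = k.*2.
Proof. by rewrite /zigzag => /negbTE ot; rewrite ot; move: ot k_gt0; clear; lia. Qed.

Lemma small_mul m : m * k < k.*2 -> m = 0 \/ m = 1.
Proof. by rewrite -mul2n ltn_mul2r => /andP[_]; case: m => [|[|m]]; auto. Qed.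

Lemma block_at_inj c t t' : t < k -> t' < k -> block_at c t = block_at c t' -> t = t'.
Proof.
move=> tk tk' /eqP; rewrite /block_at eqn_modDl => /eqP/eq_modP[m].
case: (boolP (odd t)) => ot; case: (boolP (odd t')) => ot'.
all: try (have := zigzag_odd ot); try (have := zigzag_odd ot').
all: try (have := zigzag_even ot (ltnW tk)); try (have := zigzag_even ot' (ltnW tk')).
all: have sm := @small_mul m; move: ot ot' sm tk tk' k_gt0 k_even; clear.
all: case: m => [|[|m]]; rewrite ?mulSn ?mul0n; lia.
Qed.
Lemma block_at_pair_inj (c c' : 'I_k) t t' : t.+1 < k -> t'.+1 < k ->
  block_at c t = block_at c' t' -> block_at c t.+1 = block_at c' t'.+1 -> c = c' /\ t = t'.
Proof.
move=> tk tk' /eq_modP[m e1] /eq_modP[m' e2].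
suff tt : t = t'.
  split=> //; apply: val_inj => /=; move: e1; rewrite tt.
  have sm := @small_mul m; move: (ltn_ord c) (ltn_ord c') sm.
  move: (zigzag t') k_gt0 => z; clear.
  by case: m => [|[|m]]; rewrite ?mulSn ?mul0n; lia.
move: (ltn_ord c) (ltn_ord c').
case: (boolP (odd t)) => ot; case: (boolP (odd t')) => ot'.
all: try (have := zigzag_odd ot); try (have := zigzag_odd ot').
all: try (have := zigzag_even ot (ltnW (ltnW tk))); try (have := zigzag_even ot' (ltnW (ltnW tk'))).
all: try (have /zigzag_odd := (ot : odd t.+1)); try (have /zigzag_odd := (ot' : odd t'.+1)).
all: try (have ot1 : ~~ odd t.+1 by rewrite /= ot).
all: try (have ot1' : ~~ odd t'.+1 by rewrite /= ot').
all: try (have := zigzag_even ot1 (ltnW tk)); try (have := zigzag_even ot1' (ltnW tk')).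
all: have sm := @small_mul m; have sm' := @small_mul m'.
all: move: ot ot' sm sm' e1 e2 tk tk' k_gt0 k_even; clear.
all: case: m => [|[|m]]; case: m' => [|[|m']]; rewrite ?mulSn ?mul0n; lia.
Qed.
(** Step t of a zigzag changes the block by t + 1 for even t and by -(t + 1) for odd t. With only
    the first k - 2h - 1 steps, t + 1 stays below k - 2h, so modulo k the odd changes miss -1, -3,
    ..., -(2h - 1) and the even ones miss 2, 4, ..., 2h. *)
Lemma block_at_odd_gap c t j h : t + h.*2 + 1 < k -> odd j -> j < h.*2 ->
  block_at c t <> (block_at c t.+1 + j) %% k.
Proof.
move=> tk oj jh; rewrite /block_at modnDml -addnA => /eqP; rewrite eqn_modDl => /eqP/eq_modP[m].
have tk1 : t < k by move: tk; clear; lia.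
have tk2 : t.+1 <= k by [].
case: (boolP (odd t)) => ot.
- have := zigzag_odd ot; have /zigzag_even/(_ tk2) : ~~ odd t.+1 by rewrite /= ot.
  have sm := @small_mul m; move: ot sm oj jh tk k_gt0 k_even; clear.
  by case: m => [|[|m]]; rewrite ?mulSn ?mul0n; lia.
have := zigzag_even ot (ltnW tk1); have /zigzag_odd : odd t.+1 by rewrite /= ot.
have sm := @small_mul m; move: ot sm oj jh tk k_gt0 k_even; clear.
by case: m => [|[|m]]; rewrite ?mulSn ?mul0n; lia.
Qed.

Lemma block_at_even_gap c t j h : t + h.*2 + 1 < k -> ~~ odd j -> 0 < j <= h.*2 ->
  block_at c t.+1 <> (block_at c t + j) %% k.
Proof.
move=> tk oj jh; rewrite /block_at modnDml -addnA => /eqP; rewrite eqn_modDl => /eqP/eq_modP[m].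
have tk1 : t < k by move: tk; clear; lia.
have tk2 : t.+1 <= k by [].
case: (boolP (odd t)) => ot.
- have := zigzag_odd ot; have /zigzag_even/(_ tk2) : ~~ odd t.+1 by rewrite /= ot.
  have sm := @small_mul m; move: ot sm oj jh tk k_gt0 k_even; clear.
  by case: m => [|[|m]]; rewrite ?mulSn ?mul0n; lia.
have := zigzag_even ot (ltnW tk1); have /zigzag_odd : odd t.+1 by rewrite /= ot.
have sm := @small_mul m; move: ot sm oj jh tk k_gt0 k_even; clear.
by case: m => [|[|m]]; rewrite ?mulSn ?mul0n; lia.
Qed.

Lemma block_at_lt c t : block_at c t < k.
Proof. exact: ltn_pmod. Qed.

Lemma bump_omitted_lt i c (x : 'I_b) : i < k -> i + k * bump (omitted i c) x < N.
Proof.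
move=> ik; rewrite /omitted; have xb := ltn_ord x.
case: ifP => [ib|_]; first apply: leq_ltn_trans ib.
  rewrite leq_add2l leq_mul2l; apply/orP; right.
  by apply: leq_trans xb; rewrite /bump; case: (c %% b.+1 <= x); rewrite ?add1n ?add0n ?leqnSn.
have -> : bump b x = x by rewrite /bump leqNgt xb.
apply: leq_trans (_ : k * b <= _); last by rewrite bE mulnC leq_divM.
by apply: leq_trans (_ : k * x.+1 <= _); rewrite ?leq_mul2l ?xb ?orbT // mulnS ltn_add2r.
Qed.

Lemma val_vertex_at c t x :
  vertex_at c t x = block_at c t + k * bump (omitted (block_at c t) c) x :> nat.
Proof. by rewrite inordK // bump_omitted_lt // block_at_lt. Qed.

Lemma block_vertex_at c t x : block (vertex_at c t x) = block_at c t.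
Proof. by rewrite /block val_vertex_at addnC mulnC modnMDl modn_small // block_at_lt. Qed.

Lemma vertex_at_inj c t : injective (vertex_at c t).
Proof.
move=> x y /(congr1 val) /=; rewrite !val_vertex_at => /eqP.
by rewrite eqn_add2l eqn_pmul2l // => /eqP/(can_inj (bumpK _))/val_inj.
Qed.

(** In its block [v] has the index [v %/ k], and it can only be missed as the omitted vertex. The
    omitted index runs with c through the residues modulo b + 1, so only about k / (b + 1) rotations
    miss a given vertex. *)
Lemma codom_vertex_at (c : 'I_k) t (v : 'I_N) :
  (block_at c t == block v) <= (v \in codom (vertex_at c t)) + (c %% b.+1 == v %/ k).
Proof.
case: eqP => // ev; case: (c %% b.+1 =P v %/ k) => [_|nex]; rewrite ?addn1 // addn0 lt0b.
have vE : v = block_at c t + k * (v %/ k) :> nat by rewrite ev mulnC addnC -divn_eq.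
have vkb : v %/ k <= b by rewrite bE leq_div2r // ltnW.
have ne : omitted (block_at c t) c != v %/ k.
  rewrite /omitted; case: ifP => [_|/negP lt]; first exact/eqP.
  by apply/eqP => e; apply: lt; rewrite e -vE.
have lt : unbump (omitted (block_at c t) c) (v %/ k) < b.
  move: ne vkb; rewrite /unbump /omitted; case: ifP => [_|_].
    have : c %% b.+1 <= b by rewrite -ltnS ltn_pmod.
    by case: ltnP => /=; move: (_ %% _) (_ %/ _) => x y; clear; lia.
  by case: ltnP => /=; move: (_ %/ _) => y; clear; lia.
suff -> : v = vertex_at c t (Ordinal lt) by exact: codom_f.
by apply: val_inj; rewrite /= val_vertex_at /= unbumpK // inE eq_sym.
Qed.

Lemma count_residue m e : 0 < m -> \sum_(c < k) (c %% m == e) <= (k %/ m).+1.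
Proof.
move=> m_gt0; rewrite -big_mkcond sum1_card -[X in _ <= X]card_ord.
pose f (c : 'I_k) : 'I_(k %/ m).+1 := inord (c %/ m).
rewrite -(@card_in_image _ _ f); first exact: max_card.
have fE (c : 'I_k) : f c = c %/ m :> nat.
  by rewrite /f inordK // ltnS leq_div2r // ltnW.
move=> c c'; rewrite !unfold_in => /eqnP e1 /eqnP e2 /(congr1 val); rewrite /= !fE => e3.
by apply: val_inj; rewrite /= (divn_eq c m) (divn_eq c' m) e1 e2 e3.
Qed.

(** For each t some rotation has the block of v at place t + d, which gives L visits. A rotation
    that omits v loses at most one of them, since a zigzag meets a block only once. The case d = 0
    counts arcs out of v, d = 1 arcs into v. *)
Lemma sum_codom d L (v : 'I_N) : L + d <= k ->
  L <= \sum_(c : 'I_k) \sum_(t < L) (v \in codom (vertex_at c (t + d))) + (k %/ b.+1).+1.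
Proof.
move=> Lk; apply: leq_trans (_ : \sum_(c : 'I_k) \sum_(t < L) (block_at c (t + d) == block v)
    <= _); last first.
  apply: leq_trans (_ : \sum_(c : 'I_k) (\sum_(t < L) (v \in codom (vertex_at c (t + d))) +
     (c %% b.+1 == v %/ k)) <= _); last first.
    by rewrite big_split leq_add2l count_residue.
  apply: leq_sum => c _; case: (boolP (_ == _)) => e; last first.
    rewrite addn0; apply: leq_sum => t _; apply: leq_trans (codom_vertex_at _ _ _) _.
    by rewrite (negbTE e) addn0.
  apply: leq_trans (_ : 1 <= _); last by rewrite addn1.
  apply: sum_bool_le1 => t t' /eqP et /eqP et'.
  have lt (s : 'I_L) : s + d < k by apply: leq_trans Lk; rewrite ltn_add2r.
  rewrite -et' in et; apply: val_inj.
  by have /eqP := block_at_inj (lt _) (lt _) et; rewrite eqn_add2r => /eqP.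
rewrite exchange_big -[X in X <= _]muln1 -[L in X in X <= _]card_ord -sum_nat_const.
apply: leq_sum => t _.
have [c ec] : exists c : 'I_k, block_at c (t + d) = block v.
  have zk : zigzag (t + d) <= k.
    have tk : t + d < k by apply: leq_trans Lk; rewrite ltn_add2r.
    case: (boolP (odd (t + d))) => o; first have := zigzag_odd o.
      by move: tk; clear; lia.
    by have := zigzag_even o (ltnW tk); clear; lia.
  have lt : (block v + (k - zigzag (t + d))) %% k < k by rewrite ltn_pmod.
  exists (Ordinal lt); rewrite /block_at /= modnDml -addnA subnK //.
  by rewrite modnDr modn_small // ltn_pmod.
by rewrite (bigD1 c) //= ec eqxx.
Qed.

Lemma block_path_system (D : {set 'I_N * 'I_N}) r h L : L + h.*2 + 1 = k ->
    (forall (c : 'I_k) t (X Y : {set 'I_b}), t < L -> r * (#|X| + #|Y|) <=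
      #|[set e : 'I_b * 'I_b | (vertex_at c t e.1, vertex_at c t.+1 e.2) \in D] :&: setX X Y|
      + r * b) ->
  exists (E1 : {set 'I_N * 'I_N}) P, [/\ E1 \subset D, decomposes E1 P,
    forall q, q \in P -> uniq [seq block x | x <- q.1 :: q.2],
    forall v, starts P v <= r /\ ends P v <= r &
    [/\ forall v, r * L <= outn E1 v + r * (k %/ b.+1).+1,
        forall v, r * L <= inn E1 v + r * (k %/ b.+1).+1 &
        forall e j, e \in E1 -> j <= h.*2 ->
          (odd j -> block e.1 <> (block e.2 + j) %% k) /\
          (~~ odd j -> 0 < j -> block e.2 <> (block e.1 + j) %% k)]].
Proof.
move=> Lk cut.
have lt t : t <= L -> t < k by move: Lk; clear; lia.
have [||||E1 [P [ED dec bP stP [endP outE inE zone]]]] :=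
  @path_system _ D b r k L vertex_at block block_at _ _ _ _ cut.
- by move=> c t _; apply: vertex_at_inj.
- by move=> c t x _; apply: block_vertex_at.
- by move=> c t t' /lt tk /lt tk'; apply: block_at_inj.
- by move=> c c' t t' /lt tk /lt tk'; apply: block_at_pair_inj.
exists E1, P; split=> //.
  have at_inj t v : \sum_(c : 'I_k) (v \in codom (vertex_at c t)) <= 1.
    apply: sum_bool_le1 => c c' /codomP[x ex] /codomP[x' ex']; apply: val_inj => /=.
    have : block_at c t = block_at c' t by rewrite -(block_vertex_at c t x) -ex ex' block_vertex_at.
    by move/eqP; rewrite /block_at eqn_modDr !modn_small // => /eqP.
  move=> v; rewrite stP endP; have le a : a <= 1 -> r * a <= r.
    by move=> a1; rewrite -[X in _ <= X]muln1 leq_mul2l a1 orbT.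
  by split; apply/le/at_inj.
split=> [v|v|e j eE jh].
- rewrite outE -mulnDr leq_mul2l; apply/orP; right.
  have := @sum_codom 0 L v; rewrite addn0 => /(_ (ltnW (lt _ (leqnn L)))).
  move=> le; apply: leq_trans le _; rewrite leq_add2r.
  by apply: leq_sum => c _; apply: leq_sum => t _; rewrite addn0.
- rewrite inE -mulnDr leq_mul2l; apply/orP; right.
  have := @sum_codom 1 L v; rewrite addn1 => /(_ (lt _ (leqnn L))).
  move=> le; apply: leq_trans le _; rewrite leq_add2r.
  by apply: leq_sum => c _; apply: leq_sum => t _; rewrite addn1.
have [c [t [tL -> ->]]] := zone e eE.
have tk : t + h.*2 + 1 < k by move: tL Lk; clear; lia.
split=> oj; last by move=> j_gt0; apply: (block_at_even_gap tk oj); rewrite j_gt0.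
apply: (block_at_odd_gap tk oj); rewrite ltn_neqAle jh andbT.
by apply: contraTneq oj => ->; rewrite odd_double.
Qed.
End Blocks.

(** * Absorbing a sparse remainder *)

Section Absorption.
Context (T : finType).
Implicit Types (E R D : {set T * T}) (u v x y : T) (q : T * seq T) (P : seq (T * seq T)).

Definition on_path q := [pred x | x \in q.1 :: q.2].

Lemma inn_setD1 R x v w : (x, v) \in R -> inn R w = (w == v) + inn (R :\ (x, v)) w.
Proof.
by move=> xvR; rewrite -[in LHS](setD1K xvR) inn_setU1 // !inE eqxx.
Qed.

(** Greedy choice: a path is left alone as long as the later paths from the same vertex can use up
    the surplus arcs there. Otherwise more than [t q.1] arcs remain, of which at most [t q.1] come
    from the path itself, so one can be put in front of it. *)
Lemma attach R P (t : T -> nat) :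
    (forall v, t v <= inn R v <= t v + starts P v) ->
    (forall q, q \in P -> #|[set x | ((x, q.1) \in R) && on_path q x]| <= t q.1) ->
  exists (Q : seq (T * seq T * option T)) R', [/\ map fst Q = P,
    forall qo x, qo \in Q -> qo.2 = Some x -> ((x, qo.1.1) \in R) && ~~ on_path qo.1 x,
    R' \subset R, forall v, inn R' v = t v &
    forall e, \sum_(qo <- Q) ((if qo.2 is Some x then (x, qo.1.1) == e else false) : nat)
       + (e \in R') = (e \in R)].
Proof.
elim: P R => [|q P IH] R bnd conf.
  exists [::], R; split=> // [v|e]; last by rewrite big_nil.
  by have := bnd v; rewrite /starts big_nil addn0; case: (ltngtP (t v)).
have st v : starts (q :: P) v = (q.1 == v) + starts P v by rewrite /starts big_cons.
have [le|lt] := leqP (inn R q.1) (t q.1 + starts P q.1).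
  have [||Q [R' [QP Qok RR tR dR]]] := IH R.
  - move=> v; have := bnd v; rewrite st; case: eqP => [<-|_] //=.
    by move=> /andP[-> _].
  - by move=> q' q'P; apply: conf; rewrite inE q'P orbT.
  exists ((q, None) :: Q), R'; split=> //=.
  - by rewrite QP.
  - by move=> qo x; rewrite inE => /orP[/eqP->//|]; apply: Qok.
  - by move=> e; rewrite big_cons /= add0n.
have [x xR nx] : exists2 x, (x, q.1) \in R & ~~ on_path q x.
  have : ~~ ([set x | (x, q.1) \in R] \subset [set x | ((x, q.1) \in R) && on_path q x]).
    apply/negP => /subset_leq_card; apply/negP; rewrite -ltnNge.
    apply: leq_ltn_trans (conf q (mem_head _ _)) _.
    by apply: leq_ltn_trans lt; rewrite leq_addr.
  by case/subsetPn => x; rewrite !inE => xR; rewrite xR; exists x.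
have innR w := inn_setD1 w xR.
have [||Q [R' [QP Qok RR tR dR]]] := IH (R :\ (x, q.1)).
- move=> v; have := bnd v; rewrite st innR [q.1 == v]eq_sym; case: eqP => [->|_] //=.
  by move: lt; rewrite innR eqxx; clear; lia.
- move=> q' q'P; apply: leq_trans (conf q' _); last by rewrite inE q'P orbT.
  by apply/subset_leq_card/subsetP => y; rewrite !inE => /andP[/andP[_ ->] ->].
exists ((q, Some x) :: Q), R'; split=> //=.
- by rewrite QP.
- move=> qo y; rewrite inE => /orP[/eqP-> /= [<-]|qoQ e]; first by rewrite xR.
  by have := Qok _ _ qoQ e; rewrite !inE => /andP[/andP[_ ->] ->].
- by apply: subset_trans RR (subsetDl _ _).
- move=> e; rewrite big_cons /= -addnA dR !inE eq_sym.
  by case: eqP => [->|_]; rewrite ?xR.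
Qed.

(** The last clause prepares the extension at the other end: a path gains no vertices except tails
    of arcs of [R]. *)
Lemma attach_fronts E R P (t : T -> nat) :
    decomposes E P -> [disjoint E & R] ->
    (forall v, t v <= inn R v <= t v + starts P v) ->
    (forall q, q \in P -> #|[set x | ((x, q.1) \in R) && on_path q x]| <= t q.1) ->
  exists P' R', [/\ R' \subset R, forall v, inn R' v = t v,
    decomposes (E :|: (R :\: R')) P', size P' = size P &
    (forall v, ends P' v = ends P v) /\
    forall q', q' \in P' -> exists2 q, q \in P & last q'.1 q'.2 = last q.1 q.2 /\
      forall x, on_path q' x -> on_path q x \/ exists v, (x, v) \in R].
Proof.
move=> [simP dec] ER bnd conf; have [Q [R' [QP Qok RR tR dR]]] := attach bnd conf.
pose ext (qo : T * seq T * option T) :=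
  if qo.2 is Some x then (x, qo.1.1 :: qo.1.2) else qo.1.
exists (map ext Q), R'; split=> //.
- split.
    apply/allP => _ /mapP[[q o] qQ ->].
    have sq : simple_path q by apply: (allP simP); rewrite -QP; apply: (map_f fst qQ).
    case: o qQ => [x|] qQ //=; have /andP[_] := Qok _ x qQ erefl.
    by rewrite /simple_path /= /on_path inE /= => ->.
  move=> e; rewrite big_map.
  transitivity (\sum_(qo <- Q) (((if qo.2 is Some x then (x, qo.1.1) == e else false) : nat) +
     count_mem e (arcs qo.1))).
    by apply: eq_bigr => -[q [x|]] _.
  rewrite big_split /= -(big_map fst xpredT (fun q => count_mem e (arcs q))) QP dec.
  have := dR e; rewrite !inE; have /setP/(_ e) := disjoint_setI0 ER; rewrite !inE.
  have := subsetP RR e.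
  case: (e \in R'); case: (e \in R); case: (e \in E) => //= h; rewrite ?addn0; do ?[by case];
    try (by have := h isT); by lia.
- by rewrite size_map -QP size_map.
split=> [v|q' /mapP[[q o] qQ ->]].
  rewrite /ends -QP !big_map; apply: eq_bigr => -[q [x|]] _ //=.
exists q; first by rewrite -QP; apply: (map_f fst qQ).
case: o qQ => [x|] qQ /=; split=> // y; last by left.
rewrite /on_path inE /= inE => /orP[/eqP->|]; last by left.
by have /andP[xR _] := Qok _ x qQ erefl; right; exists q.1.
Qed.

Definition rev_set E : {set T * T} := [set e | (e.2, e.1) \in E].
Definition rev_path q := (last q.1 q.2, rev (belast q.1 q.2)).

Lemma rev_setK : involutive rev_set.
Proof. by move=> E; apply/setP => -[x y]; rewrite !inE. Qed.

Lemma outn_rev E v : outn (rev_set E) v = inn E v.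
Proof. by rewrite outn_sum inn_sum; apply: eq_bigr => u _; rewrite inE. Qed.

Lemma inn_rev E v : inn (rev_set E) v = outn E v.
Proof. by rewrite -outn_rev rev_setK. Qed.

Lemma rev_path_seq q : (rev_path q).1 :: (rev_path q).2 = rev (q.1 :: q.2).
Proof. by case: q => x p; rewrite /rev_path /= (lastI x p) rev_rcons. Qed.

Lemma on_rev_path q : on_path (rev_path q) =1 on_path q.
Proof.
move=> x; change ((x \in (rev_path q).1 :: (rev_path q).2) = (x \in q.1 :: q.2)).
by rewrite rev_path_seq mem_rev.
Qed.

Lemma count_rev_path q x y :
  count_mem (x, y) (arcs (rev_path q)) = count_mem (y, x) (arcs q).
Proof.
case: q => z p; elim/last_ind: p => [//|p w IH].
rewrite arcs_rcons -(cats1 (arcs (z, p))) count_cat /= addn0 -IH /rev_path /= last_rcons belast_rcons.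
rewrite (lastI z p) rev_rcons /arcs /= addnC !xpair_eqE; congr (_ + _).
by rewrite andbC.
Qed.

Lemma decomposes_rev E P : decomposes E P -> decomposes (rev_set E) (map rev_path P).
Proof.
move=> [simP dec]; split.
  apply/allP => _ /mapP[q qP ->]; rewrite /simple_path rev_path_seq rev_uniq.
  exact: (allP simP).
move=> [x y]; rewrite big_map inE /= -dec; apply: eq_bigr => q _.
exact: count_rev_path.
Qed.

Lemma starts_rev P v : starts (map rev_path P) v = ends P v.
Proof. by rewrite /starts big_map. Qed.

Lemma attach_ends E R P (t : T -> nat) :
    decomposes E P -> [disjoint E & R] ->
    (forall v, t v <= outn R v <= t v + ends P v) ->
    (forall q, q \in P ->
       #|[set y | ((last q.1 q.2, y) \in R) && on_path q y]| <= t (last q.1 q.2)) ->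
  exists P' R', [/\ R' \subset R, forall v, outn R' v = t v,
    decomposes (E :|: (R :\: R')) P' & size P' = size P].
Proof.
move=> dec ER bnd conf.
have [|||P' [R' [RR tR dec' szP _]]] :=
  @attach_fronts (rev_set E) (rev_set R) (map rev_path P) t (decomposes_rev dec).
- rewrite -setI_eq0; apply/eqP/setP => -[x y]; rewrite !inE /=.
  by have /setP/(_ (y, x)) := disjoint_setI0 ER; rewrite !inE.
- by move=> v; rewrite inn_rev starts_rev.
- move=> _ /mapP[q qP ->]; apply: leq_trans (conf q qP).
  apply/subset_leq_card/subsetP => y; rewrite !in_set => /andP[yR].
  by rewrite on_rev_path => ->; rewrite andbT.
exists (map rev_path P'), (rev_set R'); split.
- by apply/subsetP => -[x y]; rewrite inE => /(subsetP RR); rewrite inE.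
- by move=> v; rewrite outn_rev.
- have := decomposes_rev dec'; congr (decomposes _ _).
  by apply/setP => -[x y]; rewrite !inE.
- by rewrite size_map szP size_map.
Qed.

Lemma decomposes_cat E E' P P' : [disjoint E & E'] ->
  decomposes E P -> decomposes E' P' -> decomposes (E :|: E') (P ++ P').
Proof.
move=> dis [simP dec] [simP' dec']; split; first by rewrite all_cat simP.
move=> e; rewrite big_cat /= dec dec' !inE.
have /setP/(_ e) := disjoint_setI0 dis; rewrite !inE.
by case: (e \in E); case: (e \in E').
Qed.

(** Of the s reserved in-arcs and the s reserved out-arcs at v, [kap v] of each kind prolong paths,
    and the remaining ones are joined into paths x, v, y; these account for the change in size.
    Since no tail of [Rin] is a head of [Rout], the two new ends of a path never coincide. *)
Lemma absorption E (Rin Rout : {set T * T}) P (kap : T -> nat) s :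
    decomposes E P ->
    [disjoint E & Rin] -> [disjoint E & Rout] -> [disjoint Rin & Rout] ->
    (forall u, (u, u) \notin Rin) -> (forall u, (u, u) \notin Rout) ->
    (forall v, inn Rin v = s) -> (forall v, outn Rout v = s) ->
    (forall x v w, (x, v) \in Rin -> (w, x) \notin Rout) ->
    (forall v, kap v <= s) ->
    (forall v, kap v <= starts P v) -> (forall v, kap v <= ends P v) ->
    (forall q, q \in P -> #|[set x | ((x, q.1) \in Rin) && on_path q x]| + kap q.1 <= s) ->
    (forall q, q \in P -> #|[set y | ((last q.1 q.2, y) \in Rout) && on_path q y]|
        + kap (last q.1 q.2) <= s) ->
  exists P', decomposes (E :|: Rin :|: Rout) P' /\
    size P' + \sum_v kap v = size P + s * #|T|.
Proof.
move=> dec dEi dEo dio li lo inR outR sep kap_s kap_st kap_en ci co.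
have [v|q qP|P1 [Ri [Ri_sub inRi dec1 sz1 [ends1 orig1]]]] :=
  @attach_fronts E Rin P (fun v => s - kap v) dec dEi.
- by rewrite inR leq_subr -leq_subLR subKn ?kap_s ?kap_st.
- by rewrite leq_subRL // addnC ci.
have [|v|q' q'P|P2 [Ro [Ro_sub outRo dec2 sz2]]] :=
  @attach_ends (E :|: (Rin :\: Ri)) Rout P1 (fun v => s - kap v) dec1.
- apply: disjointWl (_ : [disjoint E :|: Rin & Rout]); first exact/setUS/subsetDl.
  by rewrite -setI_eq0 setIUl setU_eq0 !setI_eq0 dEo.
- by rewrite outR leq_subr ends1 -leq_subLR subKn ?kap_s ?kap_en.
- have [q qP [eq_last onq]] := orig1 q' q'P; rewrite eq_last leq_subRL // addnC.
  apply: leq_trans (co q qP); rewrite leq_add2r; apply/subset_leq_card/subsetP => y.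
  rewrite !inE => /andP[yR]; rewrite yR => /onq[//|[v yv]].
  by have := sep _ _ (last q.1 q.2) yv; rewrite yR.
(* The leftover arcs of [Rin] as paths with one arc; with quota 0, [attach_ends] uses up the
   leftover arcs of [Rout] behind them. *)
pose P0 := [seq (e.1, [:: e.2]) | e <- enum Ri].
have arcs0 (e : T * T) : arcs (e.1, [:: e.2]) = [:: e] by case: e.
have dec0 : decomposes Ri P0.
  split.
    apply/allP => q /mapP[[x v]]; rewrite mem_enum => xv ->.
    rewrite /simple_path /= inE andbT; apply: contraTneq (subsetP Ri_sub _ xv) => ->.
    exact: li.
  move=> e; rewrite big_map; under eq_bigr do rewrite arcs0 /= addn0.
  rewrite big_enum /= big_mkcond (bigD1 e) //= eqxx big1 ?addn0 => [|e' /negbTE->].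
    by case: ifP.
  by case: ifP.
have ends0 v : ends P0 v = s - kap v.
  rewrite -inRi inn_sum /ends big_map big_enum /= big_mkcond.
  transitivity (\sum_w \sum_u (((u, w) \in Ri) && (w == v))); last first.
    rewrite (bigD1 v) //= [X in _ + X]big1 ?addn0; first by apply: eq_bigr => u _; rewrite eqxx andbT.
    by move=> w /negbTE->; rewrite big1 // => u _; rewrite andbF.
  rewrite exchange_big pair_big /=; apply: eq_bigr => -[u w] _ /=.
  by case: ((u, w) \in Ri).
have [|v|q0|P3 [R3 [R3_sub outR3 dec3 sz3]]] :=
  @attach_ends Ri Ro P0 (fun=> 0) dec0.
- exact: disjointWl Ri_sub (disjointWr Ro_sub dio).
- by rewrite outRo ends0 add0n leqnn.
- move=> /mapP[[x v]]; rewrite mem_enum => xv -> /=.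
  rewrite leqn0 cards_eq0; apply/eqP/setP => y; rewrite !inE /=.
  apply/negbTE/negP => /andP[vy] /orP[]/eqP ey.
    have := sep _ _ v (subsetP Ri_sub _ xv); rewrite -ey.
    by rewrite (subsetP Ro_sub _ vy).
  by have := lo v; rewrite -{2}ey (subsetP Ro_sub _ vy).
have R30 : R3 = set0.
  apply/eqP; rewrite -cards_eq0 card_outn big1 // => v _; exact: outR3.
rewrite R30 setD0 in dec3.
exists (P2 ++ P3); split.
  have -> : E :|: Rin :|: Rout = (E :|: (Rin :\: Ri) :|: (Rout :\: Ro)) :|: (Ri :|: Ro).
    apply/setP => e; rewrite !inE; have := subsetP Ri_sub e; have := subsetP Ro_sub e.
    by case: (e \in E); case: (e \in Rin); case: (e \in Rout); case: (e \in Ri) => //=;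
       case: (e \in Ro) => //= h h'; try (by have := h isT); try (by have := h' isT).
  apply: decomposes_cat => //; rewrite -setI_eq0; apply/eqP/setP => e.
  have /setP/(_ e) := disjoint_setI0 dEi; have /setP/(_ e) := disjoint_setI0 dEo.
  have /setP/(_ e) := disjoint_setI0 dio; rewrite !inE.
  have := subsetP Ri_sub e; have := subsetP Ro_sub e.
  by case: (e \in E); case: (e \in Rin); case: (e \in Rout); case: (e \in Ri) => //=;
     case: (e \in Ro) => //= h h'; try (by have := h isT); try (by have := h' isT).
rewrite size_cat sz2 sz1 sz3 size_map -cardE -addnA; congr (_ + _).
rewrite card_inn -big_split /= mulnC -sum_nat_const; apply: eq_bigr => v _.
by rewrite inRi subnK.
Qed.

End Absorption.

Lemma trim_inn (T : finType) (R : {set T * T}) s : (forall v, s <= inn R v) ->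
  exists R' : {set T * T}, R' \subset R /\ forall v, inn R' v = s.
Proof.
move=> sR; exists [set e in R | e.1 \in take s (enum [set x | (x, e.2) \in R])].
split; first by apply/subsetP => e; rewrite inE => /andP[].
move=> v; rewrite /inn.
have -> : [set u | (u, v) \in [set e in R | e.1 \in take s (enum [set x | (x, e.2) \in R])]]
   = [set u in take s (enum [set x | (x, v) \in R])].
  apply/setP => u; rewrite !inE /=; case: (boolP (u \in take _ _)); last by rewrite andbF.
  by move/mem_take; rewrite mem_enum inE => ->.
rewrite cardsE; have /card_uniqP-> : uniq (take s (enum [set x | (x, v) \in R])).
  by rewrite take_uniq // enum_uniq.
by rewrite size_takel // -cardE; apply: sR.
Qed.

Lemma outn_setU (T : finType) (E F : {set T * T}) v : [disjoint E & F] ->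
  outn (E :|: F) v = outn E v + outn F v.
Proof.
move=> /disjoint_setI0/setP EF; rewrite !outn_sum -big_split; apply: eq_bigr => w _ /=.
by have := EF (v, w); rewrite !inE; case: (_ \in E); case: (_ \in F).
Qed.

Lemma inn_setU (T : finType) (E F : {set T * T}) v : [disjoint E & F] ->
  inn (E :|: F) v = inn E v + inn F v.
Proof.
move=> /disjoint_setI0/setP EF; rewrite !inn_sum -big_split; apply: eq_bigr => w _ /=.
by have := EF (w, v); rewrite !inE; case: (_ \in E); case: (_ \in F).
Qed.

Lemma outn_sub (T : finType) (E F : {set T * T}) v : E \subset F -> outn E v <= outn F v.
Proof.
move=> EF; apply/subset_leq_card/subsetP => w; rewrite !inE; exact: (subsetP EF).
Qed.

Lemma inn_sub (T : finType) (E F : {set T * T}) v : E \subset F -> inn E v <= inn F v.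
Proof.
move=> EF; apply/subset_leq_card/subsetP => w; rewrite !inE; exact: (subsetP EF).
Qed.

(** Such a path has at most one vertex in each block of [B]; this limits the conflicts of the long
    paths with the reserved arcs. *)
Lemma card_on_path_le (T : finType) (bl : T -> nat) (q : T * seq T) (A : {set T}) (B : seq nat) :
    uniq [seq bl x | x <- q.1 :: q.2] ->
    (forall x, x \in A -> on_path q x && (bl x \in B)) -> #|A| <= size B.
Proof.
move=> uq AB; pose s := [seq x <- q.1 :: q.2 | x \in A].
have sub_s : A \subset s.
  apply/subsetP => x xA; rewrite mem_filter xA.
  by have /andP[] := AB x xA.
apply: leq_trans (subset_leq_card sub_s) (leq_trans (card_size s) _).
rewrite -(size_map bl); apply: uniq_leq_size.
  by apply: subseq_uniq uq; apply/map_subseq/filter_subseq.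
by move=> y /mapP[x]; rewrite mem_filter => /andP[/AB/andP[_ xB] _] ->.
Qed.

Lemma short_path_conflict (T : finType) (q : T * seq T) (A : {set T}) k :
  (forall x, x \in A -> on_path q x) -> size q.2 <= k -> #|A| <= k.+1.
Proof.
move=> AB qk; have sub_s : A \subset q.1 :: q.2 by apply/subsetP => x /AB.
by apply: leq_trans (subset_leq_card sub_s) (leq_trans (card_size _) _).
Qed.

(** * Deterministic conditions for an optimal decomposition *)

Section Deterministic.
Context (n k b h L r d l w s : nat) (D Rin0 Rout0 : {set 'I_n.+1 * 'I_n.+1}).
Hypotheses (k_gt0 : 0 < k) (k_even : ~~ odd k) (bE : b = n.+1 %/ k) (l_gt0 : 0 < l).
Hypothesis loopless : forall v, (v, v) \notin D.
Hypothesis LE : L + h.*2 + 1 = k.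
Hypothesis cut : forall (c : 'I_k) t (X Y : {set 'I_b}), t < L -> r * (#|X| + #|Y|) <=
  #|[set e : 'I_b * 'I_b | (@vertex_at n k b c t e.1, @vertex_at n k b c t.+1 e.2) \in D]
      :&: setX X Y| + r * b.
Hypothesis out_le : forall v, outn D v + r * (k %/ b.+1).+1 <= r * L + d.
Hypothesis in_le : forall v, inn D v + r * (k %/ b.+1).+1 <= r * L + d.
Hypothesis Rin_sub : Rin0 \subset D.
Hypothesis Rout_sub : Rout0 \subset D.
Hypothesis Rin_block : forall e, e \in Rin0 ->
  exists2 i, i < h & block k e.1 = (block k e.2 + i.*2.+1) %% k.
Hypothesis Rout_block : forall e, e \in Rout0 ->
  exists2 i, i < h & block k e.2 = (block k e.1 + i.*2.+2) %% k.
Hypothesis Rin_in : forall v, s <= inn Rin0 v.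
Hypothesis Rout_out : forall v, s <= outn Rout0 v.
Hypothesis Rin_out : forall v, outn Rin0 v <= outn D v - inn D v.
Hypothesis Rout_in : forall v, inn Rout0 v <= inn D v - outn D v.
Hypothesis capacity : 2 * r + (d %/ l).+1 + w + maxn l.+1 h <= s.
Hypothesis potential : n.+1 * 'C(d + l, d) < 2 ^ w.+1.

Lemma optimal_decomposition :
  exists P, decomposes D P /\ size P = \sum_v (outn D v - inn D v).
Proof.
have [Rin [Rin_sub0 Rin_s]] := trim_inn Rin_in.
have [Rout [Rout_sub0 Rout_s]] : exists R' : {set 'I_n.+1 * 'I_n.+1},
    R' \subset Rout0 /\ forall v, outn R' v = s.
  have [v|R [Rsub Rs]] := @trim_inn _ (rev_set Rout0) s; first by rewrite inn_rev.
  exists (rev_set R); split=> [|v]; last by rewrite outn_rev.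
  by apply/subsetP => -[x y]; rewrite inE => /(subsetP Rsub); rewrite inE.
have RinD := subset_trans Rin_sub0 Rin_sub.
have RoutD := subset_trans Rout_sub0 Rout_sub.
(* An arc in both would have a block difference that is odd by [Rin_block] and even by [Rout_block];
   parity makes sense modulo the even number k. *)
have disIO : [disjoint Rin & Rout].
  rewrite -setI_eq0; apply/eqP/setP => e; rewrite !inE; apply/negbTE/negP => /andP[].
  move=> /(subsetP Rin_sub0)/Rin_block[i ih ei] /(subsetP Rout_sub0)/Rout_block[j jh ej].
  have := ej; rewrite ei modnDml -addnA => e1.
  have odd_mod m : odd (m %% k) = odd m by rewrite [in RHS](divn_eq m k) oddD oddM (negbTE k_even) andbF.
  by have := congr1 odd e1; rewrite [in RHS]odd_mod !oddD /= !odd_double /= addbT; case: (odd (block k e.2)).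
have [E1 [P1 [E1D dec1 uq1 stend1 [out1 in1 zone1]]]] :=
  @block_path_system n k b k_gt0 k_even bE D r h L LE cut.
have disE1I : [disjoint E1 & Rin].
  rewrite -setI_eq0; apply/eqP/setP => e; rewrite !inE; apply/negbTE/negP => /andP[eE].
  move=> /(subsetP Rin_sub0)/Rin_block[i ih].
  have [|zo _] := zone1 e i.*2.+1 eE; first by move: ih; clear; lia.
  by apply: zo; rewrite /= odd_double.
have disE1O : [disjoint E1 & Rout].
  rewrite -setI_eq0; apply/eqP/setP => e; rewrite !inE; apply/negbTE/negP => /andP[eE].
  move=> /(subsetP Rout_sub0)/Rout_block[i ih].
  have [|_ zo] := zone1 e i.*2.+2 eE; first by move: ih; clear; lia.
  by apply: zo; rewrite //= negbK odd_double.
pose E2 := D :\: (E1 :|: Rin :|: Rout).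
have E2D : E2 \subset D by exact: subsetDl.
have disE2 (F : {set 'I_n.+1 * 'I_n.+1}) : F \subset E1 :|: Rin :|: Rout -> [disjoint E2 & F].
  move=> sF; apply: (disjointWr sF); rewrite -setI_eq0; apply/eqP/setP => e.
  by rewrite in_setI in_setD in_set0; case: (e \in _ :|: _); rewrite ?andbF.
have dis12 : [disjoint E1 & E2].
  by rewrite disjoint_sym; apply: disE2; rewrite -setUA subsetUl.
have disE2I : [disjoint E2 & Rin] by apply: disE2; rewrite setUAC subsetUr.
have disE2O : [disjoint E2 & Rout] by apply: disE2; rewrite subsetUr.
pose E := E1 :|: E2.
have disEI : [disjoint E & Rin] by rewrite -setI_eq0 setIUl setU_eq0 !setI_eq0 disE1I.
have disEO : [disjoint E & Rout] by rewrite -setI_eq0 setIUl setU_eq0 !setI_eq0 disE1O.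
have DE : D = E :|: Rin :|: Rout.
  apply/setP => e; rewrite !inE.
  have := subsetP E1D e; have := subsetP RinD e; have := subsetP RoutD e.
  case: (e \in E1); case: (e \in Rin); case: (e \in Rout) => h1 h2 h3;
    first [by rewrite (h1 isT) | by rewrite (h2 isT) | by rewrite (h3 isT) | by case: (e \in D)].
have disEIO : [disjoint E :|: Rin & Rout].
  by rewrite -setI_eq0 setIUl setU_eq0 !setI_eq0 disEO.
have outD v : outn D v = outn E1 v + outn E2 v + outn Rin v + s.
  by rewrite DE !outn_setU // Rout_s.
have inD v : inn D v = inn E1 v + inn E2 v + s + inn Rout v.
  by rewrite DE !inn_setU // Rin_s.
have [|u|u||P2 [dec2 size2 st2]] := @walk_decomposition _ E2 d l w l_gt0.
- by move=> u; apply: contra (loopless u); apply: (subsetP E2D).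
- by move: (out1 u) (out_le u) (outD u); clear; lia.
- by move: (in1 u) (in_le u) (inD u); clear; lia.
- by rewrite card_ord.
have dec := decomposes_cat dis12 dec1 dec2.
have stC v : starts (P1 ++ P2) v = starts P1 v + starts P2 v by rewrite /starts big_cat.
have enC v : ends (P1 ++ P2) v = ends P1 v + ends P2 v by rewrite /ends big_cat.
(* By [sum_starts_ends] this is the smaller of the numbers of paths starting and ending at v. *)
pose kap v := starts (P1 ++ P2) v - (outn E v - inn E v).
have se v := sum_starts_ends v dec.
have se1 v := sum_starts_ends v dec1.
have se2 v := sum_starts_ends v dec2.
have outE v : outn E v = outn E1 v + outn E2 v by rewrite outn_setU.
have inE' v : inn E v = inn E1 v + inn E2 v by rewrite inn_setU.
(* One r bounds the starts of [P1] at v, the other the amount by which [E1] can lower the excess of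
   [E2] to which [P2] is adapted. *)
have kap_le v : kap v <= 2 * r + (d %/ l).+1 + w.
  have [st1 en1] := stend1 v.
  move: (se1 v) (st2 v); rewrite /kap stC outE inE'; move: st1 en1.
  move: (_ %/ _) (starts P1 v) (ends P1 v) (starts P2 v) => z x1 y1 x2.
  move: (outn E1 v) (outn E2 v) (inn E1 v) (inn E2 v) => o1 o2 i1 i2; clear; lia.
have kapE v : kap v + (outn E v - inn E v) = starts (P1 ++ P2) v.
  by move: (se v); rewrite -!/E /kap; clear; lia.
have kap_en v : kap v <= ends (P1 ++ P2) v.
  by move: (se v); rewrite -!/E /kap; clear; lia.
have kap_max v : kap v + maxn l.+1 h <= s.
  by apply: leq_trans capacity; rewrite leq_add2r.
have confl (q : 'I_n.+1 * seq 'I_n.+1) (A : {set 'I_n.+1}) (B : seq nat) :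
    q \in P1 ++ P2 -> (forall x, x \in A -> on_path q x && (block k x \in B)) ->
    size B <= h -> #|A| <= maxn l.+1 h.
  rewrite mem_cat => /orP[q1|q2] AB Bh.
    by rewrite leq_max (leq_trans (card_on_path_le (uq1 _ q1) AB) Bh) orbT.
  rewrite leq_max (short_path_conflict _ (allP size2 _ q2)) // => x /AB.
  by case/andP.
have RinP v x : (x, v) \in Rin -> outn D x - inn D x > 0.
  move=> xv; apply: leq_trans (Rin_out x); apply/card_gt0P; exists v.
  by rewrite inE (subsetP Rin_sub0).
have RoutP v x : (v, x) \in Rout -> inn D x - outn D x > 0.
  move=> xv; apply: leq_trans (Rout_in x); apply/card_gt0P; exists v.
  by rewrite inE (subsetP Rout_sub0).
have [|u|x v u xv|v|v|v|q qP|q qP|P [decP sizeP]] :=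
  @absorption _ E Rin Rout (P1 ++ P2) kap s dec disEI disEO disIO _ _ Rin_s Rout_s.
- by move=> u; apply: contra (loopless u); apply: (subsetP RinD).
- by apply: contra (loopless u); apply: (subsetP RoutD).
- by apply/negP => /RoutP; move: (RinP _ _ xv); clear; lia.
- by apply: leq_trans (kap_max v); rewrite leq_addr.
- by rewrite leq_subr.
- exact: kap_en.
- apply: leq_trans (kap_max q.1); rewrite addnC leq_add2l.
  apply: (confl q _ [seq (block k q.1 + i.*2.+1) %% k | i <- iota 0 h]) => //.
    move=> x; rewrite in_set => /andP[xR ->] /=.
    have [i ih /= ->] := Rin_block (subsetP Rin_sub0 _ xR).
    by apply: map_f; rewrite mem_iota.
  by rewrite size_map size_iota.
- apply: leq_trans (kap_max (last q.1 q.2)); rewrite addnC leq_add2l.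
  apply: (confl q _ [seq (block k (last q.1 q.2) + i.*2.+2) %% k | i <- iota 0 h]) => //.
    move=> x; rewrite in_set => /andP[xR ->] /=.
    have [i ih /= ->] := Rout_block (subsetP Rout_sub0 _ xR).
    by apply: map_f; rewrite mem_iota.
  by rewrite size_map size_iota.
exists P; split; first by rewrite DE.
apply/eqP; rewrite -(eqn_add2r (\sum_v kap v)) sizeP.
have -> : size (P1 ++ P2) = \sum_v starts (P1 ++ P2) v.
  rewrite /starts exchange_big -sum1_size; apply: eq_bigr => q _ /=.
  by rewrite (bigD1 q.1) //= eqxx big1 // => v; rewrite eq_sym => /negbTE->.
have -> : s * #|'I_n.+1| = \sum_v outn Rin v.
  by rewrite -card_outn card_inn mulnC -sum_nat_const; apply: eq_bigr => v _; rewrite Rin_s.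
(* Together [Rin] and [Rout] change the out-degree minus the in-degree of v by [outn Rin v] minus
   [inn Rout v]. By [outR] and [inR] this never reverses its sign, so the truncated differences add
   up. *)
rewrite -!big_split /=; apply/eqP/eq_bigr => v _.
have outR : outn Rin v <= outn D v - inn D v.
  by apply: leq_trans (Rin_out v); apply: outn_sub.
have inR : inn Rout v <= inn D v - outn D v.
  by apply: leq_trans (Rout_in v); apply: inn_sub.
move: (kapE v) (outD v) (inD v) outR inR; rewrite outE inE'.
move: (kap v) (starts _ v) (outn D v) (inn D v) => x y z t.
move: (outn E1 v) (outn E2 v) (inn E1 v) (inn E2 v) (outn Rin v) (inn Rout v).
by move=> o1 o2 i1 i2 ri ro; clear; lia.
Qed.
End Deterministic.

(** * Consistency of digraphs *)

From mathcomp Require Import all_order all_algebra.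
Import Order.TTheory GRing.Theory Num.Theory.

Section Consistency.
Context (T : finType) (D : digraph T).
Let E := edges D.
Implicit Types (q : T * seq T) (e : T * T) (s : seq T).

Definition edge_set q : {set T * T} := [set e in arcs q].

Lemma path_edges_cons x p : path_edges (x :: p) = edge_set (x, p).
Proof.
apply/setP => e; rewrite !inE /arcs /=; congr (e \in _).
by elim: p x => //= y p IH x; rewrite IH.
Qed.

Lemma path_arcs (r : rel T) q : path r q.1 q.2 = all (fun e => r e.1 e.2) (arcs q).
Proof. by case: q => x p; rewrite /arcs /=; elim: p x => //= y p IH x; rewrite IH. Qed.

Lemma arcs_uniq q : simple_path q -> uniq (arcs q).
Proof.
case: q => x p; rewrite /simple_path /arcs /= => /andP[xp up].
apply: (@map_uniq _ _ snd); suff -> : [seq e.2 | e <- pairmap pair x p] = p by [].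
by elim: p x {xp up} => //= y p IH x; rewrite IH.
Qed.

Lemma count_arcs q e : simple_path q -> count_mem e (arcs q) = (e \in edge_set q).
Proof. by move=> sq; rewrite inE count_uniq_mem // arcs_uniq. Qed.

Lemma edge_set_eq0 q : (edge_set q == set0) = (q.2 == [::]).
Proof.
case: q => x [|y p]; first by apply/eqP/setP => e; rewrite !inE.
by apply/negbTE/set0Pn; exists (x, y); rewrite inE mem_head.
Qed.

(** Without the trivial paths all edge sets are nonempty, hence distinct because they are
    disjoint. *)
Lemma path_decomposition_of P : decomposes E P ->
  exists2 Q, path_decomposition D Q & (size Q <= size P)%N.
Proof.
move=> [simP dec]; pose P' := [seq q <- P | q.2 != [::]].
have sim' q : q \in P' -> simple_path q.
  by rewrite mem_filter => /andP[_ /(allP simP)].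
have dec' e : (\sum_(q <- P') (e \in edge_set q) = (e \in E))%N.
  rewrite -dec big_filter big_mkcond big_seq [RHS]big_seq; apply: eq_bigr => q qP.
  rewrite -count_arcs ?(allP simP) //; case: ifP => // /negbFE/eqP q2.
  by rewrite /arcs q2.
exists [seq q.1 :: q.2 | q <- P']; last by rewrite size_map size_filter count_size.
have mapE : [seq path_edges s | s <- [seq q.1 :: q.2 | q <- P']] = [seq edge_set q | q <- P'].
  by rewrite -map_comp; apply: eq_map => -[x p] /=; rewrite path_edges_cons.
have qE q e : q \in P' -> e \in edge_set q -> e \in E.
  by move=> qP eq; have := dec' e; rewrite (big_rem _ qP) /= eq; case: (e \in E).
have two q q' e : q \in P' -> q' \in P' -> q != q' -> e \in edge_set q -> e \notin edge_set q'.
  move=> qP qP' qq eq; apply/negP => eq'; have := dec' e.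
  have q'r : q' \in rem q P'.
    by have := perm_mem (perm_to_rem qP) q'; rewrite qP' in_cons eq_sym (negbTE qq) => /esym.
  by rewrite (big_rem _ qP) /= eq (big_rem _ q'r) /= eq'; case: (e \in E).
rewrite /path_decomposition mapE; apply/and3P; split.
- apply/allP => s /mapP[q qP ->]; rewrite /dipath -/(simple_path q) sim' //=.
  rewrite path_arcs; apply/allP => -[x y] xy; rewrite /edge.
  by apply: (qE q); rewrite ?inE.
- have : {in P', forall q, edge_set q != set0}.
    by move=> q; rewrite mem_filter edge_set_eq0 => /andP[].
  have : forall e, (\sum_(q <- P') (e \in edge_set q) <= 1)%N.
    by move=> e; rewrite dec'; case: (e \in E).
  elim: P' {sim' dec' mapE qE two} => //= q P' IH le1 ne; rewrite IH ?andbT; first last.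
  + by move=> q' q'P; apply: ne; rewrite inE q'P orbT.
  + by move=> e; have := le1 e; rewrite big_cons; case: (_ \in _) => //; case: (\sum_(_ <- _) _)%N.
  apply/mapP => -[q' q'P eq]; have /set0Pn[e eE] := ne q (mem_head _ _).
  by have := le1 e; rewrite big_cons (big_rem _ q'P) /= -eq eE.
- apply/and3P; split.
  + apply/eqP/setP => e; apply/bigcupP/idP => [[A]|eE].
      by rewrite inE => /mapP[q qP ->]; apply: qE.
    have : (0 < \sum_(q <- P') (e \in edge_set q))%N by rewrite dec' -/E eE.
    rewrite lt0n sum_nat_seq_neq0 => /hasP[q qP /=]; rewrite eqb0 negbK => eq.
    by exists (edge_set q) => //; rewrite inE; apply: map_f.
  + apply/trivIsetP => A B; rewrite !inE => /mapP[q qP ->] /mapP[q' qP' ->] ne.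
    rewrite -setI_eq0; apply/eqP/setP => e; rewrite in_setI in_set0; apply/negbTE.
    apply/negP => /andP[eq]; apply/negP; apply: (two q) => //.
    by apply: contra ne => /eqP->.
  + rewrite inE; apply/mapP => -[q qP /esym/eqP].
    by rewrite edge_set_eq0; move: qP; rewrite mem_filter => /andP[/negbTE->].
Qed.

Lemma decomposes_of Q : path_decomposition D Q ->
  exists2 P, decomposes E P & size P = size Q.
Proof.
move=> /and3P[/allP dip uQ /and3P[/eqP cov /trivIsetP triv nz]].
have sQ s : s \in Q -> exists q, s = q.1 :: q.2.
  case: s => [sQ|x p _]; last by exists (x, p).
  case/negP: nz; rewrite inE; apply/mapP; by exists [::] => //; apply/setP => e; rewrite !inE.
have [P QE] : exists P, Q = [seq q.1 :: q.2 | q <- P].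
  elim: Q sQ {dip uQ cov triv nz} => [|s Q IH] sQ; first by exists [::].
  have [|P ->] := IH; first by move=> s' s'Q; apply: sQ; rewrite inE s'Q orbT.
  by have [q ->] := sQ s (mem_head _ _); exists (q :: P).
exists P; last by rewrite QE size_map.
have simP q : q \in P -> simple_path q.
  by move=> qP; have /andP[] : dipath D (q.1 :: q.2) by apply: dip; rewrite QE map_f.
split; first exact/allP.
have mapE : [seq path_edges s | s <- Q] = [seq edge_set q | q <- P].
  by rewrite QE -map_comp; apply: eq_map => -[x p] /=; rewrite path_edges_cons.
rewrite mapE in uQ cov triv nz => e.
transitivity (\sum_(A <- [seq edge_set q | q <- P]) (e \in A) : nat)%N.
  rewrite big_map big_seq [RHS]big_seq; apply: eq_bigr => q qP.
  by rewrite count_arcs ?simP.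
rewrite big_uniq //=; have [eE|neE] := boolP (e \in E); last first.
  rewrite big1 // => A AP; apply/eqP; rewrite eqb0; apply: contra neE => eA.
  by rewrite /E -cov; apply/bigcupP; exists A; rewrite ?inE.
move: eE; rewrite /E -cov => /bigcupP[A]; rewrite inE => AP eA.
rewrite (bigD1 A) //= eA big1 // => B /andP[BP BA]; apply/eqP; rewrite eqb0.
have /disjoint_setI0/setP/(_ e) : [disjoint B & A] by apply: triv; rewrite ?inE.
by rewrite !inE eA andbT => ->.
Qed.

(** The signed excesses sum to 0, so their positive and negative parts have equal sums; truncated
    subtraction yields the positive part. *)
Lemma excessE : excess D = ((\sum_v (outn E v - inn E v))%N%:R)%R.
Proof.
rewrite /excess.
have -> : (\sum_v `|vertex_excess D v| = ((\sum_v (outn E v - inn E v)).*2)%N%:Z)%R.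
  have sumE : (\sum_v (outn E v - inn E v) = \sum_v (inn E v - outn E v))%N.
    apply/eqP; rewrite -(eqn_add2r (\sum_u inn E u)) -{2}card_inn card_outn.
    by rewrite -!big_split /=; apply/eqP/eq_bigr => v _; lia.
  rewrite -addnn {2}sumE -big_split /= (big_morph Posz PoszD (erefl 0%:Z%R)).
  apply: eq_bigr => v _; rewrite /vertex_excess /outdeg /indeg.
  by rewrite -/(outn E v) -/(inn E v); lia.
by rewrite -addnn PoszD rmorphD /= -[X in (X / _)%R]mulr2n -[X in (X / _)%R]mulr_natr mulfK // pmulrn.
Qed.

Lemma excess_le P : decomposes E P -> (\sum_v (outn E v - inn E v) <= size P)%N.
Proof.
move=> dec; have -> : size P = (\sum_v starts P v)%N.
  rewrite /starts exchange_big -sum1_size; apply: eq_bigr => q _ /=.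
  by rewrite (bigD1 q.1) //= eqxx big1 // => v; rewrite eq_sym => /negbTE->.
by apply: leq_sum => v _; have := sum_starts_ends v dec; lia.
Qed.

Lemma consistent_of P : decomposes E P -> size P = (\sum_v (outn E v - inn E v))%N ->
  consistent D.
Proof.
move=> dec szP; rewrite /consistent excessE eqr_nat eqn_leq; apply/andP; split.
  have [Q QD sQ] := path_decomposition_of dec; rewrite -szP (leq_trans _ sQ) //.
  rewrite /path_number; case: ex_minnP => m _; apply.
  by apply/boolp.asboolP; exists Q.
rewrite /path_number; case: ex_minnP => m /boolp.asboolP[Q QD <-] _.
by have [P' dec' <-] := decomposes_of QD; apply: excess_le.
Qed.

End Consistency.

(** * Probability on digraphs *)

From mathcomp Require Import reals sequences exp ring lra.
Local Open Scope ring_scope.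

Section Probability.
Context (R : realType) (n : nat) (p : R).
Hypothesis p01 : 0 <= p <= 1.
Notation I := 'I_n.
Implicit Types (D : digraph 'I_n) (S : {set I * I}) (f g : digraph 'I_n -> R) (A B : pred (digraph 'I_n)).

Definition mean f : R := \sum_D Dnp_mass p D * f D.
Definition prob A : R := mean (fun D => (A D)%:R).

Lemma probE A : Dnp_prob p A = prob A.
Proof.
rewrite /Dnp_prob /prob /mean big_mkcond; apply: eq_bigr => D _ /=.
by case: (A D); rewrite ?mulr1 ?mulr0.
Qed.

Lemma mass_ge0 D : 0 <= Dnp_mass p D.
Proof.
by apply: prodr_ge0 => e _; case: ifP => _; move: p01; lra.
Qed.

Lemma mean_prod (phi : I * I -> bool -> R) :
  mean (fun D => \prod_(e | e.1 != e.2) phi e (e \in edges D)) =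
  \prod_(e : I * I | e.1 != e.2) (p * phi e true + (1 - p) * phi e false).
Proof.
rewrite big_mkcond /=.
(* On the diagonal [F] is 0 and [G] is 1, so in the expanded product the sets with a loop vanish and
   the others keep their mass. *)
pose F (e : I * I) : R := if e.1 != e.2 then p * phi e true else 0.
pose G (e : I * I) : R := if e.1 != e.2 then (1 - p) * phi e false else 1.
transitivity (\prod_e (F e + G e)); last first.
  by apply: eq_bigr => e _; rewrite /F /G; case: ifP => _; rewrite ?add0r.
rewrite bigA_distr /mean.
pose w (J : {set I * I}) : R := \prod_e (if e \in J then F e else G e).
transitivity (\sum_(J : {set I * I} | [forall v, (v, v) \notin J]) w J); last first.
  symmetry; rewrite (bigID (fun J : {set I * I} => [forall v, (v, v) \notin J])) /=.
  rewrite [X in _ + X]big1 ?addr0 // => J; rewrite negb_forall => /existsP[v].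
  by rewrite negbK => vJ; rewrite (bigD1 (v, v)) //= vJ /F eqxx mul0r.
rewrite (reindex_omap (val : digraph I -> {set I * I}) insub) /=; last first.
  by move=> J lJ; rewrite insubT.
have -> : \sum_(j : digraph I | [forall v, (v, v) \notin edges j] && (insub (edges j) == Some j))
    w (edges j) = \sum_j w (edges j).
  by apply: eq_bigl => D; rewrite (edges_loopless D) /= (valK D) eqxx.
apply: eq_bigr => D _; rewrite /Dnp_mass -big_split /= big_mkcond; apply: eq_bigr => e _.
rewrite /F /G; case: (boolP (e.1 != e.2)) => ne; case: ifP => eD //.
by move: ne; rewrite negbK => /eqP e12; have /forallP/(_ e.1) := edges_loopless D;
   rewrite {2}e12 -surjective_pairing eD.
Qed.

Lemma mean1 : mean (fun=> 1) = 1.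
Proof.
have m1 := mean_prod (fun _ _ => 1); rewrite [RHS]big1 in m1; last by move=> e _; ring.
by rewrite -[RHS]m1; apply: eq_bigr => D _; rewrite big1.
Qed.

Lemma mean_le f g : (forall D, f D <= g D) -> mean f <= mean g.
Proof. by move=> fg; apply: ler_sum => D _; apply: ler_wpM2l; rewrite ?mass_ge0. Qed.

Lemma meanZ c f : mean (fun D => c * f D) = c * mean f.
Proof. by rewrite /mean big_distrr; apply: eq_bigr => D _; rewrite mulrCA. Qed.

Lemma meanD f g : mean (fun D => f D + g D) = mean f + mean g.
Proof. by rewrite /mean -big_split; apply: eq_bigr => D _; rewrite mulrDr. Qed.

Lemma mean_sum (J : finType) (F : J -> digraph I -> R) :
  mean (fun D => \sum_j F j D) = \sum_j mean (F j).
Proof.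
by rewrite /mean exchange_big; apply: eq_bigr => D _; rewrite big_distrr.
Qed.

Lemma prob_ge0 A : 0 <= prob A.
Proof. by apply: sumr_ge0 => D _; rewrite mulr_ge0 ?mass_ge0 ?ler0n. Qed.

Lemma prob_mono A B : (forall D, A D -> B D) -> prob A <= prob B.
Proof.
by move=> AB; apply: mean_le => D; rewrite ler_nat; case: (boolP (A D)) => // /AB ->.
Qed.

Lemma prob_eq0 A : A =1 xpred0 -> prob A = 0.
Proof. by move=> A0; rewrite /prob /mean big1 // => D _; rewrite A0 mulr0. Qed.

Lemma prob_le1 A : prob A <= 1.
Proof.
by rewrite -mean1; apply: mean_le => D; rewrite -[1]/(1%:R) ler_nat; case: (A D).
Qed.

Lemma prob_compl A : prob A = 1 - prob (fun D => ~~ A D).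
Proof.
rewrite -mean1 /prob; apply/eqP; rewrite eq_sym subr_eq -meanD; apply/eqP/eq_bigr => D _.
by case: (A D); rewrite ?addr0 ?add0r.
Qed.

Lemma prob_or A B : prob (fun D => A D || B D) <= prob A + prob B.
Proof.
rewrite -meanD; apply: mean_le => D; rewrite -natrD ler_nat.
by case: (A D); case: (B D).
Qed.

Lemma prob_exists (J : finType) (A : J -> pred (digraph I)) :
  prob (fun D => [exists j, A j D]) <= \sum_j prob (A j).
Proof.
rewrite -mean_sum; apply: mean_le => D; rewrite -natr_sum ler_nat.
by case: existsP => // -[j jD]; rewrite (bigD1 j) //= jD.
Qed.

Lemma markov A f c : 0 < c -> (forall D, 0 <= f D) -> (forall D, A D -> c <= f D) ->
  prob A <= mean f / c.
Proof.
move=> c_gt0 f0 Af; rewrite ler_pdivlMr // mulrC -meanZ; apply: mean_le => D.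
by case: (boolP (A D)) => [/Af|]; rewrite ?mulr1 ?mulr0.
Qed.

Definition depends_on S f :=
  forall D D', (forall e, e \in S -> (e \in edges D) = (e \in edges D')) -> f D = f D'.

Lemma mix_loopless S D D' : [forall v, (v, v) \notin (edges D :&: S) :|: (edges D' :\: S)].
Proof.
apply/forallP => v; rewrite !inE.
have /forallP/(_ v) := edges_loopless D; have /forallP/(_ v) := edges_loopless D'.
by move=> /negbTE-> /negbTE->; rewrite andbF.
Qed.
Definition mix S D D' := Digraph (mix_loopless S D D').

Lemma in_mix S D D' e : (e \in edges (mix S D D')) = if e \in S then e \in edges D else e \in edges D'.
Proof. by rewrite !inE; case: (e \in S); rewrite ?andbT ?andbF ?orbF. Qed.

Lemma digraph_inj D D' : edges D =i edges D' -> D = D'.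
Proof. by move=> e; apply/val_inj/setP. Qed.

(* Exchanging the arcs outside S between two independent copies of the digraph
   preserves the law of the pair. *)
Lemma mean_indep S f g : depends_on S f -> depends_on (~: S) g ->
  mean (fun D => f D * g D) = mean f * mean g.
Proof.
move=> fS gS; pose h (x : digraph I * digraph I) := (mix S x.1 x.2, mix S x.2 x.1).
have hK : involutive h.
  move=> [D D']; rewrite /h /=; congr (_, _); apply: digraph_inj => e;
    by rewrite !in_mix; case: (e \in S).
transitivity (\sum_(x : digraph I * digraph I)
    (Dnp_mass p x.1 * (f x.1 * g x.1)) * Dnp_mass p x.2).
  rewrite -(pair_bigA _ (fun D D' => Dnp_mass p D * (f D * g D) * Dnp_mass p D')) /=.
  apply: eq_bigr => D _; rewrite -big_distrr /=.
  have -> : \sum_(D' : digraph I) Dnp_mass p D' = 1; last by rewrite mulr1.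
  by rewrite -[RHS]mean1 /mean; apply: eq_bigr => D' _; rewrite mulr1.
rewrite (reindex_inj (inv_inj hK)) /mean big_distrl /=.
under [RHS]eq_bigr do rewrite big_distrr /=.
rewrite [RHS]pair_bigA /=; apply: eq_bigr => -[D D'] _ /=.
have -> : f (mix S D D') = f D.
  by apply: fS => e eS; rewrite in_mix eS.
have -> : g (mix S D D') = g D'.
  by apply: gS => e; rewrite inE => /negbTE eS; rewrite in_mix eS.
have -> : Dnp_mass p (mix S D D') * (f D * g D') * Dnp_mass p (mix S D' D) =
  Dnp_mass p (mix S D D') * Dnp_mass p (mix S D' D) * (f D * g D') by ring.
have -> : Dnp_mass p (mix S D D') * Dnp_mass p (mix S D' D) = Dnp_mass p D * Dnp_mass p D'.
  rewrite /Dnp_mass -!big_split /=; apply: eq_bigr => e _; rewrite !in_mix.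
  by case: (e \in S); rewrite // mulrC.
by ring.
Qed.

Lemma expR_le_quadratic (x : R) : x <= 1 / 2 -> expR x <= 1 + x + 2 * x ^+ 2.
Proof.
move=> x_le; have x1 : 0 < 1 - x by lra.
have : expR x <= (1 - x)^-1.
  rewrite -[x in expR x]opprK expRN lef_pV2 ?posrE ?expR_gt0 //.
  exact: expR_ge1Dx.
move=> /le_trans; apply; rewrite -[(1 - x)^-1]mul1r ler_pdivrMr //.
have -> : (1 + x + 2 * x ^+ 2) * (1 - x) = 1 + x ^+ 2 * (1 - 2 * x) by ring.
by rewrite lerDl mulr_ge0 ?sqr_ge0 //; lra.
Qed.

Lemma mean_expR_linear (a : I * I -> R) (c : R) :
  mean (fun D => expR (\sum_(e | e.1 != e.2) a e * ((e \in edges D)%:R - c))) =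
  \prod_(e : I * I | e.1 != e.2) (p * expR (a e * (1 - c)) + (1 - p) * expR (- (a e * c))).
Proof.
transitivity (mean (fun D => \prod_(e | e.1 != e.2) expR (a e * ((e \in edges D)%:R - c)))).
  by apply: eq_bigr => D _; rewrite expR_sum.
rewrite (mean_prod (fun e (t : bool) => expR (a e * (t%:R - c)))).
by apply: eq_bigr => e _ /=; rewrite sub0r mulrN.
Qed.

(** Exponential Markov inequality: for |y| at most 1/2, a centred arc indicator times y has
    exponential moment at most exp (2 y ^ 2 p (1 - p)). The factor p (1 - p) is kept because p and 1
    - p may both become small. *)
Lemma chernoff A (a : I * I -> R) (l V x : R) :
    0 <= l <= 1 / 2 -> (forall e, `|a e| <= 1) ->
    \sum_(e | e.1 != e.2) a e ^+ 2 * (p * (1 - p)) <= V ->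
    (forall D, A D -> x <= \sum_(e | e.1 != e.2) a e * ((e \in edges D)%:R - p)) ->
  prob A <= expR (2 * l ^+ 2 * V - l * x).
Proof.
move=> /andP[l0 l1] a1 aV Ax.
pose f D := expR (\sum_(e | e.1 != e.2) (l * a e) * ((e \in edges D)%:R - p)).
have := @markov A f (expR (l * x)) (expR_gt0 _) (fun D => expR_ge0 _).
have Af D : A D -> expR (l * x) <= f D.
  move=> AD; rewrite ler_expR.
  under eq_bigr do rewrite -mulrA.
  by rewrite -big_distrr /= ler_wpM2l // Ax.
move=> /(_ Af) /le_trans; apply; rewrite ler_pdivrMr ?expR_gt0 // -expRD subrK.
rewrite mean_expR_linear.
apply: le_trans (_ : \prod_(e : I * I | e.1 != e.2) expR (2 * l ^+ 2 * (a e ^+ 2 * (p * (1 - p)))) <= _).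
  apply: ler_prod => e _; have /andP[p0 p1] := p01.
  have la : `|l * a e| <= 1 / 2.
    rewrite normrM (ger0_norm l0); apply: le_trans (_ : l * 1 <= _); last by rewrite mulr1.
    exact: ler_wpM2l.
  have {la} /andP[la1 la2] : - (1 / 2) <= l * a e <= 1 / 2 by rewrite -ler_norml.
  set y := l * a e in la1 la2 *.
  apply/andP; split.
    by rewrite addr_ge0 // mulr_ge0 ?expR_ge0 ?subr_ge0.
  have e1 : expR (y * (1 - p)) <= 1 + y * (1 - p) + 2 * (y * (1 - p)) ^+ 2.
    by apply: expR_le_quadratic; nra.
  have e2 : expR (- (y * p)) <= 1 + - (y * p) + 2 * (- (y * p)) ^+ 2.
    by apply: expR_le_quadratic; nra.
  apply: le_trans (expR_ge1Dx _).
  have -> : 1 + 2 * l ^+ 2 * (a e ^+ 2 * (p * (1 - p))) =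
     p * (1 + y * (1 - p) + 2 * (y * (1 - p)) ^+ 2) +
     (1 - p) * (1 + - (y * p) + 2 * (- (y * p)) ^+ 2) by rewrite /y; ring.
  by apply: lerD; apply: ler_wpM2l; rewrite ?subr_ge0.
rewrite -expR_sum ler_expR -big_distrr /= ler_wpM2l // mulr_ge0 // sqr_ge0 //.
Qed.
End Probability.

(** * Anticoncentration, and events on disjoint sets of arcs *)

Section Concentration.
Context (R : realType) (n : nat) (p : R).
Hypothesis p01 : 0 <= p <= 1.
Notation I := 'I_n.
Implicit Types (D : digraph 'I_n) (S : {set I * I}) (f g : digraph 'I_n -> R) (A B : pred (digraph 'I_n)).
Notation mean := (@mean R n p).
Notation prob := (@prob R n p).

Lemma paley_zygmund f m2 : (forall D, 0 <= f D) -> 0 < mean f ->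
  mean (fun D => f D ^+ 2) <= m2 ->
  mean f ^+ 2 / (4 * m2) <= prob (fun D => mean f / 2 <= f D).
Proof.
move=> f0 m_gt0 fm2; set m := mean f in m_gt0 *; set P := prob _.
have m2_ge0 : 0 <= m2.
  by apply: le_trans fm2; apply: sumr_ge0 => D _; rewrite mulr_ge0 ?mass_ge0 ?sqr_ge0.
(* On the event, f is at most t f ^ 2 / 2 + 1 / (2 t) by the inequality of means; elsewhere it is at
   most m / 2. The later choice t = m / (2 m2) makes t m2 half of m. *)
have key t : 0 < t -> m <= t * m2 + P / t.
  move=> t0; have le : m <= m / 2 + (t / 2 * m2 + (2 * t)^-1 * P).
    have : m <= mean (fun D => m / 2 * 1 + (t / 2 * f D ^+ 2 +
      (2 * t)^-1 * (m / 2 <= f D)%R%:R)).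
      apply: mean_le => // D; case: (boolP (m / 2 <= f D)) => mf /=; last first.
        rewrite -ltNge in mf.
        by rewrite mulr0 addr0 mulr1 (le_trans (ltW mf)) // lerDl mulr_ge0 ?sqr_ge0 ?divr_ge0 // ltW.
      have -> : (2 * t)^-1 = (2 : R)^-1 / t by rewrite invfM.
      have -> : m / 2 * 1 + (t / 2 * f D ^+ 2 + 2^-1 / t * 1) =
         f D + m / 2 + (t * f D - 1) ^+ 2 / (2 * t) by field; rewrite gt_eqF.
      rewrite -addrA lerDl addr_ge0 ?divr_ge0 ?sqr_ge0 // ?mulr_ge0 // ltW //.
    move/le_trans; apply; rewrite meanD !meanZ mean1 // meanD !meanZ mulr1 lerD2l lerD //.
    by rewrite ler_wpM2l // divr_ge0 // ltW.
  have -> : t * m2 + P / t = 2 * (t / 2 * m2 + (2 * t)^-1 * P).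
    by field; rewrite gt_eqF.
  lra.
(* For m2 = 0 the left side is 0, as division by 0 gives 0. *)
have [m20|m20] := leP m2 0.
  have -> : m2 = 0 by apply/le_anti; rewrite m20.
  by rewrite mulr0 invr0 mulr0 prob_ge0.
have t0 : 0 < m / (2 * m2) by rewrite divr_gt0 // mulr_gt0.
have := key _ t0; rewrite -subr_ge0 => k0.
rewrite -subr_ge0; have -> : P - m ^+ 2 / (4 * m2) =
   (m / (2 * m2)) * (m / (2 * m2) * m2 + P / (m / (2 * m2)) - m).
  by field; rewrite !gt_eqF.
by rewrite mulr_ge0 // ltW.
Qed.

Lemma prod_star (x : I) (W : {set I}) (a : R) (b : bool) : x \notin W ->
  \prod_(e : I * I | e.1 != e.2)
    (if if b then (e.1 == x) && (e.2 \in W) else (e.2 == x) && (e.1 \in W) then a else 1) =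
  a ^+ #|W|.
Proof.
move=> xW; rewrite -prodr_const big_mkcond; case: b => /=.
  rewrite -(pair_bigA _ (fun u w => if u != w then if (u == x) && (w \in W) then a else 1 else 1)).
  rewrite /= (bigD1 x) //= [X in _ * X]big1 ?mulr1 => [|u /negbTE->]; last first.
    by rewrite big1 // => w _; case: ifP.
  rewrite [RHS]big_mkcond; apply: eq_bigr => w _; rewrite eqxx /=.
  by case: eqP => // <-; rewrite (negbTE xW).
rewrite -(pair_bigA _ (fun u w => if u != w then if (w == x) && (u \in W) then a else 1 else 1)).
rewrite exchange_big /= (bigD1 x) //= [X in _ * X]big1 ?mulr1 => [|u /negbTE->]; last first.
  by rewrite big1 // => w _; case: ifP.
rewrite [RHS]big_mkcond; apply: eq_bigr => w _; rewrite eqxx /=.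
by case: eqP => // ->; rewrite (negbTE xW).
Qed.

Definition imbalance (W : {set I}) (x : I) D : R :=
  \sum_(w in W) (((x, w) \in edges D)%:R - ((w, x) \in edges D)%:R).

Lemma imbalanceE (W : {set I}) (x : I) D (l : R) : x \notin W ->
  l * imbalance W x D = \sum_(e | e.1 != e.2)
    (l * (((e.1 == x) && (e.2 \in W))%:R - ((e.2 == x) && (e.1 \in W))%:R)) *
       ((e \in edges D)%:R - 0).
Proof.
move=> xW; rewrite /imbalance big_distrr /=.
pose F (u w : I) : R := if u != w then
  (l * (((u == x) && (w \in W))%:R - ((w == x) && (u \in W))%:R)) * ((u, w) \in edges D)%:R else 0.
have -> : \sum_(e | e.1 != e.2) (l * (((e.1 == x) && (e.2 \in W))%:R - ((e.2 == x) && (e.1 \in W))%:R)) *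
       ((e \in edges D)%:R - 0) = \sum_u \sum_w F u w.
  rewrite big_mkcond pair_bigA; apply: eq_bigr => -[u w] _ /=.
  by rewrite /F subr0.
rewrite [RHS](eq_bigr (fun u => (u == x)%:R * \sum_(w in W) l * ((x, w) \in edges D)%:R
   - (u \in W)%:R * (l * ((u, x) \in edges D)%:R))); last first.
  move=> u _; rewrite /F; case: (altP (u =P x)) => [->|ux].
    rewrite (negbTE xW) mul0r subr0 mul1r [RHS]big_mkcond; apply: eq_bigr => w _.
    case: (altP (x =P w)) => [<-|xw]; first by rewrite (negbTE xW).
    by rewrite andbF subr0; case: (w \in W); rewrite ?mulr1 // mulr0 mul0r.
  rewrite mul0r sub0r (bigD1 x) //= ux eqxx /= big1 ?addr0 => [|w /negbTE wx]; last first.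
    by rewrite wx /= subr0 mulr0 mul0r if_same.
  by rewrite sub0r; ring.
rewrite big_split /= [in RHS](bigD1 x) //= eqxx mul1r [X in _ + X + _]big1 ?addr0; last first.
  by move=> u /negbTE->; rewrite mul0r.
under eq_bigr do rewrite mulrBr; rewrite big_split /= !sumrN; congr (_ - _).
rewrite big_mkcond; apply: eq_bigr => u _.
by case: (u \in W); rewrite ?mul1r ?mul0r.
Qed.

Lemma mean_expR_imbalance (W : {set I}) x (l : R) : x \notin W ->
  mean (fun D => expR (l * imbalance W x D)) =
  (1 + p * (1 - p) * (expR l + expR (- l) - 2)) ^+ #|W|.
Proof.
move=> xW; transitivity (mean (fun D => expR (\sum_(e | e.1 != e.2)
    (l * (((e.1 == x) && (e.2 \in W))%:R - ((e.2 == x) && (e.1 \in W))%:R)) *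
       ((e \in edges D)%:R - 0)))).
  by apply: eq_bigr => D _; rewrite imbalanceE.
rewrite mean_expR_linear.
have -> : 1 + p * (1 - p) * (expR l + expR (- l) - 2) =
  (p * expR l + (1 - p)) * (p * expR (- l) + (1 - p)).
  have := expRxMexpNx_1 l; move: (expR l) (expR (- l)) => a b ab.
  have -> : (p * a + (1 - p)) * (p * b + (1 - p)) =
    p ^+ 2 * (a * b) + p * (1 - p) * (a + b) + (1 - p) ^+ 2 by ring.
  by rewrite ab; ring.
rewrite exprMn -(@prod_star x W _ true) // -(@prod_star x W _ false) // -big_split /=.
apply: eq_bigr => e _; rewrite subr0 mulr0 oppr0 expR0 mulr1.
case: (altP (e.1 =P x)) => [e1|ne1] /=.
  rewrite e1 (negbTE xW) andbF mulr1; case: (e.2 \in W); rewrite ?subr0 ?mulr1 //.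
  by rewrite mulr0 expR0; ring.
case: (altP (e.2 =P x)) => [e2|ne2] /=; last by rewrite subr0 mulr0 mulr1 expR0 mul1r; ring.
rewrite mul1r; case: (e.1 \in W); rewrite ?sub0r ?mulrN1 ?mulr1 //.
by rewrite oppr0 mulr0 expR0; ring.
Qed.

(** Paley-Zygmund is applied to an exponential of the signed imbalance, since the moments of its
    square would control only the absolute value. *)
Lemma imbalance_tail (W : {set I}) x (s : bool) : x \notin W ->
    256 <= #|W|%:R * (p * (1 - p)) ->
  expR (- 256) <= prob (fun D => Num.sqrt (#|W|%:R * (p * (1 - p))) / 8 <=
    (-1) ^+ s * imbalance W x D).
Proof.
move=> xW; set v := #|W|%:R * _ => v256.
have v_gt0 : 0 < v by lra.
set r := Num.sqrt v; have r2 : r ^+ 2 = v by rewrite sqr_sqrtr // ltW.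
have r16 : 16 <= r.
  by rewrite -(@ler_pXn2r _ 2) ?nnegrE ?sqrtr_ge0 ?r2 //; lra.
have r_gt0 : 0 < r by lra.
(* Then l ^ 2 v = 16, so the mean of [f] is at least 1 + 16 / 2 = 9 and its second moment at most
   exp (16 * 16), and 81 / 4 exceeds 1. Half the mean exceeds exp (1 / 2), and (1 / 2) / l = r /
   8. *)
pose l := 4 / r; have l_gt0 : 0 < l by rewrite divr_gt0.
have l_le : l <= 1 / 4 by rewrite /l ler_pdivrMr //; lra.
have lr : l * r = 4 by rewrite /l mulfVK // gt_eqF.
have lv : l ^+ 2 * v = 16 by rewrite -r2 -exprMn lr; ring.
pose f D := expR (l * ((-1) ^+ s * imbalance W x D)).
have mf (m : R) : mean (fun D => expR (m * ((-1) ^+ s * imbalance W x D))) =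
    (1 + p * (1 - p) * (expR m + expR (- m) - 2)) ^+ #|W|.
  case: s {f}; last first.
    rewrite -(mean_expR_imbalance m xW).
    by apply: eq_bigr => D _; rewrite expr0 mul1r.
  have := mean_expR_imbalance (- m) xW; rewrite opprK [expR (- m) + _]addrC => <-.
  by apply: eq_bigr => D _; rewrite expr1 mulN1r mulrN mulNr.
have pq0 : 0 <= p * (1 - p) by rewrite mulr_ge0 ?subr_ge0 //; case/andP: p01.
have f_ge : 9 <= mean f.
  rewrite mf; have e1 : l ^+ 2 / 2 <= expR l + expR (- l) - 2.
    have := expR_ge1Dx l; have := expR_ge1Dx (- l); have := expRxMexpNx_1 l.
    move: (expR l) (expR (- l)) => a b ab hb ha.
    have -> : a + b - 2 = (a - 1) ^+ 2 * b.
      have -> : (a - 1) ^+ 2 * b = a * (a * b) - 2 * (a * b) + b by ring.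
      by rewrite ab; ring.
    apply: le_trans (_ : l ^+ 2 * b <= _).
      by rewrite ler_wpM2l ?sqr_ge0 //; lra.
    by rewrite ler_wpM2r //; [lra | rewrite -subr_ge0; nra].
  have bern (y : R) k : 0 <= y -> 1 + k%:R * y <= (1 + y) ^+ k.
    move=> y0; elim: k => [|k IH]; first by rewrite mul0r addr0 expr0.
    rewrite exprS; apply: le_trans (_ : (1 + y) * (1 + k%:R * y) <= _).
      rewrite -subr_ge0 -natr1; have -> : (1 + y) * (1 + k%:R * y) - (1 + (k%:R + 1) * y) = k%:R * y ^+ 2.
        by ring.
      by rewrite mulr_ge0 ?sqr_ge0.
    by rewrite ler_wpM2l //; lra.
  have y0 : 0 <= p * (1 - p) * (expR l + expR (- l) - 2).
    by rewrite mulr_ge0 // (le_trans _ e1) // divr_ge0 ?sqr_ge0.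
  apply: le_trans (bern _ _ y0); rewrite mulrA -/v.
  have : v * (l ^+ 2 / 2) <= v * (expR l + expR (- l) - 2) by rewrite ler_wpM2l // ltW.
  lra.
have f2_le : mean (fun D => f D ^+ 2) <= expR 256.
  have -> : mean (fun D => f D ^+ 2) = mean (fun D => expR (2 * l * ((-1) ^+ s * imbalance W x D))).
    by apply: eq_bigr => D _; rewrite /f -expRM_natl mulrA.
  rewrite mf; have e2 : expR (2 * l) + expR (- (2 * l)) - 2 <= 16 * l ^+ 2.
    have h1 : expR (2 * l) <= 1 + 2 * l + 2 * (2 * l) ^+ 2.
      by apply: expR_le_quadratic; lra.
    have h2 : expR (- (2 * l)) <= 1 + - (2 * l) + 2 * (- (2 * l)) ^+ 2.
      by apply: expR_le_quadratic; lra.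
    apply: le_trans (lerB (lerD h1 h2) (lexx 2)) _.
    by rewrite le_eqVlt; apply/orP; left; apply/eqP; ring.
  apply: le_trans (_ : expR (p * (1 - p) * (16 * l ^+ 2)) ^+ #|W| <= _).
    apply: lerXn2r; rewrite ?nnegrE ?expR_ge0 //.
      have := expR_ge1Dx (2 * l); have := expR_ge1Dx (- (2 * l)) => h1 h2.
      by rewrite addr_ge0 // mulr_ge0 //; lra.
    apply: le_trans (expR_ge1Dx _); rewrite lerD2l ler_wpM2l //.
  rewrite -expRM_natl ler_expR mulrA -/v.
  by have -> : v * (16 * l ^+ 2) = 256 by rewrite mulrCA [v * _]mulrC lv; ring.
have f_ge0 D : 0 <= f D by apply: expR_ge0.
have mf_gt0 : 0 < mean f by lra.
apply: le_trans (_ : prob (fun D => mean f / 2 <= f D) <= _); last first.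
  apply: prob_mono => // D fD.
  have le2 : expR (1 / 2) <= f D.
    apply: le_trans fD; apply: le_trans (_ : 2 <= _); last lra.
    have e0 := @expR_ge1Dx R (- (1 / 2)); have ee := @expRxMexpNx_1 R (1 / 2).
    have eg := @expR_gt0 R (1 / 2).
    by move: e0 ee eg; move: (expR _) (expR _) => a b; nra.
  rewrite ler_expR in le2; rewrite ler_pdivrMr //.
  have : (1 / 2) * r <= l * ((-1) ^+ s * imbalance W x D) * r by rewrite ler_wpM2r // ltW.
  by rewrite [l * _ * r]mulrAC lr; lra.
apply: le_trans (paley_zygmund f_ge0 mf_gt0 f2_le).
rewrite expRN ler_pdivlMr ?mulr_gt0 ?expR_gt0 // mulrCA mulVf ?expR_eq0 // mulr1.
by move: (mean f) f_ge => z z9; nra.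
Qed.

Lemma mean_prod_indep (J : eqType) (s : seq J) (S : J -> {set I * I}) (F : J -> digraph I -> R) :
    uniq s -> (forall j, depends_on (S j) (F j)) ->
    (forall i j, i \in s -> j \in s -> i != j -> [disjoint S i & S j]) ->
  mean (fun D => \prod_(j <- s) F j D) = \prod_(j <- s) mean (F j).
Proof.
elim: s => [_ _ _|j s IH /= /andP[js us] dep dis].
  by rewrite big_nil -[RHS](mean1 n p); apply: eq_bigr => D _; rewrite big_nil.
rewrite big_cons -IH //; last by move=> i i' si si'; apply: dis; rewrite inE ?si ?si' orbT.
rewrite -(@mean_indep _ _ _ (S j)) //; first by apply: eq_bigr => D _; rewrite big_cons.
move=> D D' e; rewrite big_seq [RHS]big_seq; apply: eq_bigr => i si; apply: (dep i) => u uS.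
apply: e; rewrite inE; apply: contraL uS => uj.
have ij : j != i by apply: contraNneq js => ->.
have /disjoint_setI0/setP/(_ u) := dis j i (mem_head _ _) (mem_behead (s := j :: s) si) ij.
by rewrite !inE uj /= => ->.
Qed.

(** Exponential Markov inequality for exp of minus the count: by independence its mean is at most
    exp (- c #|J| / 2), and half of this exponent is spent on the threshold. *)
Lemma count_lower_tail (J : {set I}) (S : I -> {set I * I}) (A : I -> pred (digraph I)) (c : R) :
    0 <= c ->
    (forall x, depends_on (S x) (fun D => (A x D)%:R : R)) ->
    {in J &, forall x y, x != y -> [disjoint S x & S y]} ->
    {in J, forall x, c <= prob (A x)} ->
  prob (fun D => #|[set x in J | A x D]|%:R <= c * #|J|%:R / 4) <= expR (- (c * #|J|%:R / 4)).
Proof.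
move=> c0 dep dis cA; pose F x D : R := expR (- (A x D)%:R).
have Fdep x : depends_on (S x) (F x) by move=> D D' e; rewrite /F (dep x _ _ e).
have prodF D : \prod_(x <- enum J) F x D = expR (- #|[set x in J | A x D]|%:R).
  rewrite big_enum /= -expR_sum; congr expR; rewrite sumrN; congr (- _).
  rewrite -sum1_card natr_sum big_mkcond [RHS]big_mkcond; apply: eq_bigr => x _.
  by rewrite inE; case: (x \in J) => //; case: (A x D).
have meanF x : x \in J -> mean (F x) <= expR (- (c / 2)).
  move=> xJ; have FE D : F x D = 1 + (expR (- 1) - 1) * (A x D)%:R.
    by rewrite /F; case: (A x D); rewrite ?mulr1 ?mulr0 ?oppr0 ?expR0 ?addr0 //; ring.
  have -> : mean (F x) = 1 + (expR (- 1) - 1) * prob (A x).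
    transitivity (mean (fun D => 1 + (expR (- 1) - 1) * (A x D)%:R)).
      by apply: eq_bigr => D _; rewrite FE.
    by rewrite meanD meanZ mean1.
  apply: le_trans (expR_ge1Dx _); rewrite lerD2l.
  have : expR (- 1) <= 1 / 2 :> R.
    rewrite expRN mul1r lef_pV2 ?posrE ?expR_gt0 //.
    by have := @expR_ge1Dx R 1; lra.
  by have := cA x xJ; move: (prob (A x)) (expR (- 1)) => a b h1 h2; nra.
have F_ge0 D : 0 <= \prod_(x <- enum J) F x D by rewrite prodF expR_ge0.
have F_ge D : #|[set x in J | A x D]|%:R <= c * #|J|%:R / 4 ->
    expR (- (c * #|J|%:R / 4)) <= \prod_(x <- enum J) F x D.
  by move=> le; rewrite prodF ler_expR lerN2.
apply: le_trans (markov p01 (expR_gt0 _) F_ge0 F_ge) _.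
rewrite (@mean_prod_indep _ _ S) ?enum_uniq //; last first.
  by move=> x y; rewrite !mem_enum; apply: dis.
rewrite ler_pdivrMr ?expR_gt0 // -expRD.
apply: le_trans (_ : expR (- (c / 2)) ^+ #|J| <= _).
  rewrite -prodr_const big_enum /=; apply: ler_prod => x xJ; rewrite meanF // andbT.
  by apply: sumr_ge0 => D _; rewrite mulr_ge0 ?mass_ge0 ?expR_ge0.
by rewrite -expRM_natl ler_expR; lra.
Qed.

(** Conditioning on [X D], which depends on the arcs in [S] only, leaves the law of the other arcs
    unchanged, so no union bound over the values of [X] is paid. This permits reserving arcs towards
    the random set of extreme vertices. *)
Lemma prob_conditional (K : finType) (X : digraph I -> K) (B : K -> pred (digraph I)) S (d : R) :
    0 <= d ->
    (forall D D', (forall e, e \in S -> (e \in edges D) = (e \in edges D')) -> X D = X D') ->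
    (forall k, depends_on (~: S) (fun D => (B k D)%:R : R)) ->
    (forall k, prob (B k) <= d) ->
  prob (fun D => B (X D) D) <= d.
Proof.
move=> d0 XS BS Bd.
have -> : prob (fun D => B (X D) D) = \sum_k mean (fun D => (X D == k)%:R * (B k D)%:R).
  rewrite -mean_sum; apply: eq_bigr => D _; congr (_ * _).
  rewrite (bigD1 (X D)) //= eqxx mul1r big1 ?addr0 // => k.
  by rewrite eq_sym => /negbTE->; rewrite mul0r.
apply: le_trans (_ : \sum_k mean (fun D => (X D == k)%:R) * d <= _).
  apply: ler_sum => k _; rewrite (@mean_indep _ _ _ S) //.
    by apply: ler_wpM2l; [exact: (prob_ge0 p01 (fun D => X D == k)) | exact: Bd].
  by move=> D D' e; rewrite (XS _ _ e).
rewrite -big_distrl /= -mean_sum.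
have -> : mean (fun D => \sum_k (X D == k)%:R) = 1.
  rewrite -[RHS](mean1 n p); apply: eq_bigr => D _; congr (_ * _).
  rewrite (bigD1 (X D)) //= eqxx big1 ?addr0 // => k.
  by rewrite eq_sym => /negbTE->.
by rewrite mul1r.
Qed.
End Concentration.

(** * Degrees and cuts in the random digraph *)

Section Counts.
Context (R : realType) (n : nat) (p : R).
Hypothesis p01 : 0 <= p <= 1.
Notation I := 'I_n.
Implicit Types (D : digraph 'I_n) (Q : {set I * I}).
Notation prob := (@prob R n p).

Lemma sum_count Q (c : R) D : (forall e, e \in Q -> e.1 != e.2) ->
  \sum_(e | e.1 != e.2) (c * (e \in Q)%:R) * ((e \in edges D)%:R - p) =
  c * (#|edges D :&: Q|%:R - #|Q|%:R * p).
Proof.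
move=> Qne; transitivity (\sum_(e in Q) c * ((e \in edges D)%:R - p)).
  rewrite big_mkcond [RHS]big_mkcond; apply: eq_bigr => e _ /=.
  case: (boolP (e \in Q)) => [/Qne->|]; rewrite ?mulr1 //.
  by rewrite mulr0 mul0r if_same.
rewrite -big_distrr /= big_split /= sumrN sumr_const; congr (_ * (_ - _)).
  rewrite -natr_sum -sum1_card big_mkcond [in RHS]big_mkcond; congr (_%:R).
  by apply: eq_bigr => e _; rewrite inE; case: (e \in Q); case: (e \in edges D).
by rewrite mulr_natl.
Qed.

Lemma count_var Q (c : R) : c ^+ 2 = 1 -> (forall e, e \in Q -> e.1 != e.2) ->
  \sum_(e | e.1 != e.2) (c * (e \in Q)%:R) ^+ 2 * (p * (1 - p)) = #|Q|%:R * (p * (1 - p)).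
Proof.
move=> c2 Qne; rewrite -big_distrl /=; congr (_ * _); rewrite -sum1_card natr_sum big_mkcond.
rewrite [RHS]big_mkcond; apply: eq_bigr => e _ /=; rewrite exprMn c2 mul1r.
by case: (boolP (e \in Q)) => [/Qne->|_]; rewrite ?expr1n // expr0n if_same.
Qed.

Lemma edge_count_upper_tail Q (l V x : R) : (forall e, e \in Q -> e.1 != e.2) ->
    0 <= l <= 1 / 2 -> #|Q|%:R * (p * (1 - p)) <= V ->
  prob (fun D => #|Q|%:R * p + x <= #|edges D :&: Q|%:R) <= expR (2 * l ^+ 2 * V - l * x).
Proof.
move=> Qne l01 QV; apply: (@chernoff _ _ _ p01 _ (fun e => 1 * (e \in Q)%:R)) => //.
- by move=> e; rewrite mul1r; case: (e \in Q); rewrite ?normr1 ?normr0.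
- by rewrite count_var // expr1n.
- by move=> D le; rewrite sum_count // mul1r lerBrDl.
Qed.

Lemma edge_count_lower_tail Q (l V x : R) : (forall e, e \in Q -> e.1 != e.2) ->
    0 <= l <= 1 / 2 -> #|Q|%:R * (p * (1 - p)) <= V ->
  prob (fun D => #|edges D :&: Q|%:R <= #|Q|%:R * p - x) <= expR (2 * l ^+ 2 * V - l * x).
Proof.
move=> Qne l01 QV; apply: (@chernoff _ _ _ p01 _ (fun e => -1 * (e \in Q)%:R)) => //.
- by move=> e; case: (e \in Q); rewrite ?mulr1 ?mulr0 ?normrN ?normr1 ?normr0.
- by rewrite count_var // sqrrN expr1n.
- by move=> D le; rewrite sum_count // mulN1r opprB; lra.
Qed.

Definition arc_at (o : bool) (v w : I) : I * I := if o then (v, w) else (w, v).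

Definition deg_in (o : bool) (W : {set I}) (v : I) D := #|[set w in W | arc_at o v w \in edges D]|.

Lemma arc_at_inj o v : injective (arc_at o v).
Proof. by case: o => w w' []. Qed.

Lemma deg_inE o (W : {set I}) v D : deg_in o W v D = #|edges D :&: [set arc_at o v w | w in W]|.
Proof.
rewrite /deg_in -(card_imset _ (@arc_at_inj o v)); apply: eq_card => e.
rewrite inE andbC; apply/imsetP/andP => [[w]|[/imsetP[w wW ->] eD]].
  by rewrite inE => /andP[wW wD] ->; rewrite imset_f.
by exists w; rewrite ?inE ?wW.
Qed.

Section Star.
Variables (o : bool) (W : {set I}) (v : I).
Hypothesis vW : v \notin W.
Let Q := [set arc_at o v w | w in W].

Let Qne e : e \in Q -> e.1 != e.2.
Proof.
move=> /imsetP[w wW ->]; rewrite /arc_at; case: o => /=; last rewrite eq_sym.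
  by apply: contraNneq vW => ->.
by apply: contraNneq vW => ->.
Qed.

Let cardQ : #|Q| = #|W|.
Proof. by rewrite card_imset //; apply: arc_at_inj. Qed.

Lemma deg_upper_tail (l V x : R) : 0 <= l <= 1 / 2 -> #|W|%:R * (p * (1 - p)) <= V ->
  prob (fun D => #|W|%:R * p + x <= (deg_in o W v D)%:R) <= expR (2 * l ^+ 2 * V - l * x).
Proof.
move=> l01 WV; rewrite -cardQ in WV *.
apply: le_trans (edge_count_upper_tail x Qne l01 WV).
by apply: prob_mono => // D; rewrite deg_inE.
Qed.

Lemma deg_lower_tail (l V x : R) : 0 <= l <= 1 / 2 -> #|W|%:R * (p * (1 - p)) <= V ->
  prob (fun D => (deg_in o W v D)%:R <= #|W|%:R * p - x) <= expR (2 * l ^+ 2 * V - l * x).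
Proof.
move=> l01 WV; rewrite -cardQ in WV *.
apply: le_trans (edge_count_lower_tail x Qne l01 WV).
by apply: prob_mono => // D; rewrite deg_inE.
Qed.
End Star.

Lemma outn_deg D v : outn (edges D) v = deg_in true [set~ v] v D.
Proof.
apply: eq_card => w; rewrite !inE; case: eqP => // ->.
by have /forallP/(_ v)/negbTE-> := edges_loopless D.
Qed.

Lemma inn_deg D v : inn (edges D) v = deg_in false [set~ v] v D.
Proof.
apply: eq_card => w; rewrite !inE; case: eqP => // ->.
by have /forallP/(_ v)/negbTE-> := edges_loopless D.
Qed.

Lemma pq_ge0 : 0 <= p * (1 - p).
Proof. by case/andP: p01 => p0 p1; rewrite mulr_ge0 ?subr_ge0. Qed.

Lemma degree_tail o (v : I) (e : R) : 0 <= e <= 1 ->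
  prob (fun D => n%:R * p + e * (n%:R * p * (1 - p)) <= (deg_in o [set~ v] v D)%:R)
    <= expR (- (e ^+ 2 * (n%:R * p * (1 - p)) / 8)).
Proof.
move=> /andP[e0 e1]; have /andP[p0 p1] := p01.
have Wn : #|[set~ v]|%:R <= n%:R :> R by rewrite ler_nat -[X in (_ <= X)%N]card_ord max_card.
have vW : v \notin [set~ v] by rewrite !inE eqxx.
(* The value e / 4 minimises 2 l ^ 2 V - l e V over l. *)
have l01 : 0 <= e / 4 <= 1 / 2 by apply/andP; split; lra.
have WV : #|[set~ v]|%:R * (p * (1 - p)) <= n%:R * p * (1 - p).
  by rewrite -mulrA ler_wpM2r ?pq_ge0.
apply: le_trans (le_trans (deg_upper_tail o vW (e * (n%:R * p * (1 - p))) l01 WV) _).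
  by apply: prob_mono => // D; apply: le_trans; rewrite lerD2r ler_wpM2r.
by rewrite ler_expR le_eqVlt; apply/orP; left; apply/eqP; field.
Qed.

Lemma bipartite_tail b (phi psi : 'I_b -> I) (X Y : {set 'I_b}) (e : R) :
    injective phi -> injective psi -> (forall x y, phi x != psi y) -> 0 <= e <= 1 ->
  prob (fun D => #|[set f : 'I_b * 'I_b | (phi f.1, psi f.2) \in edges D] :&: finset.setX X Y|%:R
       <= #|X|%:R * #|Y|%:R * p * (1 - e * (1 - p)))
    <= expR (- (e ^+ 2 * (p * (1 - p)) / 8 * (#|X|%:R * #|Y|%:R))).
Proof.
move=> phi_inj psi_inj ne /andP[e0 e1].
pose m (f : 'I_b * 'I_b) := (phi f.1, psi f.2).
have m_inj : injective m by move=> [a c] [a' c'] [/phi_inj-> /psi_inj->].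
pose Q := m @: finset.setX X Y.
have cQ : #|Q|%:R = #|X|%:R * #|Y|%:R :> R by rewrite card_imset // cardsX natrM.
have Qne f : f \in Q -> f.1 != f.2 by move=> /imsetP[g _ ->]; apply: ne.
have l01 : 0 <= e / 4 <= 1 / 2 by apply/andP; split; lra.
apply: le_trans (le_trans (@edge_count_lower_tail Q (e / 4) _ (e * (#|Q|%:R * (p * (1 - p)))) Qne l01 (lexx _)) _).
  apply: prob_mono => // D; rewrite cQ.
  have -> : #|edges D :&: Q| = #|[set f | m f \in edges D] :&: finset.setX X Y|.
    rewrite -(card_imset (mem ([set f | m f \in edges D] :&: finset.setX X Y)) m_inj).
    apply: eq_card => f; rewrite in_setI; apply/andP/imsetP => [[fD /imsetP[g gQ fg]]|[g]].
      by exists g => //; rewrite in_setI gQ inE -fg fD.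
    by rewrite in_setI inE => /andP[gD gQ] ->; rewrite gD imset_f.
  by move/le_trans; apply; rewrite le_eqVlt; apply/orP; left; apply/eqP; ring.
by rewrite ler_expR cQ le_eqVlt; apply/orP; left; apply/eqP; field.
Qed.

Lemma sum_expn_card b (z : R) : \sum_(X : {set 'I_b}) z ^+ #|X| = (1 + z) ^+ b.
Proof.
rewrite -[b in RHS]card_ord -prodr_const.
have -> : \prod_(i in 'I_b) (1 + z) = \prod_(i : 'I_b) (z + 1) by apply: eq_bigr => i _; rewrite addrC.
rewrite bigA_distr; apply: eq_bigr => X _.
by rewrite -big_mkcond prodr_const.
Qed.

(* Encoding a pair (X, Y) with [b < #|X| + #|Y|] by the smaller set and the
   complement of the larger one, whose size is smaller still, keeps the union
   bound summable. *)
Lemma factor_condition_tail b (phi psi : 'I_b -> I) (e : R) :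
    injective phi -> injective psi -> (forall x y, phi x != psi y) -> 0 <= e <= 1 ->
    let z := expR (- (e ^+ 2 * (p * (1 - p)) * b%:R / 32)) in b%:R * z <= 1 / 2 ->
  prob (fun D => [exists X : {set 'I_b}, exists Y : {set 'I_b}, (b < #|X| + #|Y|)%N &&
     (#|[set f : 'I_b * 'I_b | (phi f.1, psi f.2) \in edges D] :&: finset.setX X Y|%:R
       <= #|X|%:R * #|Y|%:R * p * (1 - e * (1 - p)))]) <= 8 * (b%:R * z).
Proof.
move=> phi_inj psi_inj ne e01 z bz.
have z0 : 0 <= z by apply: expR_ge0.
pose A (X Y : {set 'I_b}) D := #|[set f : 'I_b * 'I_b | (phi f.1, psi f.2) \in edges D] :&: finset.setX X Y|%:R
       <= #|X|%:R * #|Y|%:R * p * (1 - e * (1 - p)) :> R.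
pose T (X Y : {set 'I_b}) : R := if X == set0 then 0 else z ^+ #|X| * z ^+ #|~: Y|.
have T0 X Y : 0 <= T X Y by rewrite /T; case: ifP => // _; rewrite mulr_ge0 ?exprn_ge0.
have half (X Y : {set 'I_b}) : (#|X| <= #|Y|)%N -> (b < #|X| + #|Y|)%N ->
    expR (- (e ^+ 2 * (p * (1 - p)) / 8 * (#|X|%:R * #|Y|%:R))) <= T X Y.
  move=> XY bXY; have cY := cardsC Y; rewrite card_ord in cY.
  have X0 : X != set0 by rewrite -cards_eq0; apply/eqP => X0; move: bXY XY; rewrite X0; lia.
  rewrite /T (negbTE X0) -exprD /z -expRM_natl ler_expR.
  set q := e ^+ 2 * (p * (1 - p)); have q0 : 0 <= q by rewrite mulr_ge0 ?sqr_ge0 ?pq_ge0.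
  (* Here #|~: Y| < #|X| and b < 2 #|Y|. This factor 4 and the 8 of [bipartite_tail] make up the 32
     in z. *)
  have key : b%:R * (#|X| + #|~: Y|)%:R <= 4 * (#|X|%:R * #|Y|%:R) :> R.
    by rewrite -!natrM ler_nat; move: cY XY bXY; move: #|X| #|Y| #|~: Y| => x y y' <-; nia.
  have := ler_wpM2l q0 key; lra.
have pT (X Y : {set 'I_b}) : prob (fun D => (b < #|X| + #|Y|)%N && A X Y D) <= T X Y + T Y X.
  case: (leqP #|X| #|Y|) => XY; case: (boolP (b < #|X| + #|Y|)%N) => bXY; first last.
  - by rewrite prob_eq0 ?addr_ge0.
  - apply: le_trans (_ : T Y X <= _); last by rewrite lerDr.
    apply: le_trans (half Y X (ltnW XY) _); last by rewrite addnC.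
    by rewrite [X in expR (- (_ * X))]mulrC; apply: bipartite_tail.
  - by rewrite prob_eq0 ?addr_ge0.
  - apply: le_trans (_ : T X Y <= _); last by rewrite lerDl.
    by apply: le_trans (half X Y XY bXY); apply: bipartite_tail.
have sumT : \sum_(X : {set 'I_b}) \sum_(Y : {set 'I_b}) T X Y = ((1 + z) ^+ b - 1) * (1 + z) ^+ b.
  have -> : (1 + z) ^+ b - 1 = \sum_(X : {set 'I_b} | X != set0) z ^+ #|X|.
    by rewrite -sum_expn_card (bigD1 set0) //= cards0 expr0 addrC addrK.
  rewrite big_distrl [RHS]big_mkcond; apply: eq_bigr => X _ /=; rewrite /T.
  case: (altP (X =P set0)) => _ /=; first by rewrite big1.
  rewrite -big_distrr -sum_expn_card; congr (_ * _).
  by rewrite [RHS](reindex_inj (@setC_inj _)).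
apply: le_trans (prob_exists p01 _) _.
apply: le_trans (_ : \sum_X \sum_Y (T X Y + T Y X) <= _).
  by apply: ler_sum => X _; apply: le_trans (prob_exists p01 _) _; apply: ler_sum => Y _; apply: pT.
under eq_bigr do rewrite big_split.
rewrite big_split /= [X in _ + X]exchange_big /= sumT.
have zb : (1 + z) ^+ b <= 1 + 2 * (b%:R * z).
  apply: le_trans (_ : expR z ^+ b <= _).
    by apply: lerXn2r; rewrite ?nnegrE ?expR_ge0 ?addr_ge0 ?expR_ge1Dx.
  rewrite -expRM_natl; apply: le_trans (expR_le_quadratic bz) _.
  have : 0 <= b%:R * z by rewrite mulr_ge0.
  by move: (b%:R * z) bz => y y1 y0; nra.
have zb1 : 1 <= (1 + z) ^+ b by apply: exprn_ege1; rewrite lerDl.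
have : 0 <= b%:R * z by rewrite mulr_ge0.
move: (b%:R * z) ((1 + z) ^+ b) bz zb zb1 => y u; nra.
Qed.
End Counts.

(** * Near and far vertices *)

Section BlockGeometry.
Context (n k b h : nat).
Hypothesis k_gt0 : (0 < k)%N.
Hypothesis bE : b = (n.+1 %/ k)%N.
Notation I := 'I_n.+1.
Notation blk := (@block n k).

(** Block differences up to 2h in either direction, hence those of all reserved arcs. The own block,
    j = 0, is included so that vertices of one block are not far from each other and their
    imbalances use disjoint sets of arcs. *)
Definition near (v w : I) : bool :=
  [exists j : 'I_h.*2.+1, (blk w == (blk v + j) %% k)%N || (blk v == (blk w + j) %% k)%N].

Definition far_from (v : I) : {set I} := [set w | ~~ near v w].

Lemma near_sym v w : near v w = near w v.
Proof. by apply: eq_existsb => j; rewrite orbC. Qed.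

Lemma near_same v w : blk v = blk w -> near v w.
Proof.
move=> e; apply/existsP; exists ord0; rewrite addn0 e /block modn_mod eqxx //.
Qed.

Lemma near_refl v : near v v. Proof. exact: near_same. Qed.

Definition block_set (j : nat) : {set I} := [set v : I | blk v == j].

Lemma card_block_set j : #|block_set j| = (\sum_(v < n.+1) (v %% k == j))%N.
Proof.
rewrite -sum1_card big_mkcond; apply: eq_bigr => v _; rewrite inE /block.
by case: eqP.
Qed.

Lemma block_set_le j : (#|block_set j| <= b.+1)%N.
Proof. by rewrite card_block_set bE; apply: count_residue. Qed.

Lemma block_set_ge j : (j < k)%N -> (b <= #|block_set j|)%N.
Proof.
move=> jk; pose f (x : 'I_b) : I := inord (j + x * k).
have fE (x : 'I_b) : f x = (j + x * k)%N :> nat.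
  rewrite /f inordK //; apply: leq_trans (_ : (x.+1 * k <= _)%N); last first.
    by apply: leq_trans (_ : b * k <= _)%N; rewrite ?leq_mul2r ?ltn_ord ?orbT // bE leq_divM.
  by rewrite mulSn ltn_add2r.
rewrite -[b in (b <= _)%N]card_ord -(@card_imset _ _ f); last first.
  move=> x y /(congr1 val) /=; rewrite !fE => /eqP; rewrite eqn_add2l eqn_pmul2r // => /eqP.
  exact: val_inj.
apply/subset_leq_card/subsetP => _ /imsetP[x _ ->]; rewrite inE /block fE.
by rewrite addnC modnMDl modn_small.
Qed.

Lemma near_set_le v : (#|[set w | near v w]| <= h.*2.+1 * (b.+1 + b.+1))%N.
Proof.
have sub : [set w | near v w] \subset \bigcup_(j < h.*2.+1)
    (block_set ((blk v + j) %% k) :|: [set w | blk v == (blk w + j) %% k]%N).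
  apply/subsetP => w; rewrite inE => /existsP[j h1]; apply/bigcupP; exists j => //.
  by rewrite !inE.
apply: leq_trans (subset_leq_card sub) _; rewrite -[h.*2.+1 in X in (_ <= X)%N]card_ord -sum_nat_const.
apply: leq_trans (_ : \sum_(j < h.*2.+1)
   #|block_set ((blk v + j) %% k) :|: [set w | blk v == (blk w + j) %% k]%N| <= _)%N.
  elim/big_ind2: _ => [|m X m' Y Xm Ym|//]; first by rewrite cards0.
  by rewrite (leq_trans (leq_card_setU X Y)) // leq_add.
apply: leq_sum => j _; rewrite (leq_trans (leq_card_setU _ _)) // leq_add ?block_set_le //.
have [i iE] : exists i, [set w : I | blk v == (blk w + j) %% k]%N \subset block_set i.
  exists ((blk v + (k - j %% k)) %% k)%N; apply/subsetP => w; rewrite !inE => /eqP->.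
  have jk : (j %% k <= k)%N by rewrite ltnW // ltn_pmod.
  rewrite modnDml -addnA.
  have -> : ((blk w + (j + (k - j %% k))) %% k = blk w %% k)%N.
    have z : ((j + (k - j %% k)) %% k = 0)%N by rewrite -modnDml subnKC // modnn.
    by rewrite -modnDmr z addn0.
  by rewrite modn_small // ltn_pmod.
by apply: leq_trans (subset_leq_card iE) (block_set_le _).
Qed.

(* The offsets are those for which, by [block_at_odd_gap] and
   [block_at_even_gap], the path systems use no arc from [zone false v] to v and
   no arc from v to [zone true v]. *)
Definition zone (o : bool) (v : I) : {set I} :=
  [set w | [exists i : 'I_h, blk w == (blk v + i.*2 + (if o then 2 else 1)) %% k]%N].

Lemma zone_near o v w : w \in zone o v -> near v w.
Proof.
rewrite inE => /existsP[i e].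
have lt : (i.*2 + (if o then 2 else 1) < h.*2.+1)%N by have := ltn_ord i; case: o {e}; clear; lia.
by apply/existsP; exists (Ordinal lt); rewrite /= addnA e.
Qed.

Lemma zone_irrefl o v : (h.*2 < k)%N -> v \notin zone o v.
Proof.
move=> hk; rewrite inE; apply/existsP => -[i /eqP]; rewrite -addnA.
rewrite -[in LHS](@modn_small (blk v) k) ?ltn_pmod // -[in LHS](addn0 (blk v)).
move/eqP; rewrite eqn_modDl mod0n modn_small; first by case: o; rewrite ?addn2 ?addn1.
by apply: leq_trans hk; have := ltn_ord i; case: o; clear; lia.
Qed.

Lemma zone_card o v (A : {set I}) (m : nat) : (h.*2 < k)%N ->
    (forall j, j < k -> m <= #|A :&: block_set j|)%N ->
  (h * m <= #|zone o v :&: A|)%N.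
Proof.
move=> hk Am; pose d := (if o then 2 else 1)%N.
pose bl (i : 'I_h) := ((blk v + i.*2 + d) %% k)%N.
have bl_inj : injective bl.
  have lt (i : 'I_h) : (i.*2 + d < k)%N.
    by have := ltn_ord i; move: hk; rewrite /d; clear; case: o; lia.
  move=> i j /eqP; rewrite /bl -!addnA eqn_modDl !modn_small ?lt //.
  by rewrite eqn_add2r => /eqP/double_inj; apply: val_inj.
apply: leq_trans (_ : \sum_(i < h) #|A :&: block_set (bl i)| <= _)%N.
  rewrite -[h in (h * _)%N]card_ord -sum_nat_const; apply: leq_sum => i _.
  by apply: Am; rewrite ltn_pmod.
under eq_bigr do rewrite -sum1_card big_mkcond.
rewrite exchange_big -sum1_card [X in (_ <= X)%N]big_mkcond; apply: leq_sum => w _ /=.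
have one : (\sum_(i < h) (blk w == bl i) <= 1)%N.
  by apply: sum_bool_le1 => i j /eqP-> /eqP/bl_inj.
case: (boolP (w \in zone o v :&: A)) => [_|nw].
  apply: leq_trans one; apply: leq_sum => i _; rewrite !inE.
  by case: (w \in A); case: (blk w == bl i).
rewrite big1 // => i _; rewrite !inE; case: (boolP (w \in A)) => //= wA.
case: (boolP (blk w == bl i)) => // e; move: nw; rewrite !inE wA andbT.
by move/existsP; case; exists i.
Qed.

End BlockGeometry.

(** * Exceptional events and the union bound *)

Section FiniteBound.
Context (R : realType) (n k b h L r d l w s m : nat) (p e theta delta : R).
Notation I := 'I_n.+1.
Notation N := (n.+1%:R : R).
Notation q := (1 - p).
Notation c1 := (expR (- 256) : R).
Notation prob := (@prob R n.+1 p).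
Let M := (h.*2.+1 * (b.+1 + b.+1))%N.
Let z := expR (- (e ^+ 2 * (p * q) * b%:R / 32)).
Hypothesis p01' : 0 < p < 1.
Hypothesis e01 : 0 <= e <= 1.
Hypotheses (k_even : ~~ odd k) (bE : b = (n.+1 %/ k)%N) (l_gt0 : (0 < l)%N).
Hypothesis LE : (L + h.*2 + 1 = k)%N.
Hypothesis bz : b%:R * z <= 1 / 2.
Hypothesis tail_degree : expR (- (e ^+ 2 * (N * p * q) / 8)) <= delta.
Hypothesis tail_factor : 8 * (b%:R * z) <= delta.
Hypothesis tail_count : expR (- (c1 * b%:R / 4)) <= delta.
Hypothesis tail_near : expR (- (3 / 32 * (M%:R * p))) <= delta.
Hypothesis tail_zone : expR (- ((h * m)%:R * p / 32)) <= delta.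
Hypothesis m_le : m%:R <= c1 * b%:R / 4.
Hypothesis M_le : (M.*2 <= n.+1)%N.
Hypothesis variance_ge : 256 <= N / 2 * (p * q).
Hypothesis theta_le : theta <= Num.sqrt (N / 2 * (p * q)) / 8.
Hypothesis theta_ge : 2 * (M%:R * p) <= theta.
Hypothesis s_le : s%:R <= (h * m)%:R * p / 2.
Hypothesis r_le : r%:R <= b%:R * p * (1 - e * q).
Hypothesis degree_le :
  N * p + e * (N * p * q) + (r * (k %/ b.+1).+1)%:R <= (r * L + d)%:R.
Hypothesis capacity : (2 * r + (d %/ l).+1 + w + maxn l.+1 h <= s)%N.
Hypothesis potential : (n.+1 * 'C(d + l, d) < 2 ^ w.+1)%N.

Let p01 : 0 <= p <= 1. Proof. by move: p01'; lra. Qed.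
Let k_gt0 : (0 < k)%N. Proof. by rewrite -LE addn1. Qed.
Let hk : (h.*2 < k)%N. Proof. by rewrite -LE; clear; lia. Qed.

Notation near := (@near n k h).
Notation far_from := (@far_from n k h).
Notation zone := (@zone n k h).

(** Only arcs to far vertices count, so the set is independent of the reserved arcs, which join near
    vertices. It collects large excess for [o = false] and large deficiency for [o = true]. *)
Definition extreme (o : bool) (D : digraph I) : {set I} :=
  [set x | theta <= (-1) ^+ o * imbalance R (far_from x) x D].

Definition bad_degree (D : digraph I) := [exists o : bool, exists v : I,
  N * p + e * (N * p * q) <= (deg_in o [set~ v] v D)%:R].

Definition bad_factor (D : digraph I) := [exists c : 'I_k, exists t : 'I_L,
  exists X : {set 'I_b}, exists Y : {set 'I_b}, (b < #|X| + #|Y|)%N &&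
     (#|[set f : 'I_b * 'I_b | (vertex_at n c t f.1, vertex_at n c t.+1 f.2) \in edges D]
         :&: finset.setX X Y|%:R <= #|X|%:R * #|Y|%:R * p * (1 - e * q))].

Definition bad_count (D : digraph I) := [exists o : bool, exists j : 'I_k,
  #|[set x in @block_set n k j | theta <= (-1) ^+ o * imbalance R (far_from x) x D]|%:R
    <= c1 * #|@block_set n k j|%:R / 4].

Definition bad_near (D : digraph I) := [exists o : bool, exists v : I,
  theta <= (deg_in o ([set w | near v w] :\ v) v D)%:R].

Definition rich (A : {set I}) := [forall j : 'I_k, (m <= #|A :&: @block_set n k j|)%N].

(** Richness is part of the event so that it stays improbable when the extreme set is frozen to an
    arbitrary [A]. *)
Definition bad_zone (D : digraph I) := [exists o : bool, exists v : I,
  rich (extreme o D) && (deg_in o (zone o v :&: extreme o D) v D < s)%N].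

Definition bad D := [|| bad_degree D, bad_factor D, bad_count D, bad_near D | bad_zone D].

Let far_irrefl x : x \notin far_from x.
Proof. by rewrite inE negbK near_refl. Qed.

Let far_card x : N / 2 <= #|far_from x|%:R.
Proof.
have := @near_set_le n k b h k_gt0 bE x; rewrite -/M => le.
have := cardsC [set w | near x w]; rewrite card_ord.
have -> : ~: [set w | near x w] = far_from x by apply/setP => v; rewrite !inE.
move=> c; have : (n.+1 <= #|far_from x| + #|far_from x|)%N.
  have half (x1 x2 y1 y2 : nat) : (x1 + x2 = y1 -> x1 <= y2 -> y2.*2 <= y1 -> y1 <= x2 + x2)%N.
    by clear; lia.
  exact: half c le M_le.
by rewrite -(@ler_nat R) natrD; lra.
Qed.

Lemma prob_bad_degree : prob bad_degree <= (2 * n.+1)%:R * delta.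
Proof.
apply: le_trans (prob_exists p01 _) _.
apply: le_trans (_ : \sum_(o : bool) \sum_(v : I) delta <= _).
  apply: ler_sum => o _; apply: le_trans (prob_exists p01 _) _; apply: ler_sum => v _.
  by apply: le_trans tail_degree; apply: degree_tail.
by rewrite !sumr_const card_bool card_ord -mulrnA mulnC mulr_natl.
Qed.

Lemma prob_bad_factor : prob bad_factor <= (k * L)%:R * delta.
Proof.
apply: le_trans (prob_exists p01 _) _.
apply: le_trans (_ : \sum_(c : 'I_k) \sum_(t : 'I_L) delta <= _).
  apply: ler_sum => c _; apply: le_trans (prob_exists p01 _) _; apply: ler_sum => t _.
  apply: le_trans tail_factor; apply: factor_condition_tail => //; try exact: vertex_at_inj.
  move=> x y; apply/eqP => /(congr1 (block k)); rewrite !block_vertex_at // => et.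
  have tk : (t.+1 < k)%N by have := ltn_ord t; move: LE; clear; lia.
  by have := block_at_inj k_gt0 k_even (ltnW tk) tk et; move/eqP; rewrite eqn_leq ltnn andbF.
by rewrite !sumr_const !card_ord -mulrnA mulnC mulr_natl.
Qed.

Let arcs_at x : {set I * I} :=
  [set f | (f.1 == x) && (f.2 \in far_from x) || (f.2 == x) && (f.1 \in far_from x)].

Let imbalance_arcs x (D D' : digraph I) :
  (forall f, f \in arcs_at x -> (f \in edges D) = (f \in edges D')) ->
  imbalance R (far_from x) x D = imbalance R (far_from x) x D'.
Proof.
move=> DD; apply: eq_bigr => v vx.
by move: vx; rewrite inE => vx; rewrite !DD // !inE /= eqxx vx ?orbT.
Qed.

Lemma prob_bad_count : prob bad_count <= (2 * k)%:R * delta.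
Proof.
apply: le_trans (prob_exists p01 _) _.
apply: le_trans (_ : \sum_(o : bool) \sum_(j : 'I_k) delta <= _).
  apply: ler_sum => o _; apply: le_trans (prob_exists p01 _) _; apply: ler_sum => j _.
  apply: le_trans (_ : expR (- (c1 * #|@block_set n k j|%:R / 4)) <= _); last first.
    apply: le_trans tail_count; rewrite ler_expR lerN2.
    have : b%:R <= #|@block_set n k j|%:R :> R by rewrite ler_nat block_set_ge.
    by have := @expR_gt0 R (- 256); move=> c0 /(ler_wpM2l (ltW c0)); lra.
  apply: (@count_lower_tail R n.+1 p p01 _ arcs_at
    (fun x D => theta <= (-1) ^+ o * imbalance R (far_from x) x D)); first exact: expR_ge0.
  - by move=> x D D' DD; rewrite (imbalance_arcs DD).
  (* Vertices of one block are near each other, so an arc to a far vertex lies in [arcs_at] of only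
     one of them. *)
  - move=> x y; rewrite !inE => /eqP xj /eqP yj xy; rewrite -setI_eq0; apply/eqP/setP => -[u v].
    rewrite !inE /=; apply/negbTE/negP => /andP[].
    have nxy : near x y by apply: near_same; rewrite xj yj.
    have nyx : near y x by rewrite near_sym.
    move=> /orP[]/andP[/eqP-> h1] /orP[]/andP[/eqP h2 h3].
    + by rewrite h2 eqxx in xy.
    + by rewrite h2 nxy in h1.
    + by rewrite h2 nxy in h1.
    + by rewrite h2 eqxx in xy.
  - move=> x _; have v256 : 256 <= #|far_from x|%:R * (p * q).
      by apply: le_trans variance_ge _; rewrite ler_wpM2r // (pq_ge0 p01).
    apply: le_trans (imbalance_tail p01 o (far_irrefl x) v256) _.
    apply: prob_mono => // D; apply: le_trans; apply: le_trans theta_le _.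
    have : N / 2 * (p * q) <= #|far_from x|%:R * (p * q) by rewrite ler_wpM2r // (pq_ge0 p01).
    by move/ler_wsqrtr => le; apply: ler_wpM2r; rewrite ?invr_ge0 ?le //.
by rewrite !sumr_const card_bool card_ord -mulrnA mulnC mulr_natl.
Qed.

Lemma prob_bad_near : prob bad_near <= (2 * n.+1)%:R * delta.
Proof.
apply: le_trans (prob_exists p01 _) _.
apply: le_trans (_ : \sum_(o : bool) \sum_(v : I) delta <= _).
  apply: ler_sum => o _; apply: le_trans (prob_exists p01 _) _; apply: ler_sum => v _.
  set W := _ :\ v; have vW : v \notin W by rewrite !inE eqxx.
  have WM : #|W|%:R <= M%:R :> R.
    rewrite ler_nat; apply: leq_trans (@near_set_le n k b h k_gt0 bE v).
    exact/subset_leq_card/subsetDl.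
  have /andP[p0 p1] := p01; have l01 : 0 <= (1 / 8 : R) <= 1 / 2 by apply/andP; split; lra.
  have Wp : #|W|%:R * p <= M%:R * p by rewrite ler_wpM2r.
  have WV : #|W|%:R * (p * q) <= M%:R * p.
    apply: le_trans Wp; rewrite ler_wpM2l // -[X in _ <= X]mulr1 ler_wpM2l //; lra.
  apply: le_trans (le_trans (deg_upper_tail p01 o vW (M%:R * p) l01 WV) _).
    apply: prob_mono => // D; apply: le_trans; apply: le_trans theta_ge; lra.
  by apply: le_trans tail_near; rewrite ler_expR; lra.
by rewrite !sumr_const card_bool card_ord -mulrnA mulnC mulr_natl.
Qed.

Lemma prob_bad_zone : prob bad_zone <= (2 * n.+1)%:R * delta.
Proof.
apply: le_trans (prob_exists p01 _) _.
apply: le_trans (_ : \sum_(o : bool) \sum_(v : I) delta <= _).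
  apply: ler_sum => o _; apply: le_trans (prob_exists p01 _) _; apply: ler_sum => v _.
  have delta0 : 0 <= delta by apply: le_trans tail_zone; apply: expR_ge0.
  pose B (A : {set I}) (D : digraph I) := rich A && (deg_in o (zone o v :&: A) v D < s)%N.
  (* The arcs between far vertices determine the extreme set; those between near vertices determine
     the degrees into its part in the zone. *)
  apply: (@prob_conditional R n.+1 p p01 _ (extreme o) B [set f | ~~ near f.1 f.2]) => //.
  - move=> D D' DD; apply/setP => x; rewrite !inE (@imbalance_arcs x D D') // => f fx.
    apply: DD; move: fx; rewrite !inE => /orP[]/andP[/eqP-> //].
    by rewrite near_sym.
  - move=> A D D' DD; rewrite /B; congr (_ && (_ < s)%N)%:R; apply: eq_card => u.
    rewrite in_set [in RHS]in_set; case: (boolP (u \in zone o v :&: A)) => //= /setIP[uz _].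
    have nvu := zone_near uz; apply: DD.
    by rewrite !inE negbK /arc_at; case: (o); rewrite //= near_sym.
  move=> A; rewrite /B; case: (boolP (rich A)) => [|_]; last by rewrite prob_eq0.
  move=> /forallP richA.
  set W := zone o v :&: A.
  have vW : v \notin W by rewrite inE negb_and zone_irrefl.
  have hm : (h * m)%:R <= #|W|%:R :> R.
    rewrite ler_nat; apply: zone_card => // j jk; exact: (richA (Ordinal jk)).
  have /andP[p0 p1] := p01; have l01 : 0 <= (1 / 8 : R) <= 1 / 2 by apply/andP; split; lra.
  have Wp : (h * m)%:R * p <= #|W|%:R * p by rewrite ler_wpM2r.
  have WV : #|W|%:R * (p * q) <= #|W|%:R * p.
    rewrite ler_wpM2l // -[X in _ <= X]mulr1 ler_wpM2l //; lra.
  apply: le_trans (le_trans (deg_lower_tail p01 o vW (#|W|%:R * p / 2) l01 WV) _).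
    apply: prob_mono => // D /=; rewrite -(@ltr_nat R) => lt.
    by apply: le_trans (ltW lt) _; apply: le_trans s_le _; lra.
  by apply: le_trans tail_zone; rewrite ler_expR; lra.
by rewrite !sumr_const card_bool card_ord -mulrnA mulnC mulr_natl.
Qed.

Let near_set x : {set I} := [set u | near x u] :\ x.

Let deg_split o x D : deg_in o [set~ x] x D = (deg_in o (far_from x) x D + deg_in o (near_set x) x D)%N.
Proof.
rewrite /deg_in -cardsUI [X in (_ = _ + X)%N]eq_card0 ?addn0; last first.
  by move=> u; rewrite !inE; case: (near x u); rewrite //= !andbF.
apply: eq_card => u; rewrite !inE; case: (altP (u =P x)) => [->|_] /=.
  by rewrite near_refl.
by case: (near x u); rewrite //= orbF.
Qed.

Let imbalance_deg x (D : digraph I) : imbalance R (far_from x) x D =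
  (deg_in true (far_from x) x D)%:R - (deg_in false (far_from x) x D)%:R.
Proof.
have deg_sum o : (deg_in o (far_from x) x D)%:R =
    \sum_(u in far_from x) (arc_at o x u \in edges D)%:R :> R.
  rewrite -natr_sum /deg_in -sum1_card big_mkcond [in RHS]big_mkcond; congr (_%:R).
  by apply: eq_bigr => u _; rewrite in_set; case: (u \in far_from x) => //=; case: (_ \in edges D).
by rewrite !deg_sum -sumrB.
Qed.

Lemma consistent_of_not_bad D : ~~ bad D -> consistent D.
Proof.
rewrite /bad !negb_or => /and5P[ok_degree ok_factor ok_count ok_near ok_zone].
pose Rin0 := [set f in edges D | (f.1 \in extreme false D) && (f.1 \in zone false f.2)].
pose Rout0 := [set f in edges D | (f.2 \in extreme true D) && (f.2 \in zone true f.1)].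
have degree o v : (deg_in o [set~ v] v D + r * (k %/ b.+1).+1 <= r * L + d)%N.
  move: ok_degree; rewrite negb_exists => /forallP/(_ o); rewrite negb_exists => /forallP/(_ v).
  rewrite -ltNge => lt; rewrite -(@ler_nat R) natrD; apply: le_trans degree_le.
  by rewrite lerD2r ltW.
have nearD o v : (deg_in o (near_set v) v D)%:R <= theta.
  move: ok_near; rewrite negb_exists => /forallP/(_ o); rewrite negb_exists => /forallP/(_ v).
  by rewrite -ltNge => /ltW.
have richD o : rich (extreme o D).
  apply/forallP => j; rewrite -(@ler_nat R).
  move: ok_count; rewrite negb_exists => /forallP/(_ o); rewrite negb_exists => /forallP/(_ j).
  rewrite -ltNge => lt; apply: le_trans m_le _; apply: le_trans (ltW (le_lt_trans _ lt)) _.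
    have : b%:R <= #|@block_set n k j|%:R :> R by rewrite ler_nat block_set_ge.
    by have := @expR_gt0 R (- 256) => c0 /(ler_wpM2l (ltW c0)); lra.
  rewrite ler_nat; apply/subset_leq_card/subsetP => x.
  by rewrite in_setI !in_set => /andP[-> ->].
have zoneD o v : (s <= deg_in o (zone o v :&: extreme o D) v D)%N.
  move: ok_zone; rewrite negb_exists => /forallP/(_ o); rewrite negb_exists => /forallP/(_ v).
  by rewrite richD /= -leqNgt.
have loopless v : (v, v) \notin edges D by have /forallP := edges_loopless D.
(* The excess is the imbalance plus the near out-degree minus the near in-degree, and the last is at
   most theta by [nearD]. What remains is at least the near out-degree, which counts every reserved
   arc of [Rin0] leaving v. *)
have exc v : theta <= imbalance R (far_from v) v D ->
    (deg_in true (near_set v) v D <= outn (edges D) v - inn (edges D) v)%N.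
  rewrite outn_deg inn_deg !deg_split imbalance_deg => th.
  have /(le_trans (nearD false v)) := th; rewrite lerBrDr -natrD ler_nat.
  by clear; lia.
have def v : theta <= - imbalance R (far_from v) v D ->
    (deg_in false (near_set v) v D <= inn (edges D) v - outn (edges D) v)%N.
  rewrite outn_deg inn_deg !deg_split imbalance_deg opprB => th.
  have /(le_trans (nearD true v)) := th; rewrite lerBrDr -natrD ler_nat.
  by clear; lia.
have [|||||||||||P [decP sizeP]] := @optimal_decomposition n k b h L r d l w s
   (edges D) Rin0 Rout0 k_gt0 k_even bE l_gt0 loopless LE _ _ _ _ _ _ _ _ _ _ _ capacity potential;
  last exact: consistent_of decP sizeP.
(* The cut condition is trivial up to size sum b. Beyond that, the bound on arcs suffices because (b
   - #|X|) (b - #|Y|) is nonnegative, that is, #|X| #|Y| is at least b (#|X| + #|Y| - b). *)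
- move=> c t X Y tL; case: (leqP (#|X| + #|Y|) b) => XY.
    by apply: leq_trans (leq_addl _ _); rewrite leq_mul2l XY orbT.
  move: ok_factor; rewrite negb_exists => /forallP/(_ c).
  rewrite negb_exists => /forallP/(_ (Ordinal tL)); rewrite negb_exists => /forallP/(_ X).
  rewrite negb_exists => /forallP/(_ Y); rewrite XY /= -ltNge.
  move: #|_ :&: _| => c0 lt; rewrite -(@ler_nat R) natrD !natrM natrD.
  have Xb : #|X|%:R <= b%:R :> R by rewrite ler_nat -[X in (_ <= X)%N]card_ord max_card.
  have Yb : #|Y|%:R <= b%:R :> R by rewrite ler_nat -[X in (_ <= X)%N]card_ord max_card.
  have XYb : b%:R <= #|X|%:R + #|Y|%:R :> R by rewrite -natrD ler_nat ltnW.
  rewrite -lerBlDr -mulrBr.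
  apply: le_trans (_ : b%:R * p * (1 - e * q) * (#|X|%:R + #|Y|%:R - b%:R) <= _).
    by rewrite ler_wpM2r // subr_ge0.
  apply: le_trans (ltW lt).
  have pe : 0 <= p * (1 - e * q).
    have /andP[p0 p1] := p01; have /andP[e0 e1] := e01.
    by rewrite mulr_ge0 // subr_ge0; nra.
  have : b%:R * (#|X|%:R + #|Y|%:R - b%:R) <= #|X|%:R * #|Y|%:R :> R.
    by move: Xb Yb; move: (#|X|%:R) (#|Y|%:R) (b%:R) => x y b'; nra.
  by move/(ler_wpM2l pe); lra.
- by move=> v; rewrite outn_deg degree.
- by move=> v; rewrite inn_deg degree.
- by apply/subsetP => f; rewrite inE => /andP[].
- by apply/subsetP => f; rewrite inE => /andP[].
- move=> f; rewrite in_set => /and3P[_ _]; rewrite in_set => /existsP[i /eqP->].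
  by exists i; rewrite // -addnA addn1.
- move=> f; rewrite in_set => /and3P[_ _]; rewrite in_set => /existsP[i /eqP->].
  by exists i; rewrite // -addnA addn2.
- move=> v; apply: leq_trans (zoneD false v) _; apply/subset_leq_card/subsetP => x.
  by rewrite in_set => /andP[/setIP[xz xe] xD]; rewrite in_set in_set xe xz xD.
- move=> v; apply: leq_trans (zoneD true v) _; apply/subset_leq_card/subsetP => x.
  by rewrite in_set => /andP[/setIP[xz xe] xD]; rewrite in_set in_set xe xz xD.
- move=> v; case: (boolP (v \in extreme false D)) => vE.
    apply: leq_trans (exc v _); last by move: vE; rewrite in_set expr0 mul1r.
    apply/subset_leq_card/subsetP => x; rewrite in_set in_set => /and3P[xD _ /zone_near nxv].
    rewrite in_set in_setD1 in_set near_sym nxv xD !andbT.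
    by apply: contraTneq xD => ->.
  by rewrite /outn eq_card0 // => x; rewrite in_set in_set /= (negbTE vE) andbF.
- move=> v; case: (boolP (v \in extreme true D)) => vE.
    apply: leq_trans (def v _); last by move: vE; rewrite in_set expr1 mulN1r.
    apply/subset_leq_card/subsetP => x; rewrite in_set in_set => /and3P[xD _ /zone_near nxv].
    rewrite in_set in_setD1 in_set near_sym nxv xD !andbT.
    by apply: contraTneq xD => ->.
  by rewrite /inn eq_card0 // => x; rewrite in_set in_set /= (negbTE vE) andbF.
Qed.

Lemma prob_consistent_ge :
  1 - (6 * n.+1 + k * L + 2 * k)%:R * delta <= Dnp_prob p (@consistent I).
Proof.
rewrite probE prob_compl lerD2l lerN2.
apply: le_trans (_ : prob bad <= _).
  by apply: prob_mono => // D; apply: contraR; apply: consistent_of_not_bad.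
rewrite /bad; apply: le_trans (prob_or p01 _ _) _.
apply: le_trans (lerD prob_bad_degree (le_trans (prob_or p01 _ _) (lerD prob_bad_factor
  (le_trans (prob_or p01 _ _) (lerD prob_bad_count (le_trans (prob_or p01 _ _)
    (lerD prob_bad_near prob_bad_zone))))))) _.
by rewrite -!mulrDl -!natrD; rewrite le_eqVlt; apply/orP; left; apply/eqP; congr (_%:R * _); clear; lia.
Qed.
End FiniteBound.

(** * Choice of the parameters *)

Lemma nat_floor (R : realType) (x : R) : 0 <= x -> exists t : nat, t%:R <= x < t%:R + 1.
Proof.
by move=> x0; exists (Num.truncn x); rewrite natr1; apply: truncn_itv.
Qed.

Lemma bin_le_expn m k : ('C(m, k) <= m ^ k)%N.
Proof.
apply: leq_trans (_ : m ^_ k <= _)%N; first by rewrite -bin_ffact leq_pmulr ?fact_gt0.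
elim: k => [|k IH]; first by rewrite ffactn0.
by rewrite ffactnSr expnSr leq_mul // leq_subr.
Qed.

Lemma expR_nat_lt (R : realType) (x : R) (t : nat) : x < t%:R -> expR x < (2 ^ t.*2)%:R.
Proof.
move=> xt; have e4 : expR 1 <= 4 :> R.
  have : expR 1 = expR (1 / 2) ^+ 2 :> R.
    by rewrite -expRM_natl; congr expR; lra.
  have := @expR_ge1Dx R (- (1 / 2)); have := @expRxMexpNx_1 R (1 / 2).
  have := @expR_gt0 R (1 / 2); move: (expR (1 / 2)) (expR (- (1 / 2))) => a b; nra.
apply: lt_le_trans (_ : expR t%:R <= _); first by rewrite ltr_expR.
rewrite -mul2n expnM natrX -[t%:R]mulr1 expRM_natl.
by apply: lerXn2r => //; rewrite nnegrE ?expR_ge0.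
Qed.

Section Numerics.
Context (R : realType).
Notation c1 := (expR (- 256) : R).

(* In terms of S = sqrt (n p q): [k] is of order S / q, so that the blocks have
   pseudo-random density up to a relative error e q; the remainder of the path
   systems has degrees of order e S ^ 2, and its decomposition into paths of
   length about S / y ^ 2 costs O(S / y) superfluous starts per vertex. The
   constants h and K make the h zones of a vertex supply s >= 3 b p reserved
   arcs, while its 2 h nearest blocks shift its excess by at most S / 12. *)
Lemma prob_consistent_large : exists C : R, 1 <= C /\ forall n (p : R), 0 < p < 1 ->
  let N : R := n.+1%:R in let y := ln N in
  C <= y -> C * y ^+ 9 <= Num.sqrt (N * p * (1 - p) ^+ 3) ->
  1 - 9 / N <= Dnp_prob p (@consistent 'I_n.+1).
Proof.
set c : R := c1; have c0 : 0 < c by apply: expR_gt0.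
have cle1 : c <= 1 by rewrite expR_le1; lra.
have cE : c = c1 by [].
clearbody c.
(* With m about c b / 4 and B = b p, this makes h m p at least 32 B up to a constant; the 32 matches
   the denominator in [tail_zone]. *)
have [h0 /andP[_ hlt]] := nat_floor (ltW (divr_gt0 (ltr0Sn R 127) c0)).
pose h := h0.+1; have hc : 128 <= h%:R * c.
  by move: hlt; rewrite ltr_pdivrMr // natr1 -/h => /ltW.
clear hlt.
(* Later M p = (4 h + 2) (B + p), with B + p at most 3 a for a = S / (3 K). So 2 M p is at most (24
   h + 12) a, and this K turns it into a K / 4 = S / 12. *)
pose K : R := 96 * h%:R + 48; have KE : K = 96 * h%:R + 48 by [].
have h1 : 1 <= h%:R :> R by rewrite ler1n.
clearbody h K; clear h0.
have K1 : 144 <= K by lra.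
have K0 : 0 < K by move: K1; clear; lra.
have Kh : h%:R + 3 <= K by lra.
pose C := 40 * 40 * K / c.
have CK : 40 * 40 * K <= C.
  by rewrite /C ler_pdivlMr // -[X in _ <= X]mulr1 ler_wpM2l //; lra.
have Cc : C * c = 40 * 40 * K by rewrite /C mulfVK // gt_eqF.
clearbody C.
have C1 : 1 <= C by move: CK K1; clear; lra.
exists C; split=> //.
move=> n p p01 N y yC; set X := Num.sqrt _ => XC.
set q := 1 - p in X XC *; have qE : q = 1 - p by [].
have /andP[p0 p1] := p01; have q0 : 0 < q by rewrite subr_gt0.
have q1 : q <= 1 by rewrite gerBl ltW.
have y1 : 1 <= y by apply: le_trans yC.
have y0 : 0 < y by apply: lt_le_trans y1.
have N0 : 0 < N by rewrite ltr0n.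
have Ny : expR y = N by rewrite lnK // posrE.
have XE : X = Num.sqrt (N * p * q ^+ 3) by [].
clearbody X q.
pose V := N * p * q; have V0 : 0 < V by rewrite !mulr_gt0.
pose S := Num.sqrt V; have S2 : S ^+ 2 = V by rewrite sqr_sqrtr // ltW.
have S0 : 0 < S by rewrite sqrtr_gt0.
have XS : X = S * q.
  rewrite XE (_ : N * p * q ^+ 3 = V * q ^+ 2); last by rewrite /V; ring.
  by rewrite sqrtrM ?(ltW V0) // sqrtr_sqr gtr0_norm.
pose g := S / q; have g0 : 0 < g by rewrite divr_gt0.
have gq : g * q = S by rewrite /g mulfVK // gt_eqF.
have Sg : N * p = S * g.
  by apply: (mulIf (lt0r_neq0 q0)); rewrite -[LHS]/V -S2 -mulrA gq.
have VE : V = N * p * q by [].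
clearbody V S g.
have y9 : 1 <= y ^+ 9 by rewrite exprn_ege1.
have X_ge : C <= X.
  by apply: le_trans XC; rewrite -[X in X <= _]mulr1 ler_wpM2l // (le_trans ler01).
have XS' : X <= S by rewrite XS -[X in _ <= X]mulr1 ler_wpM2l // ltW.
have Sge : C * y ^+ 9 <= S by apply: le_trans XS'.
have gS : S <= g by rewrite -gq -[X in _ <= X]mulr1 ler_wpM2l // ltW.
have yS : C * y <= S.
  apply: le_trans Sge; rewrite ler_wpM2l // ?(le_trans ler01) //.
  by rewrite -[X in X <= _]expr1 ler_weXn2l.
have CS : C <= S by apply: le_trans XS'.
have Kg : K <= K * g.
  by rewrite -[X in X <= _]mulr1 ler_wpM2l ?(ltW K0) // (le_trans C1) // (le_trans CS).
have [k1 /andP[k1le k1gt]] := nat_floor (ltW (mulr_gt0 K0 g0)).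
pose k0 := k1.+1; pose k := k0.*2.
have kR : k%:R = 2 * k1%:R + 2 :> R by rewrite /k /k0 -mul2n natrM -natr1; ring.
have k_ge : 2 * (K * g) <= k%:R by move: k1gt; rewrite kR; clear; lra.
have k_le : k%:R <= 3 * (K * g) by move: k1le K1 Kg; rewrite kR; clear; lra.
have k_gt0 : (0 < k)%N by rewrite /k double_gt0.
have k_even : ~~ odd k by rewrite odd_double.
pose b := (n.+1 %/ k)%N.
have bk : b%:R * k%:R <= N by rewrite -natrM ler_nat leq_divM.
have bk1 : N < (b%:R + 1) * k%:R by rewrite natr1 -natrM ltr_nat ltn_ceil.
have kpos : 0 < k%:R :> R by rewrite ltr0n.
(* As N p = S g and k lies between 2 K g and 3 K g, the average degree B between two blocks lies, up
   to p, between a and 3 a / 2. *)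
pose a := S / (3 * K); have aS : a * (3 * K) = S.
  by rewrite /a mulfVK // gt_eqF // mulr_gt0.
clearbody a.
pose B := b%:R * p; have BE : B = b%:R * p by [].
have B_le : B <= a * (3 / 2).
  rewrite -(ler_pM2r (mulr_gt0 K0 g0)).
  have -> : a * (3 / 2) * (K * g) = a * (3 * K) * g / 2 by ring.
  rewrite aS -Sg ler_pdivlMr //.
  have -> : B * (K * g) * 2 = b%:R * (2 * (K * g)) * p by rewrite /B; ring.
  rewrite ler_pM2r //; apply: le_trans bk; exact: ler_wpM2l.
have Bp_ge : a <= B + p.
  rewrite -(ler_pM2r (mulr_gt0 (mulr_gt0 (ltr0Sn R 2) K0) g0)) mulrA aS -Sg.
  have -> : (B + p) * (3 * K * g) = (b%:R + 1) * (3 * (K * g)) * p by rewrite /B; ring.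
  rewrite ler_pM2r // (le_trans (ltW bk1)) // ler_wpM2l // addr_ge0 //.
clearbody B.
have a_ge : 500 * y <= a.
  rewrite -(ler_pM2r (mulr_gt0 (ltr0Sn R 2) K0)) aS.
  apply: le_trans yS; apply: le_trans (ler_wpM2r (ltW y0) CK).
  by move: (mulr_gt0 y0 K0); clear; nra.
have Bge : a / 2 <= B by move: a_ge y1 p1 Bp_ge; clear; lra.
have B1 : 1 <= B by move: a_ge y1 Bge; clear; lra.
have b_ge : B <= b%:R by rewrite BE -[X in _ <= X]mulr1 ler_wpM2l // ltW.
have b1 : (0 < b)%N by rewrite -(ltr_nat R) (lt_le_trans _ b_ge) // (lt_le_trans _ B1).
have Ky : 40 * 40 * K <= y by apply: le_trans yC.
(* This power serves twice: e S ^ 2 is the square of T = S / y ^ 2, and e ^ 2 y ^ 9 = y is left for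
   the exponent of z. *)
pose e := (y ^+ 4)^-1.
have y4 : 1 <= y ^+ 4 by rewrite exprn_ege1.
have e01 : 0 <= e <= 1.
  by rewrite invr_ge0 (le_trans _ y4) //= invf_le1 // (lt_le_trans _ y4).
have ye : y ^+ 4 * e = 1 by rewrite mulfV // gt_eqF // (lt_le_trans _ y4).
have e0 : 0 < e by rewrite invr_gt0 (lt_le_trans _ y4).
pose E := e * V.
pose T := S / y ^+ 2.
have T0 : 0 < T by rewrite divr_gt0 // exprn_gt0.
have TE : T ^+ 2 = E by rewrite /T /E /e -S2; field; rewrite gt_eqF.
have y2T : T * y ^+ 2 = S by rewrite /T mulfVK // expf_neq0 // gt_eqF.
have E_ge c' : c' <= 100 * K -> c' * g <= E.
  move=> c'K; rewrite -(ler_pM2r q0) -mulrA gq /E -S2.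
  have -> : e * S ^+ 2 * q = S * (e * X) by rewrite XS; ring.
  rewrite mulrC ler_pM2l //.
  have : 100 * K <= e * X; last by move: c'K; clear; lra.
  have : e * (C * y ^+ 9) <= e * X by rewrite ler_pM2l.
  have -> : e * (C * y ^+ 9) = y ^+ 4 * e * C * y ^+ 5 by ring.
  rewrite ye mul1r; have : 1 <= y ^+ 5 by rewrite exprn_ege1.
  by move: CK K1; clear; nra.
(* One E is for the fluctuation of the degrees, one for the factor 1 - e q in r. The three k are for
   rounding b, rounding r and the omitted vertices. The last term is for the shortfall of [L] from k
   and for rounding up k / (b + 1). *)
have [d1 /andP[d1le d1gt]] : exists t : nat,
    t%:R <= 2 * E + 3 * k%:R + (2 * h%:R + 2) * B < t%:R + 1.
  apply: nat_floor.
  have E0' : 0 <= E by rewrite -TE exprn_ge0 // ltW.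
  have hB : 0 <= h%:R * B by rewrite mulr_ge0 // (le_trans _ B1).
  have k0' := ltW kpos.
  by move: E0' hB k0' B1; clear; lra.
set Q := _ + _ in d1le d1gt; have QE : Q = 2 * E + 3 * k%:R + (2 * h%:R + 2) * B by [].
clearbody Q.
pose d := d1.+1; have d_ge : Q <= d%:R by rewrite -natr1 ltW.
have d_le : d%:R <= 3 * E.
  have E1 : (9 * K + 2) * g <= E by apply: E_ge; move: K1; clear; lra.
  have hB : (2 * h%:R + 2) * B <= S.
    apply: le_trans (_ : 2 * K * (a * (3 / 2)) <= _).
      by apply: ler_pM => //; [move: h1 | move: B1 | move: Kh]; clear; lra.
    by rewrite -aS; clear; lra.
  rewrite -[d%:R]/(d1.+1%:R) -[d1.+1%:R]natr1; have S1 : 1 <= S by apply: le_trans CS.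
  by move: d1le E1 hB QE k_le S1 gS; clear; lra.
clearbody d; clear d1 d1gt d1le.
have q01 : 0 <= 1 - e * q <= 1.
  have eq1 : e * q <= 1 by apply: mulr_ile1 (ltW e0) (ltW q0) _ q1; case/andP: e01.
  by apply/andP; split; rewrite ?subr_ge0 // gerBl mulr_ge0 // ltW.
have /andP[q00 q11] := q01.
have B0 : 0 < B by apply: lt_le_trans B1.
have [r /andP[r_le r_gt]] : exists t : nat, t%:R <= B * (1 - e * q) < t%:R + 1.
  by apply/nat_floor/mulr_ge0 => //; exact: ltW.
have rB : r%:R <= B.
  by apply: le_trans r_le _; rewrite -[X in _ <= X]mulr1 ler_wpM2l // ltW.
have hk : (h.*2 + 1 <= k)%N.
  rewrite -(ler_nat R) natrD -mul2n natrM; move: Kh Kg k_ge; clear; lra.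
pose L := (k - (h.*2 + 1))%N.
have LE : (L + h.*2 + 1 = k)%N by rewrite /L -addnA subnK.
have LR : L%:R = k%:R - (2 * h%:R + 1) :> R by rewrite /L natrB // natrD -mul2n natrM.
clearbody L.
have degree_le : N * p + e * (N * p * q) + (r * (k %/ b.+1).+1)%:R <= (r * L + d)%:R.
  rewrite natrD !natrM LR -[_.+1%:R]natr1 -VE -/E.
  have fk : (k %/ b.+1)%:R * (b%:R + 1) <= k%:R :> R by rewrite natr1 -natrM ler_nat leq_divM.
  have F2 : r%:R * (k %/ b.+1)%:R <= k%:R :> R.
    by apply: le_trans fk; rewrite mulrC ler_wpM2l // (le_trans rB) // (le_trans b_ge) // lerDl.
  have F3 : r%:R * (2 * h%:R + 2) <= B * (2 * h%:R + 2).
    by rewrite ler_wpM2r //; move: h1; clear; lra.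
  have F1 : B * (1 - e * q) * k%:R <= (r%:R + 1) * k%:R by rewrite ler_wpM2r // ltW.
  have F4 : N * p - k%:R <= B * k%:R.
    apply: le_trans (_ : (N - k%:R) * p <= _).
      rewrite mulrBl lerD2l lerN2 -[X in _ <= X]mulr1 ler_wpM2l // ltW //.
    rewrite BE mulrAC ler_pM2r // lerBlDr (le_trans (ltW bk1)) //.
    by rewrite mulrDl mul1r.
  have F5 : e * q * (B * k%:R) <= E.
    rewrite /E VE (_ : e * (N * p * q) = e * q * (N * p)); last by ring.
    rewrite ler_wpM2l //; first by rewrite mulr_ge0 // ltW.
    by rewrite BE mulrAC ler_wpM2r // ltW.
  by move: F1 F2 F3 F4 F5 d_ge QE; move: (r%:R) (k%:R : R) => rr kk; clear; lra.
have EV : E = e * V by [].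
clearbody E.
(* Length about T keeps both costs of the walk decomposition small against S: d / l is at most 3 T,
   and w will be of order T y = S / y. *)
have [l0 /andP[l0le l0gt]] := nat_floor (ltW T0).
pose l := l0.+1; have lT : T < l%:R by rewrite -natr1.
have lT1 : l%:R <= T + 1 by rewrite -[l%:R]/(l0.+1%:R) -[l0.+1%:R]natr1 lerD2r.
have l_gt0 : (0 < l)%N by [].
clearbody l; clear l0 l0le l0gt.
have dl : (d %/ l)%:R <= 3 * T.
  rewrite -(ler_pM2r T0); apply: le_trans (_ : (d %/ l)%:R * l%:R <= _).
    by rewrite ler_wpM2l // ltW.
  apply: le_trans (_ : d%:R <= _); first by rewrite -natrM ler_nat leq_divM.
  by rewrite -mulrA -[T * T]/(T ^+ 2) TE.
pose U := T * y.
have Uy : U * y = S by rewrite /U -mulrA -y2T.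
have TU : T <= U by rewrite -[X in X <= _]mulr1 ler_wpM2l // ltW.
have Ua : 500 * U <= a.
  rewrite -(ler_pM2r y0) -mulrA Uy -aS.
  have : 40 * 40 * K * a <= a * y by rewrite mulrC ler_wpM2l //; move: a_ge y1; clear; lra.
  have : 0 <= K * a by rewrite mulr_ge0 ?(ltW K0) //; move: a_ge y1; clear; lra.
  by clear; lra.
have [t /andP[t_le t_gt]] : exists t : nat, t%:R <= y + 3 < t%:R + 1.
  by apply: nat_floor; move: y1; clear; lra.
pose u := t.*2; have uy : u%:R <= 8 * y.
  by rewrite /u -mul2n natrM; move: t_le y1; clear; lra.
have Nu : 4 * N < (2 ^ u)%:R.
  apply: le_lt_trans (expR_nat_lt (_ : y + 2 < t%:R)); last by move: t_gt; clear; lra.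
  rewrite -Ny expRD mulrC ler_wpM2l ?expR_ge0 //.
  rewrite (_ : 2 = 1 + 1) ?expRD; last by clear; lra.
  by have := @expR_ge1Dx R 1; move: (expR 1) => x; clear; nra.
clearbody u.
(* As 2 ^ u exceeds 4 N, which bounds d + l, this makes 2 ^ w at least N (d + l) ^ l. *)
pose w := (u * l.+1)%N.
have w_le : w%:R <= 8 * U + 16 * y.
  rewrite /w natrM -[l.+1%:R]natr1; apply: le_trans (_ : 8 * y * (T + 2) <= _).
    by apply: ler_pM; rewrite ?addr_ge0 //; move: lT1; clear; lra.
  by rewrite /U; clear; lra.
have wE : w = (u * l.+1)%N by [].
clearbody w.
have capacity : forall s, 3 * B <= s%:R -> (2 * r + (d %/ l).+1 + w + maxn l.+1 h <= s)%N.
  move=> s Bs; rewrite -(ler_nat R); apply: le_trans Bs.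
  have lh : (maxn l.+1 h)%:R <= T + 2 + h%:R.
    apply: le_trans (_ : (l.+1 + h)%:R <= _); first by rewrite ler_nat geq_max leq_addr leq_addl.
    by rewrite natrD -[l.+1%:R]natr1; move: lT1; clear; lra.
  rewrite mul2n -addnn !natrD -[(d %/ l).+1%:R]natr1.
  by move: lh dl w_le TU Ua rB a_ge Bge Kh Ky K1 y1; clear; lra.
have N1 : 1 <= N by rewrite ler1n.
have V_N : V <= N.
  by rewrite VE -mulrA -[X in _ <= X]mulr1 ler_wpM2l ?mulr_ile1 // ltW.
have E_V : E <= V / 3.
  have : 3 <= y ^+ 4.
    apply: le_trans (_ : y <= _); first by move: Ky K1; clear; lra.
    by rewrite -[X in X <= _]expr1 ler_weXn2l.
  move=> y43; have : 3 * e <= 1 by rewrite -[X in _ <= X]ye ler_pM2r.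
  by move=> /(ler_wpM2r (ltW V0)); rewrite EV; clear; lra.
have potential : (n.+1 * 'C(d + l, d) < 2 ^ w.+1)%N.
  have dl4 : (d + l <= 4 * n.+1)%N.
    rewrite -(ler_nat R) natrD natrM.
    have T_E : T <= E + 1.
      by rewrite -TE; clear; nra.
    by move: T_E lT1 d_le E_V V_N N1; clear; lra.
  have N2 : (4 * n.+1 <= 2 ^ u)%N by rewrite -(ler_nat R) natrM ltW.
  apply: leq_ltn_trans (_ : (2 ^ w < _)%N); last by rewrite ltn_exp2l.
  have -> : 'C(d + l, d) = 'C(d + l, l) by rewrite -[in RHS]bin_sub ?leq_addl // addnK.
  rewrite wE mulnS expnD expnM; apply: leq_mul.
    by apply: leq_trans N2; rewrite -[X in (X <= _)%N]mul1n leq_mul2r.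
  apply: leq_trans (bin_le_expn _ _) _; rewrite leq_exp2r //.
  exact: leq_trans N2.
clear Nu u uy wE w_le.
have [m /andP[m_le m_gt]] : exists t : nat, t%:R <= c * b%:R / 4 < t%:R + 1.
  by apply/nat_floor/divr_ge0 => //; rewrite mulr_ge0 // ltW.
have HM : 32 * B - h%:R <= (h * m)%:R * p.
  rewrite natrM BE; apply: le_trans (_ : h%:R * (c * b%:R / 4 - 1) * p <= _); last first.
    by rewrite ler_pM2r // ler_wpM2l // lerBlDr ltW.
  have : 128 * (b%:R * p) <= h%:R * c * (b%:R * p) by rewrite ler_wpM2r // -BE ltW.
  have : h%:R * p <= h%:R by rewrite -[X in _ <= X]mulr1 ler_wpM2l // ltW.
  by move: (h%:R) b%:R => x b'; clear; lra.
have [s /andP[s_le s_gt]] : exists t : nat, t%:R <= (h * m)%:R * p / 2 < t%:R + 1.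
  by apply/nat_floor/divr_ge0 => //; rewrite mulr_ge0 // ltW.
have sB : 3 * B <= s%:R.
  by move: s_gt HM Bge a_ge Ky Kh y1; move: (h * m)%:R => hm; clear; lra.
pose M := (h.*2.+1 * (b.+1 + b.+1))%N.
have MR : M%:R = (2 * h%:R + 1) * (2 * (b%:R + 1)) :> R.
  by rewrite /M natrM natrD -!natr1 -mul2n natrM; clear; ring.
have Mp : M%:R * p = (4 * h%:R + 2) * (B + p) by rewrite MR BE; ring.
have M_le : (M.*2 <= n.+1)%N.
  rewrite -(ler_nat R) -mul2n natrM MR; apply: le_trans bk.
  have Kk : K <= k%:R by move: Kg k_ge K0; clear; lra.
  have Kb : b%:R * K <= b%:R * k%:R by rewrite ler_wpM2l.
  apply: le_trans Kb; have : 1 <= b%:R :> R by apply: le_trans B1 b_ge.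
  by rewrite KE; move: h1; clear; nra.
(* That is N ^ -4, against at most 9 N ^ 2 terms in the union bound. *)
pose delta := expR (- (4 * y)).
have delta_ge x : 4 * y <= x -> expR (- x) <= delta.
  by move=> xy; rewrite ler_expR lerN2.
have eS : 40 * y <= e * S.
  apply: le_trans (_ : e * (C * y ^+ 9) <= _); last by rewrite ler_pM2l.
  have -> : e * (C * y ^+ 9) = y ^+ 4 * e * C * y ^+ 5 by ring.
  rewrite ye mul1r; apply: ler_pM => //; first exact: ltW.
    by move: CK K1; clear; lra.
  by rewrite -[X in X <= _]expr1 ler_weXn2l.
have tail_degree : expR (- (e ^+ 2 * (N * p * q) / 8)) <= delta.
  apply: delta_ge; rewrite -VE -S2 -exprMn.
  by move: eS y1; move: (e * S) => x; clear; nra.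
have eqB : 200 * y <= e ^+ 2 * (q * B).
  have aq : 500 * y ^+ 9 <= q * a.
    have : 40 * 40 * K * y ^+ 9 <= q * (a * (3 * K)).
      rewrite aS [q * S]mulrC -XS; apply: le_trans XC; rewrite ler_wpM2r //.
      exact: le_trans y9.
    have := mulr_ge0 (ltW K0) (le_trans ler01 y9).
    by rewrite -[_ * _ <= q * a](ler_pM2l K0); move: (y ^+ 9) => x; clear; lra.
  have : 200 * y ^+ 9 <= q * B.
    have : q * (a / 2) <= q * B by rewrite ler_pM2l.
    by move: aq y9; move: (y ^+ 9) => x; clear; lra.
  move=> /(ler_wpM2l (exprn_ge0 2 (ltW e0))); apply: le_trans.
  have -> : e ^+ 2 * (200 * y ^+ 9) = 200 * (y ^+ 4 * e) ^+ 2 * y by ring.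
  by rewrite ye expr1n mulr1.
pose z := expR (- (e ^+ 2 * (p * q) * b%:R / 32)).
have z_le : z <= expR (- (6 * y)).
  rewrite ler_expR lerN2 (_ : _ * b%:R = e ^+ 2 * (q * B)); last by rewrite BE; ring.
  by move: eqB y1; clear; lra.
have y6 : 8 <= y by move: Ky K1; clear; lra.
have tail_factor : 8 * (b%:R * z) <= delta.
  have bN : b%:R <= N by rewrite ler_nat leq_div.
  apply: le_trans (_ : N * (N * expR (- (6 * y))) <= _).
    apply: ler_pM => //; first by rewrite mulr_ge0 ?expR_ge0.
      rewrite -Ny; apply: le_trans (expR_ge1Dx y); by move: y6; clear; lra.
    by apply: ler_pM => //; rewrite expR_ge0.
  rewrite -Ny -!expRD ler_expR; clear; lra.
have delta1 : delta <= 1 by rewrite expR_le1; move: y0; clear; lra.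
have bz : b%:R * z <= 1 / 2 by move: tail_factor delta1; clear; lra.
have cB : 20 * y <= c * B.
  have : 40 * 40 * K * y <= c * (a * (3 * K)).
    rewrite aS -Cc mulrAC mulrC ler_pM2l //.
  have -> : c * (a * (3 * K)) = 3 * K * (c * a) by ring.
  have -> : 40 * 40 * K * y = K * (40 * 40 * y) by ring.
  rewrite -mulrA [3 * _]mulrC -mulrA ler_pM2l //.
  have : c * (a / 2) <= c * B by rewrite ler_pM2l.
  by move: y0; clear; lra.
have tail_count : expR (- (c * b%:R / 4)) <= delta.
  apply: delta_ge; have : c * B <= c * b%:R by rewrite ler_pM2l.
  by move: cB y0; clear; lra.
have tail_near : expR (- (3 / 32 * (M%:R * p))) <= delta.
  apply: delta_ge; rewrite Mp; move: h1 Bge a_ge p0 y1.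
  by move: (h%:R) => x; clear; nra.
have tail_zone : expR (- ((h * m)%:R * p / 32)) <= delta.
  by apply: delta_ge; move: HM Bge a_ge Ky Kh y1; move: ((h * m)%:R) => x; clear; lra.
have theta_ge : 2 * (M%:R * p) <= S / 12.
  rewrite -aS KE ler_pdivlMr // Mp.
  have : (8 * h%:R + 4) * (B + p) <= (8 * h%:R + 4) * (a * 3).
    by rewrite ler_wpM2l //; [move: h1 | move: B_le p1 a_ge y1]; clear; lra.
  by clear; lra.
have NE : N / 2 * (p * q) = V / 2 by rewrite VE; ring.
(* S / 12 is (2 / 3) S / 8, and 2 / 3 is below the square root of 1 / 2. *)
have theta_le : S / 12 <= Num.sqrt (N / 2 * (p * q)) / 8.
  have : Num.sqrt ((2 / 3 * S) ^+ 2) <= Num.sqrt (N / 2 * (p * q)).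
    rewrite NE ler_sqrt; last by rewrite divr_ge0 // ltW.
    by rewrite exprMn S2; move: V0; clear; lra.
  rewrite sqrtr_sqr ger0_norm; last by rewrite mulr_ge0 ?divr_ge0 // ltW.
  by clear; lra.
have variance_ge : 256 <= N / 2 * (p * q).
  by rewrite NE -S2; move: CS CK K1; clear; nra.
have Nd : delta = N ^- 4 by rewrite /delta expRN expRM_natl Ny.
have kN : (k <= n.+1)%N.
  by apply: leq_trans (leq_divM n.+1 k); rewrite leq_pmull.
have Lk : (L <= k)%N by rewrite -LE -addnA leq_addr.
have total : (6 * n.+1 + k * L + 2 * k)%:R * delta <= 9 / N.
  have : (6 * n.+1 + k * L + 2 * k)%:R <= 9 * N ^+ 2 :> R.
    rewrite -natrX -natrM ler_nat.
    have : (k * L <= n.+1 * n.+1)%N by rewrite leq_mul // (leq_trans Lk).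
    have : (n.+1 <= n.+1 * n.+1)%N by rewrite leq_pmull.
    by rewrite -mulnn; move: kN; clear; move: (n.+1) (k * L)%N (_ * _)%N => *; lia.
  move=> /(ler_wpM2r (ltW (expR_gt0 _))) => /(_ (- (4 * y))); rewrite -/delta => /le_trans; apply.
  rewrite Nd (_ : 9 * N ^+ 2 * N ^- 4 = 9 / N * N^-1).
    by rewrite -[X in _ <= X]mulr1; apply: ler_wpM2l; [rewrite divr_ge0 // ltW | rewrite invf_le1].
  by move: (lt0r_neq0 N0); move: (N) => x x0; field.
apply: le_trans (_ : 1 - (6 * n.+1 + k * L + 2 * k)%:R * delta <= _).
  by rewrite lerB.
rewrite cE in m_le tail_count.
have := @prob_consistent_ge R n k b h L r d l w s m p e (S / 12) delta.
rewrite -qE -BE; apply => //.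
exact: capacity.
Qed.
End Numerics.

(* The asymptotic statement *)
From mathcomp Require Import all_classical all_reals all_analysis.
Import numFieldNormedType.Exports.
Local Open Scope classical_set_scope.

(** The logarithmic factors being at least 1, p is at least N ^ (-1/3) and 1 - p at least N ^
    (-1/5). For p up to 1/2 the product N p (1 - p) ^ 3 is at least N ^ (2/3) / 8, for larger p at
    least N ^ (2/5) / 2, the smaller order. *)
Lemma sqrt_npq3_ge (R : realType) (N p : R) :
  1 <= ln N -> (ln N) ^+ 4 / N `^ (1 / 3) <= p -> p <= 1 - (ln N) `^ (5 / 2) / N `^ (1 / 5) ->
  0 < p < 1 /\ expR (ln N / 5) / 4 <= Num.sqrt (N * p * (1 - p) ^+ 3).
Proof.
(* [ln] is 0 on nonpositive numbers. *)
move=> y1; have N0 : 0 < N.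
  by rewrite ltNge; apply/negP => /ln0 yE; move: y1; rewrite yE; lra.
have Ny : expR (ln N) = N by rewrite lnK // posrE.
have powE a : (N `^ a)^-1 = expR (- (a * ln N)) by rewrite /powR gt_eqF // expRN.
rewrite !powE; set y := ln N in y1 Ny *; move=> lo up.
have pge : expR (- (1 / 3 * y)) <= p.
  apply: le_trans lo; rewrite -[X in X <= _]mul1r ler_wpM2r ?expR_ge0 //.
  exact: exprn_ege1.
have qge : expR (- (1 / 5 * y)) <= 1 - p.
  have : 1 * expR (- (1 / 5 * y)) <= y `^ (5 / 2) * expR (- (1 / 5 * y)).
    rewrite ler_wpM2r ?expR_ge0 //.
    by have := @ler_powR R y y1 0 (5 / 2); rewrite powRr0; apply; lra.
  by move: up; rewrite mul1r; move: (expR _) (_ * _) => u v; lra.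
have p0 : 0 < p := lt_le_trans (expR_gt0 _) pge.
have q0 : 0 < 1 - p := lt_le_trans (expR_gt0 _) qge.
split; first by rewrite p0 -subr_gt0.
have E2 : expR (2 / 5 * y) / 16 <= N * p * (1 - p) ^+ 3.
  rewrite -[N * p * _]mulrA -Ny; case: (lerP p (1 / 2)) => p12.
    have e1 : expR (- (1 / 3 * y)) / 8 <= p * (1 - p) ^+ 3.
      apply: ler_pM; rewrite ?expR_ge0 ?invr_ge0 //.
      rewrite (_ : 8^-1 = (1 / 2) ^+ 3); last by field.
      by apply: lerXn2r; rewrite ?nnegrE; lra.
    apply: le_trans (_ : expR y * (expR (- (1 / 3 * y)) / 8) <= _); last by rewrite ler_wpM2l ?expR_ge0.
    rewrite [X in _ <= X]mulrA -expRD; apply: ler_pM; rewrite ?expR_ge0 ?ler_expR //; lra.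
  have e1 : (1 / 2) * expR (- (1 / 5 * y)) ^+ 3 <= p * (1 - p) ^+ 3.
    apply: ler_pM; rewrite ?exprn_ge0 ?expR_ge0 ?(ltW p12) //.
    by apply: lerXn2r; rewrite ?nnegrE ?expR_ge0 // ltW.
  apply: le_trans (_ : expR y * ((1 / 2) * expR (- (1 / 5 * y)) ^+ 3) <= _); last by rewrite ler_wpM2l ?expR_ge0.
  rewrite -expRM_natl mulrCA -expRD mulrC; apply: ler_pM; rewrite ?expR_ge0 ?ler_expR //; lra.
have -> : expR (y / 5) / 4 = Num.sqrt (expR (2 / 5 * y) / 16).
  rewrite (_ : expR (2 / 5 * y) / 16 = (expR (y / 5) / 4) ^+ 2).
    by rewrite sqrtr_sqr ger0_norm // divr_ge0 ?expR_ge0.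
  rewrite exprMn -expRM_natl; congr (expR _ * _); lra.
by rewrite ler_wsqrtr.
Qed.

(** The term of order 10 of the exponential series outgrows y ^ 9. *)
Lemma expR_beats_power (R : realType) (C : R) : 0 <= C ->
  exists Y : R, forall y, 1 <= y -> Y <= y -> C * y ^+ 9 <= expR (y / 5) / 4.
Proof.
move=> C0; have [F F0 expF] : exists2 F : R, 0 < F & forall x, 0 <= x -> x ^+ 10 / F <= expR x.
  exists (9.+1)`!%:R => [|x x0]; first by rewrite ltr0n fact_gt0.
  by apply: le_trans (expR_ge1Dxn 9 x0); rewrite lerDr.
pose A := 5 ^+ 10 * F; have A0 : 0 < A by rewrite mulr_gt0 ?exprn_gt0.
exists (4 * C * A) => y y1 Yy.
have y0 : 0 <= y / 5 by rewrite divr_ge0 // (le_trans ler01).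
rewrite ler_pdivlMr //; apply: le_trans (expF _ y0).
rewrite (_ : _ / F = y ^+ 10 / A); last by rewrite /A invfM exprMn exprVn mulrA.
rewrite ler_pdivlMr // [y ^+ 10]exprS (_ : _ * A = 4 * C * A * y ^+ 9); last by ring.
by rewrite ler_wpM2r // exprn_ge0 // (le_trans ler01).
Qed.

Theorem theorem1p2 (R : realType) (p : nat -> R)
  (hp : \forall n \near \oo,
     ((ln (n%:R : R)) ^+ 4) / ((n%:R : R) `^ (1 / 3)) <= p n
     /\ p n <= 1 - ((ln (n%:R : R)) `^ (5 / 2)) / ((n%:R : R) `^ (1 / 5))) :
  Dnp_prob (p n) (@consistent 'I_n) @[n --> \oo] --> (1 : R).
Proof.
have [C [C1 large]] := prob_consistent_large R.
have [Y beats] := expR_beats_power (le_trans ler01 C1).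
have lower m (x : R) : (0 < m)%N -> 1 <= ln (m%:R : R) -> Y <= ln (m%:R : R) ->
    C <= ln (m%:R : R) -> 0 < x < 1 ->
    expR (ln m%:R / 5) / 4 <= Num.sqrt (m%:R * x * (1 - x) ^+ 3) ->
    1 - 9 / m%:R <= Dnp_prob x (@consistent 'I_m).
  case: m => // m _ y1 yY yC x01 Nq; apply: large => //.
  by apply: le_trans Nq; apply: beats.
apply: (@squeeze_cvgr _ _ _ _ (fun n => 1 - 9 / n%:R) (fun=> 1)); last 2 first.
- rewrite -[X in _ --> X]subr0; apply: cvgB; first exact: cvg_cst.
  rewrite -[X in _ --> X](mulr0 9); apply: cvgMr.
  apply/gtr0_cvgV0; last exact: cvgr_idn.
  by exists 1%N => // n /= n1; rewrite ltr0n.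
- exact: cvg_cst.
near=> n.
have n1 : (0 < n)%N by near: n; exists 1%N.
have ln_ge (x : R) : expR x <= n%:R -> x <= ln (n%:R : R).
  by move=> xn; rewrite -[x]expRK ler_ln ?posrE ?expR_gt0 ?ltr0n.
have y1 : 1 <= ln (n%:R : R) by apply: ln_ge; near: n; exact: nbhs_infty_ger.
have yY : Y <= ln (n%:R : R) by apply: ln_ge; near: n; exact: nbhs_infty_ger.
have yC : C <= ln (n%:R : R) by apply: ln_ge; near: n; exact: nbhs_infty_ger.
have [lo up] : ((ln (n%:R : R)) ^+ 4) / ((n%:R : R) `^ (1 / 3)) <= p n
     /\ p n <= 1 - ((ln (n%:R : R)) `^ (5 / 2)) / ((n%:R : R) `^ (1 / 5)) by near: n.
have [p01 Nq] := sqrt_npq3_ge y1 lo up.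
apply/andP; split; first exact: lower Nq.
rewrite probE prob_le1 //; case/andP: p01 => ? ?; rewrite !ltW //.
Unshelve. all: by end_near.
Qed.
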